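(* Let $\varrho\in\mathcal{B}$ be in GHS with $\int x^2\,d\varrho(x)=1$ (so that the critical inverse temperature is $\beta_c=1$), and let $\beta>0$ be such that $G_\varrho(\beta,\cdot)$ has a unique global minimum $\alpha$ (i.e. $0<\beta\le1$), of type $k$ and strength $\mu$. Assume that the single-spin random variables $X_i$ are bounded $\varrho$-a.s. (i.e. $\varrho$ has bounded support). In the case $k=1$ (where $0<\beta<1$) there is a constant $C$, depending on $\beta$ but not on $n$, such that $$\sup_{z\in\mathbb{R}}\Big|P_n\Big(\frac{S_n}{\sqrt n}\le z\Big)-\Phi_W(z)\Big|\le C\,n^{-1/2},$$ where $W:=S_n/\sqrt n$ and $\Phi_W$ denotes the distribution function of the normal distribution with mean zero and variance $\mathbb{E}(W^2)$. For $k\ge2$ there is a constant $C_k$, not depending on $n$, such that $$\sup_{z\in\mathbb{R}}\Big|P_n\Big(\frac{S_n-n\alpha}{n^{1-1/2k}}\le z\Big)-\widehat F_{W,k}(z)\Big|\le C_k\,n^{-1/k},$$ where $W:=\frac{S_n-n\alpha}{n^{1-1/2k}}$, $\widehat F_{W,k}(z):=\int_{-\infty}^z\widehat f_{W,k}(x)\,dx$ and $$\widehat f_{W,k}(x):=\frac{\exp\big(-\frac{x^{2k}}{2k\,\mathbb{E}(W^{2k})}\big)}{\int_{\mathbb{R}}\exp\big(-\frac{y^{2k}}{2k\,\mathbb{E}(W^{2k})}\big)\,dy}.$$ Here $\mathbb{E}$ is the expectation with respect to $P_n=P_{n,\beta}$.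
   Context: $\mathcal{B}$ is the class of non-degenerate symmetric Borel probability measures $\varrho$ on $\mathbb{R}$ with $\int\exp(bx^2/2)\,d\varrho(x)<\infty$ for all $b>0$. The general Curie–Weiss measure $P_n=P_{n,\beta}$ on $\mathbb{R}^n$ is the law of the spins $(X_1,\dots,X_n)$ given by $$dP_{n,\beta}(x)=\frac1{Z_n(\beta)}\exp\Big(\frac{\beta}{2n}\big(\sum_{i=1}^nx_i\big)^2\Big)\prod_{i=1}^nd\varrho(x_i),$$ and $S_n=\sum_{i=1}^nX_i$. Put $\phi_\varrho(s)=\log\int e^{sx}\,d\varrho(x)$ and $G_\varrho(\beta,s)=\frac{\beta s^2}{2}-\phi_\varrho(\beta s)$. A minimum $\alpha$ of $G=G_\varrho(\beta,\cdot)$ has type $k\in\mathbb{N}$, $k\ge1$, and strength $\mu>0$ if $G(s)=G(\alpha)+\frac{\mu(s-\alpha)^{2k}}{(2k)!}+\mathcal{O}((s-\alpha)^{2k+1})$ as $s\to\alpha$. GHS is the set of $\varrho\in\mathcal{B}$ satisfying the Griffiths–Hurst–Sherman inequality $\frac{d^3}{ds^3}\phi_\varrho(s)\le0$ for all $s\ge0$, which in its multi-site formulation reads: $\frac{\partial^3}{\partial h_i\partial h_j\partial h_k}\log Z_{n,\beta,h_1,\dots,h_n}\le0$ for all (not necessarily distinct) $i,j,k\in\{1,\dots,n\}$, all $n$, $\beta>0$ and $h_1,\dots,h_n\ge0$, where $Z_{n,\beta,h_1,\dots,h_n}=\int\exp\big(\frac{\beta}{2n}(\sum_ix_i)^2+\beta\sum_ih_ix_i\big)\,d\varrho^{\otimes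 n}(x)$. For $\varrho\in$ GHS with variance one: $G_\varrho(\beta,\cdot)$ has the origin as unique global minimum for $0<\beta\le1$, of type $1$ if $\beta<1$ and of type $k\ge2$ if $\beta=1$, and it has exactly two global minima for $\beta>1$. *)

(* Defs.v *)
From HB Require Import structures.
From mathcomp Require Import all_boot all_order all_algebra.
From mathcomp Require Import all_classical all_reals all_analysis.
From mathcomp Require Import measurable_realfun.
Set Implicit Arguments.
Unset Strict Implicit.
Unset Printing Implicit Defensive.
Import Order.TTheory GRing.Theory Num.Theory.
Import numFieldNormedType.Exports.
Local Open Scope classical_set_scope.
Local Open Scope ring_scope.

Section power_probability_cons.
Context d (T : measurableType d) (R : realType) (n : nat).

Definition tuple_cons (x : T * n.-tuple T) : n.+1.-tuple T :=
  [tuple of x.1 :: x.2].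

Lemma measurable_tuple_cons : measurable_fun setT tuple_cons.
Proof. by apply: measurable_cons => //; exact: measurable_snd. Qed.

HB.instance Definition _ :=
  isMeasurableFun.Build _ _ _ _ tuple_cons measurable_tuple_cons.

End power_probability_cons.

(* The n-fold product of rho: the image of rho \x rho^(n-1) under
   (x, t) |-> x :: t, with the point mass at the empty tuple for n = 0. *)
Fixpoint power_probability d (T : measurableType d) (R : realType)
    (rho : probability T R) (n : nat) : probability (n.-tuple T) R :=
  match n with
  | 0 => dirac [tuple]
  | m.+1 => distribution (rho \x power_probability rho m)%E (@tuple_cons _ T m)
  end.

Lemma power_probabilityE d (T : measurableType d) (R : realType)
    (rho : probability T R) (n : nat) (A : 'I_n -> set T) :
  (forall i, measurable (A i)) ->
  power_probability rho n [set x | forall i, A i (tnth x i)] =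
  (\prod_(i < n) rho (A i))%E.
Proof.
elim: n A => [|n IH] A mA.
  rewrite big_ord0 /= diracE mem_set//= => i; by case: i.
rewrite big_ord_recl -IH// /= /distribution /pushforward.
rewrite -[RHS]product_measure1E//; last first.
  rewrite (_ : [set x | _] = \bigcap_(i in setT) ((@tnth n T)^~ i @^-1` A (lift ord0 i))); last first.
    by apply/seteqP; split => [x h i _|x h i]; exact: h.
  apply: fin_bigcap_measurable => // i _.
  by rewrite -[X in measurable X]setTI; exact: measurable_tnth.
congr product_measure1; apply/seteqP; split => [[x t]/= h|[x t]/= [Ax At] i].
  split; first by have := h ord0; rewrite tnth0.
  by move=> i; have := h (lift ord0 i); rewrite tnthS.
by case: (unliftP ord0 i) => [j|] ->; rewrite ?tnthS ?tnth0.
Qed.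

Section curie_weiss.
Context (R : realType) (rho : probability (measurableTypeR R) R).
Context (beta : R) (n : nat).
Local Notation spins := (n.-tuple (measurableTypeR R)).

Definition spin_sum (x : spins) : R := \sum_(i < n) tnth x i.

Lemma measurable_spin_sum : measurable_fun setT spin_sum.
Proof. by apply: measurable_sum => i; exact: measurable_tnth. Qed.

Definition cw_density (x : spins) : R :=
  expR (beta / (2 * n%:R) * spin_sum x ^+ 2).

Lemma measurable_cw_density : measurable_fun setT cw_density.
Proof.
apply: measurableT_comp => //; apply: (measurableT_comp (mulrl_measurable _)).
by apply: measurable_funX; exact: measurable_spin_sum.
Qed.

Definition cw_weight (A : set spins) : \bar R :=
  (\int[power_probability rho n]_(x in A) (cw_density x)%:E)%E.

Let cw_weight0 : cw_weight set0 = 0%E.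
Proof. by rewrite /cw_weight integral_set0. Qed.

Let cw_weight_ge0 A : (0 <= cw_weight A)%E.
Proof. by apply: integral_ge0 => x _; rewrite lee_fin expR_ge0. Qed.

Let cw_weight_sigma_additive : semi_sigma_additive cw_weight.
Proof.
apply: semi_sigma_additive_nng_induced.
- by apply/measurable_EFinP; exact: measurable_cw_density.
- by move=> x; rewrite lee_fin expR_ge0.
Qed.

HB.instance Definition _ := isMeasure.Build _ _ _ cw_weight
  cw_weight0 cw_weight_ge0 cw_weight_sigma_additive.

(* mnormalize falls back on its second argument only when the total mass is 0
   or +oo, which cw_weight_fin_pos excludes for rho in classB; curie_weissE
   gives the explicit formula. *)
Definition curie_weiss : probability spins R :=
  mnormalize cw_weight (power_probability rho n).

End curie_weiss.
Arguments cw_density {R} beta n x.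
Arguments cw_weight {R} rho beta n A.

Section spin_classes.
Context (R : realType).
Implicit Types rho : probability (measurableTypeR R) R.

Definition classB rho : Prop :=
  [/\ forall a : R, rho [set a] <> 1%E,
      forall A : set R, measurable A -> rho [set x | A (- x)] = rho A &
      forall b : R, 0 < b ->
        (\int[rho]_x (expR (b * x ^+ 2 / 2))%:E < +oo)%E].

(* For rho in classB the integral is finite for every s and cumulant rho is
   smooth, so the total operators \int (real-valued), ln and derive1n below
   return genuine values. *)
Definition cumulant rho (s : R) : R := ln (\int[rho]_x expR (s * x)).

Definition classGHS rho : Prop :=
  classB rho /\ forall s : R, 0 <= s -> derive1n 3 (cumulant rho) s <= 0.

Definition cwG rho (beta s : R) : R :=
  beta * s ^+ 2 / 2 - cumulant rho (beta * s).

Definition bounded_support rho : Prop :=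
  exists M : R, {ae rho, forall x, `|x| <= M}.

Definition unique_global_min (G : R -> R) (alpha : R) : Prop :=
  forall s, s != alpha -> G alpha < G s.

Definition min_type (G : R -> R) (alpha : R) (k : nat) (mu : R) : Prop :=
  [/\ (1 <= k)%N, 0 < mu &
      (fun s => G s - (G alpha + mu * (s - alpha) ^+ (2 * k) / (2 * k)`!%:R))
        =O_ alpha (fun s => (s - alpha) ^+ (2 * k).+1)].

End spin_classes.

Lemma integral_power_probability_prod d (T : measurableType d) (R : realType)
    (rho : probability T R) (f : T -> R) (n : nat) :
  measurable_fun setT f -> (forall x, 0 <= f x) ->
  (\int[power_probability rho n]_x (\prod_(i < n) f (tnth x i))%:E =
   \prod_(i < n) \int[rho]_x (f x)%:E)%E.
Proof.
move=> mf f0; elim: n => [|n IH].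
  rewrite big_ord0 (eq_integral (cst 1%E)); last by move=> x _; rewrite big_ord0.
  rewrite integral_cst// mul1e.
  exact: (probability_setT (power_probability rho 0)).
have mF m : measurable_fun setT
    (fun x : m.-tuple T => (\prod_(i < m) f (tnth x i))%:E).
  apply/measurable_EFinP; apply: measurable_prod => i _.
  by apply: measurableT_comp => //; exact: measurable_tnth.
have F0 m (x : m.-tuple T) : (0 <= (\prod_(i < m) f (tnth x i))%:E)%E.
  by rewrite lee_fin prodr_ge0.
have mFc : measurable_fun setT
    ((fun x => (\prod_(i < n.+1) f (tnth x i))%:E) \o @tuple_cons _ T n).
  exact: (measurableT_comp (mF n.+1) (@measurable_tuple_cons _ T n)).
rewrite big_ord_recl -IH /= (ge0_integral_distribution _ (mF _) (F0 _)).
rewrite (fubini_tonelli1 _ mFc (fun=> F0 _ _)).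
have mEf : measurable_fun setT (fun x => (f x)%:E) by exact/measurable_EFinP.
have Ef0 x : setT x -> (0 <= (f x)%:E)%E by rewrite lee_fin.
have I0 : (0 <= \int[power_probability rho n]_x
    (\prod_(i < n) f (tnth x i))%:E)%E by exact: integral_ge0.
rewrite -(ge0_integralZr _ measurableT mEf Ef0 I0).
apply: eq_integral => x _.
rewrite /fubini_F.
rewrite -(ge0_integralZl_EFin _ measurableT (fun y _ => F0 n y) (mF n) (f0 x)).
apply: eq_integral => t _ /=; rewrite big_ord_recl /tuple_cons tnth0 EFinM /=.
by under eq_bigr do rewrite tnthS.
Qed.

Lemma sqr_sum_le (R : realFieldType) (n : nat) (x : 'I_n -> R) :
  (\sum_(i < n) x i) ^+ 2 <= n%:R * \sum_(i < n) x i ^+ 2.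
Proof.
have : 0 <= \sum_(i < n) \sum_(j < n) (x i - x j) ^+ 2.
  by apply: sumr_ge0 => i _; apply: sumr_ge0 => j _; exact: sqr_ge0.
under eq_bigr do (under eq_bigr do rewrite sqrrB; rewrite big_split/= sumrB).
rewrite big_split/= sumrB.
have -> : \sum_(i < n) \sum_(j < n) x i ^+ 2 = n%:R * \sum_(i < n) x i ^+ 2.
  by rewrite mulr_sumr; apply: eq_bigr => i _; rewrite sumr_const card_ord mulr_natl.
have -> : \sum_(i < n) \sum_(j < n) x j ^+ 2 = n%:R * \sum_(i < n) x i ^+ 2.
  by rewrite sumr_const card_ord mulr_natl.
have -> : \sum_(i < n) \sum_(j < n) (x i * x j) *+ 2 = 2 * (\sum_(i < n) x i) ^+ 2.
  rewrite expr2 mulr_suml mulr_sumr; apply: eq_bigr => i _.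
  by rewrite mulr_sumr mulr_sumr; apply: eq_bigr => j _; rewrite mulr_natl.
rewrite addrAC -mulr2n -[X in 0 <= X - _]mulr_natl -mulrBr.
by rewrite pmulr_rge0// subr_ge0.
Qed.

Lemma mnormalize_ltyE d (T : measurableType d) (R : realType)
    (m : {measure set T -> \bar R}) (P : probability T R) (A : set T) :
  (0 < m setT < +oo)%E ->
  mnormalize m P A = ((fine (m setT))^-1%:E * m A)%E.
Proof.
by move=> /andP[m0 moo]; rewrite muleC /mnormalize gt_eqF//= lt_eqF.
Qed.

Section curie_weissE.
Context (R : realType) (rho : probability (measurableTypeR R) R) (beta : R).

Lemma cw_weight_fin_pos (n : nat) : classB rho -> 0 < beta -> (0 < n)%N ->
  (0 < cw_weight rho beta n setT < +oo)%E.
Proof.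
move=> [_ _ rhoE] b0 n0.
have n0R : 0 < n%:R :> R by rewrite ltr0n.
have c0 : 0 <= beta / (2 * n%:R) by rewrite divr_ge0 ?mulr_ge0 ?ltW.
have mD : measurable_fun setT (fun x => (cw_density beta n x)%:E).
  by apply/measurable_EFinP; exact: measurable_cw_density.
apply/andP; split.
  apply: (@lt_le_trans _ _ (\int[power_probability rho n]_x 1)%E).
    by rewrite integral_cst// mul1e [ltRHS](probability_setT _) lte01.
  apply: ge0_le_integral => // x _.
  by rewrite lee_fin -[leLHS]expR0 ler_expR mulr_ge0 ?sqr_ge0.
pose f (y : measurableTypeR R) : R := expR (beta * y ^+ 2 / 2).
have mf : measurable_fun setT f.
  apply: measurableT_comp => //; apply: (measurableT_comp (mulrr_measurable _)).
  by apply: (measurableT_comp (mulrl_measurable _)); exact: exprn_measurable.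
have f0 y : 0 <= f y by exact: expR_ge0.
apply: (@le_lt_trans _ _
    (\int[power_probability rho n]_x (\prod_(i < n) f (tnth x i))%:E)%E).
  apply: ge0_le_integral => //.
  - by move=> x _; rewrite lee_fin expR_ge0.
  - apply/measurable_EFinP; apply: measurable_prod => i _.
    by apply: (measurableT_comp mf); exact: measurable_tnth.
  - move=> x _; rewrite lee_fin /f -expR_sum ler_expR.
    apply: (le_trans (ler_wpM2l c0 (sqr_sum_le _))).
    rewrite mulrA -mulr_suml -mulr_sumr [leRHS]mulrAC ler_wpM2r//.
      by apply: sumr_ge0 => i _; exact: sqr_ge0.
    by rewrite invfM mulrA divfK ?gt_eqF.
rewrite (integral_power_probability_prod rho n mf f0) ltey_eq.
rewrite prode_fin_num// => i _; rewrite ge0_fin_numE; first exact: rhoE.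
by apply: integral_ge0 => y _; rewrite lee_fin.
Qed.

Lemma curie_weissE (n : nat) (A : set (n.-tuple (measurableTypeR R))) :
  classB rho -> 0 < beta -> (0 < n)%N ->
  curie_weiss rho beta n A =
  ((fine (cw_weight rho beta n setT))^-1%:E *
   \int[power_probability rho n]_(x in A)
     (expR (beta / (2 * n%:R) * (\sum_(i < n) tnth x i) ^+ 2))%:E)%E.
Proof.
move=> rhoB b0 n0; apply: mnormalize_ltyE; exact: cw_weight_fin_pos.
Qed.

End curie_weissE.

Section limit_laws.
Context (R : realType).
Local Notation leb := (@lebesgue_measure R).

Definition cdf_dist d (T : measurableType d) (P : probability T R)
    (W : T -> R) (F : R -> \bar R) : \bar R :=
  ereal_sup [set `|P [set x | (W x <= z)%R] - F z|%E | z in [set: R]].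

(* normal_prob takes the standard deviation, not the variance. *)
Definition normal_cdf (v z : R) : \bar R :=
  normal_prob 0 (Num.sqrt v) `]-oo, z].

Definition fhat (k : nat) (m x : R) : R :=
  expR (- (x ^+ (2 * k) / ((2 * k)%:R * m))) /
  \int[leb]_y expR (- (y ^+ (2 * k) / ((2 * k)%:R * m))).

Definition Fhat (k : nat) (m z : R) : \bar R :=
  (\int[leb]_(x in `]-oo, z]) (fhat k m x)%:E)%E.

End limit_laws.

(* Main.v *)
(** The proof combines the Hubbard-Stratonovich transform with Stein's method.
Give [(s, x)] the weight [exp (beta s S - n beta s^2 / 2)] with respect to
Lebesgue measure times [rho^n], where [S] is the sum of the spins. The marginal
of [x] is the Curie-Weiss measure, the marginal of [s] has density proportional
to [exp (- n G s)], and given [s] the spins are independent with an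
exponentially tilted law. Put [lambda = n^(1/2k)], [U = lambda s] and
[W = lambda S / n]. Integration by parts in [s] replaces powers of [U] by powers
of [W] up to [O(lambda^-2)]. Given [s], singling out one spin gives
[c E(W^(2k-1) f(W)) = E(f'(W))] up to [O(lambda^-2)] and the probability that [W]
falls in a window of width [O(lambda / n)]; the same identity for a truncated
linear [f] bounds that probability. Taking [f = id] yields
[c E(W^(2k)) = 1 + O(lambda^-2)], and taking for [f] the solution of Stein's
equation for the density [exp (- x^(2k) / (2k E(W^(2k))))] yields the rate
[lambda^(1-2k) + lambda^-2]. *)
Require Import Defs.
From HB Require Import structures.
From mathcomp Require Import all_boot all_order all_algebra.
From mathcomp Require Import all_classical all_reals all_analysis.
From mathcomp Require Import measurable_realfun ring lra.
Import Order.TTheory GRing.Theory Num.Theory.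
Import numFieldNormedType.Exports.
Local Open Scope classical_set_scope.
Local Open Scope ring_scope.
Set Implicit Arguments.
Unset Strict Implicit.
Unset Printing Implicit Defensive.

(** * Integrals of locally bounded functions *)

(** Every replacement must cost lambda^-2 rather than lambda^-1. Parity supplies this: G is even, so
    an expansion with remainder s^(2k+1) has in fact remainder s^(2k+2), and the drift s - mean(s),
    a multiple of its derivative, is known up to s^(2k+1). The exponents then separate the two
    cases: lambda^(1-2k) = n^(-1/2) dominates for k = 1, and lambda^-2 = n^(-1/k) for k >= 2. The
    target density has the coefficient 1 / E(W^(2k)), which moves with n, while the Stein identity
    produces the fixed coefficient c. The two differ by O(lambda^-2), and all bounds on the Stein
    solution are explicit in the coefficient, hence uniform on a compact interval around c. For the
    finitely many n where this says nothing, a distance of distribution functions is at most 1. The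
    derivative of the Stein solution jumps at z, and W may have atoms; this is why the probability
    of a small window is needed. Spins bounded only almost surely are truncated, so that all
    integrands are bounded everywhere. *)

Section bounded_integrals.
Context d (T : measurableType d) (R : realType) (P : probability T R).
Implicit Types f g : T -> R.

Lemma bounded_integrable f : measurable_fun setT f ->
  (exists K, forall x, `|f x| <= K) -> P.-integrable setT (EFin \o f).
Proof.
move=> mf [K fK]; apply: measurable_bounded_integrable => //.
  by rewrite (le_lt_trans (probability_le1 P measurableT)) ?ltry.
exists K; split; first exact: num_real.
by move=> x Kx t _ /=; rewrite (le_trans (fK t))// ltW.
Qed.

Lemma probability_Rintegral_cst (K : R) : \int[P]_x K = K.
Proof.
rewrite Rintegral_cst//; have PT : P setT = 1%E by exact: probability_setT.
by rewrite -[RHS]mulr1; congr (_ * _); rewrite -[RHS]/(fine 1%E); congr fine.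
Qed.

Lemma le_normr_Rintegral_cst f (K : R) : measurable_fun setT f ->
  (forall x, `|f x| <= K) -> `|\int[P]_x f x| <= K.
Proof.
move=> mf fK.
have intf : P.-integrable setT (EFin \o f) by apply: bounded_integrable => //; exists K.
apply: (le_trans (le_normr_Rintegral measurableT intf)).
rewrite -[leRHS]probability_Rintegral_cst; apply: le_Rintegral => //.
  exact: (integrable_norm intf).
by apply: bounded_integrable => //; exists `|K|.
Qed.

End bounded_integrals.

(** The class of test functions. A sum of [n] bounded spins stays in a bounded set, so such a
    function of it is integrable. Unlike continuity, the property covers indicators, and it is still
    closed under composition. *)
Definition locally_bounded (R : realType) (g : R -> R) :=
  measurable_fun setT g /\
  forall B : R, exists K : R, forall y : R, `|y| <= B -> `|g y| <= K.

Section locally_bounded_theory.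
Context (R : realType).
Implicit Types f g : R -> R.

Lemma locally_bounded_continuous f : continuous f -> locally_bounded f.
Proof.
move=> cf; split; first exact: continuous_measurable_fun.
move=> B; have [B0|B0] := ltP B 0.
  by exists 0 => y yB; have := le_lt_trans yB B0; rewrite normr_lt0.
have /(@continuous_compact _ _ f) : {within `[-B, B], continuous f}.
  exact: continuous_subspaceT.
move=> /(_ (@segment_compact _ _ _)) /compact_bounded [K [_ HK]].
exists (K + 1) => y yB; apply: (HK (K + 1)); first by rewrite ltrDl.
by exists y => //; rewrite /= in_itv/= -ler_norml.
Qed.

Lemma locally_bounded_cst c : locally_bounded (fun _ : R => c).
Proof. by split => // B; exists `|c|. Qed.

Lemma locally_boundedD f g : locally_bounded f -> locally_bounded g ->
  locally_bounded (fun x => f x + g x).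
Proof.
move=> [mf bf] [mg bg]; split; first exact: measurable_funD.
move=> B; have [K fK] := bf B; have [L gL] := bg B; exists (K + L) => y yB.
by rewrite (le_trans (ler_normD _ _))// lerD ?fK ?gL.
Qed.

Lemma locally_boundedM f g : locally_bounded f -> locally_bounded g ->
  locally_bounded (fun x => f x * g x).
Proof.
move=> [mf bf] [mg bg]; split; first exact: measurable_funM.
move=> B; have [K fK] := bf B; have [L gL] := bg B; exists (K * L) => y yB.
by rewrite normrM ler_pM ?fK ?gL.
Qed.

Lemma locally_boundedN f : locally_bounded f -> locally_bounded (fun x => - f x).
Proof.
move=> [mf bf]; split; first exact: measurableT_comp.
by move=> B; have [K fK] := bf B; exists K => y yB; rewrite normrN fK.
Qed.

Lemma locally_boundedB f g : locally_bounded f -> locally_bounded g ->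
  locally_bounded (fun x => f x - g x).
Proof. by move=> ? ?; apply: locally_boundedD => //; exact: locally_boundedN. Qed.

Lemma locally_bounded_id : locally_bounded (fun x : R => x).
Proof. by apply: locally_bounded_continuous => x; exact: cvg_id. Qed.

Lemma locally_boundedX f p : locally_bounded f -> locally_bounded (fun x => f x ^+ p).
Proof.
move=> lf; elim: p => [|p IH].
  by under eq_fun do rewrite expr0; exact: locally_bounded_cst.
by under eq_fun do rewrite exprS; exact: locally_boundedM.
Qed.

Lemma locally_bounded_norm f : locally_bounded f -> locally_bounded (fun x => `|f x|).
Proof.
move=> [mf bf]; split; first exact: measurableT_comp.
by move=> B; have [K fK] := bf B; exists K => y yB; rewrite normr_id fK.
Qed.

Lemma locally_bounded_comp f g : locally_bounded f -> locally_bounded g ->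
  locally_bounded (fun x => f (g x)).
Proof.
move=> [mf bf] [mg bg]; split; first exact: measurableT_comp.
move=> B; have [K gK] := bg B; have [L fL] := bf K; exists L => y yB.
by rewrite fL// gK.
Qed.

Lemma locally_bounded_exp t : locally_bounded (fun x : R => expR (t * x)).
Proof.
apply: (locally_bounded_comp (locally_bounded_continuous (@continuous_expR R))).
by apply: locally_boundedM; [exact: locally_bounded_cst|exact: locally_bounded_id].
Qed.

Lemma locally_bounded_indic (A : set R) : measurable A ->
  locally_bounded (\1_A : R -> R).
Proof.
move=> mA; split; first exact: measurable_indic.
by move=> B; exists 1 => y _; rewrite indicE; case: (_ \in _); rewrite ?normr1 ?normr0.
Qed.

Lemma locally_bounded_max f g : locally_bounded f -> locally_bounded g ->
  locally_bounded (fun x => Num.max (f x) (g x)).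
Proof.
move=> [mf bf] [mg bg]; split; first exact: measurable_maxr.
move=> B; have [K fK] := bf B; have [L gL] := bg B; exists (Num.max K L) => y yB.
by rewrite le_max; case: (leP (f y) (g y)) => _; rewrite ?(fK _ yB) ?(gL _ yB) ?orbT.
Qed.

Lemma locally_bounded_min f g : locally_bounded f -> locally_bounded g ->
  locally_bounded (fun x => Num.min (f x) (g x)).
Proof.
move=> [mf bf] [mg bg]; split; first exact: measurable_minr.
move=> B; have [K fK] := bf B; have [L gL] := bg B; exists (Num.max K L) => y yB.
by rewrite le_max; case: (leP (f y) (g y)) => _; rewrite ?(fK _ yB) ?(gL _ yB) ?orbT.
Qed.

End locally_bounded_theory.

(** * Sums of independent bounded spins *)

Section Rintegral_fubini.
Context d1 d2 (T1 : measurableType d1) (T2 : measurableType d2) (R : realType).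
Context (m1 : {sigma_finite_measure set T1 -> \bar R})
        (m2 : {sigma_finite_measure set T2 -> \bar R}).
Context (f : T1 * T2 -> R).
Hypothesis intf : (m1 \x m2)%E.-integrable setT (EFin \o f).

Lemma Rintegral_prod1 :
  (forall x, m2.-integrable setT (fun y => (f (x, y))%:E)) ->
  \int[(m1 \x m2)%E]_z f z = \int[m1]_x \int[m2]_y f (x, y).
Proof.
move=> intf2; rewrite /Rintegral -integral12_prod_meas1//; congr fine.
apply: eq_integral => x _; rewrite fineK//.
exact: (integrable_fin_num measurableT (intf2 x)).
Qed.

Lemma Rintegral_prod2 :
  (forall y, m1.-integrable setT (fun x => (f (x, y))%:E)) ->
  \int[(m1 \x m2)%E]_z f z = \int[m2]_y \int[m1]_x f (x, y).
Proof.
move=> intf1; rewrite /Rintegral -integral21_prod_meas1//; congr fine.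
apply: eq_integral => x _; rewrite fineK//.
exact: (integrable_fin_num measurableT (intf1 x)).
Qed.

End Rintegral_fubini.

Lemma measurable_partial_integral d1 d2 (T1 : measurableType d1)
    (T2 : measurableType d2) (R : realType)
    (m1 : {sigma_finite_measure set T1 -> \bar R}) (f : T1 * T2 -> \bar R) :
  measurable_fun setT f -> measurable_fun setT (fubini_G m1 f).
Proof.
move=> mf; have -> : fubini_G m1 f = (fubini_G m1 f^\+ \- fubini_G m1 f^\-)%E.
  apply/funext => y; rewrite [LHS]integralE.
  under eq_integral do rewrite funepos_comp/=.
  by under [X in (_ - X)%E = _]eq_integral do rewrite funeneg_comp/=.
by apply: emeasurable_funB; apply: measurable_fun_fubini_tonelli_G => //;
  [exact: measurable_funepos|exact: measurable_funeneg].
Qed.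

Section iid_sum.
Context d (T : measurableType d) (R : realType) (rho : probability T R).
Context (X : T -> R) (mX : measurable_fun setT X) (M : R).
Hypothesis bX : forall t, `|X t| <= M.
Implicit Types (f g h w : R -> R) (y c : R).

Definition iid_sum n (x : n.-tuple T) : R := \sum_(i < n) X (tnth x i).

Definition Esum n (g : R -> R) : R := \int[power_probability rho n]_x g (iid_sum x).

Lemma measurable_iid_sum n : measurable_fun setT (@iid_sum n).
Proof.
apply: measurable_sum => i; apply: (measurableT_comp mX).
exact: measurable_tnth.
Qed.

Lemma iid_sum_bounded n (x : n.-tuple T) : `|iid_sum x| <= n%:R * M.
Proof.
rewrite (le_trans (ler_norm_sum _ _ _))//.
rewrite -[X in X%:R * _]card_ord mulr_natl -sumr_const.
by apply: ler_sum => i _; exact: bX.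
Qed.

Lemma iid_sum_cons n (t : T) (x : n.-tuple T) :
  iid_sum (tuple_cons (t, x)) = X t + iid_sum x.
Proof.
rewrite /iid_sum big_ord_recl tnth0; congr (_ + _).
by apply: eq_bigr => i _; rewrite tnthS.
Qed.

Lemma Esum_integrable n g : locally_bounded g ->
  (power_probability rho n).-integrable setT (fun x => (g (iid_sum x))%:E).
Proof.
move=> [mg bg]; apply: (@bounded_integrable _ _ _ _ (g \o @iid_sum n)).
  by apply: measurableT_comp => //; exact: measurable_iid_sum.
have [K gK] := bg (n%:R * M); exists K => x; apply: gK; exact: iid_sum_bounded.
Qed.

Lemma Esum0 g : Esum 0 g = g 0.
Proof.
rewrite /Esum /=; transitivity (\int[power_probability rho 0]_x (g 0)).
  by apply: eq_Rintegral => x _; rewrite /iid_sum big_ord0.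
exact: probability_Rintegral_cst.
Qed.

Definition Espin (h : R -> R) : R := \int[rho]_t h (X t).

Lemma spin_integrable h : locally_bounded h ->
  rho.-integrable setT (fun t => (h (X t))%:E).
Proof.
move=> [mh bh]; apply: (@bounded_integrable _ _ _ _ (fun t => h (X t))).
  exact: measurableT_comp.
by have [K hK] := bh M; exists K => x; apply: hK.
Qed.

Let prod_integrable n g : locally_bounded g ->
  (rho \x power_probability rho n)%E.-integrable setT
    (fun z => (g (X z.1 + iid_sum z.2))%:E).
Proof.
move=> [mg bg].
apply: (@bounded_integrable _ _ _ (rho \x power_probability rho n)%E
  (fun z => g (X z.1 + iid_sum z.2))).
  apply: measurableT_comp => //; apply: measurable_funD.
    exact: (measurableT_comp mX measurable_fst).
  exact: (measurableT_comp (@measurable_iid_sum n) measurable_snd).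
have [K gK] := bg (M + n%:R * M); exists K => x; apply: gK.
by rewrite (le_trans (ler_normD _ _))// lerD// iid_sum_bounded.
Qed.

Let EsumSprod n g : locally_bounded g ->
  Esum n.+1 g = \int[(rho \x power_probability rho n)%E]_z g (X z.1 + iid_sum z.2).
Proof.
move=> lg; rewrite /Esum/= /Rintegral.
rewrite (integral_distribution
  (f := fun x : n.+1.-tuple T => (g (iid_sum x))%:E)); last 2 first.
- apply/measurable_EFinP; apply: measurableT_comp lg.1 _.
  exact: measurable_iid_sum.
- have := prod_integrable n lg; congr (_.-integrable _ _).
  by apply/funext => -[t x] /=; rewrite iid_sum_cons.
by congr fine; apply: eq_integral => -[t x] _ /=; rewrite iid_sum_cons.
Qed.

Lemma locally_bounded_shift g y : locally_bounded g ->
  locally_bounded (fun x => g (x + y)).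
Proof.
move=> lg; apply: (@locally_bounded_comp _ g (fun x => x + y)) => //.
by apply: locally_boundedD; [exact: locally_bounded_id|exact: locally_bounded_cst].
Qed.

Lemma EsumS n g : locally_bounded g ->
  Esum n.+1 g = Esum n (fun y => Espin (fun x => g (x + y))).
Proof.
move=> lg; rewrite EsumSprod// Rintegral_prod2//.
  exact: prod_integrable.
move=> x; apply: (spin_integrable (h := fun z => g (z + iid_sum x))).
exact: locally_bounded_shift.
Qed.

(** Integrating out one spin stays inside the class of test functions, so that spins can be peeled
    off repeatedly. *)
Lemma Espin_shift_locally_bounded (w g : R -> R) :
  locally_bounded w -> locally_bounded g ->
  locally_bounded (fun y => Espin (fun x => w x * g (x + y))).
Proof.
move=> [mw bw] [mg bg].
have mwg : measurable_fun setT (fun z : T * R => w (X z.1) * g (X z.1 + z.2)).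
  apply: measurable_funM.
    by apply: measurableT_comp => //; exact: (measurableT_comp mX measurable_fst).
  apply: measurableT_comp => //; apply: measurable_funD => //.
  exact: (measurableT_comp mX measurable_fst).
split.
  apply: (measurableT_comp (fine_measurable measurableT)).
  pose f (z : T * R) := (w (X z.1) * g (X z.1 + z.2))%:E.
  have mf : measurable_fun setT f by exact/measurable_EFinP.
  exact: (@measurable_partial_integral _ _ T (measurableTypeR R) R rho _ mf).
move=> B; have [K wK] := bw M; have [L gL] := bg (M + B); exists (K * L) => y yB.
apply: le_normr_Rintegral_cst.
  apply: measurable_funM; first exact: measurableT_comp.
  by apply: measurableT_comp => //; exact: measurable_funD.
move=> t; rewrite normrM ler_pM ?wK ?gL//.
by rewrite (le_trans (ler_normD _ _))// lerD.
Qed.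

Lemma EsumD n f g : locally_bounded f -> locally_bounded g ->
  Esum n (fun y => f y + g y) = Esum n f + Esum n g.
Proof. by move=> lf lg; apply: RintegralD => //; exact: Esum_integrable. Qed.

Lemma EsumZ n c g : locally_bounded g ->
  Esum n (fun y => c * g y) = c * Esum n g.
Proof. by move=> lg; apply: RintegralZl => //; exact: Esum_integrable. Qed.

Lemma EsumB n f g : locally_bounded f -> locally_bounded g ->
  Esum n (fun y => f y - g y) = Esum n f - Esum n g.
Proof. by move=> lf lg; apply: RintegralB => //; exact: Esum_integrable. Qed.

Lemma le_Esum n f g : locally_bounded f -> locally_bounded g ->
  (forall y, f y <= g y) -> Esum n f <= Esum n g.
Proof. by move=> lf lg fg; apply: le_Rintegral => //; exact: Esum_integrable. Qed.

Lemma EspinD f g : locally_bounded f -> locally_bounded g ->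
  Espin (fun y => f y + g y) = Espin f + Espin g.
Proof. by move=> lf lg; apply: RintegralD => //; exact: spin_integrable. Qed.

Lemma EspinZ c g : locally_bounded g ->
  Espin (fun y => c * g y) = c * Espin g.
Proof. by move=> lg; apply: RintegralZl => //; exact: spin_integrable. Qed.

Lemma EspinB f g : locally_bounded f -> locally_bounded g ->
  Espin (fun y => f y - g y) = Espin f - Espin g.
Proof. by move=> lf lg; apply: RintegralB => //; exact: spin_integrable. Qed.

Lemma le_Espin f g : locally_bounded f -> locally_bounded g ->
  (forall x, `|x| <= M -> f x <= g x) -> Espin f <= Espin g.
Proof.
move=> lf lg fg; apply: le_Rintegral => //; try exact: spin_integrable.
by move=> t _; exact: fg.
Qed.

(** Exchangeability of two spins, by Fubini: the spin that carries the factor [x] can be integrated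
    first or last. *)
Lemma Espin_exchange g y : locally_bounded g ->
  Espin (fun x => x * Espin (fun x' => g (x' + (x + y)))) =
  Espin (fun x' => Espin (fun x => x * g (x + (x' + y)))).
Proof.
move=> lg; have lid := @locally_bounded_id R.
pose F (z : T * T) := X z.1 * g (X z.1 + (X z.2 + y)).
have mF : measurable_fun setT F.
  have m1 := measurableT_comp mX (@measurable_fst _ _ T T).
  have m2 := measurableT_comp mX (@measurable_snd _ _ T T).
  apply: measurable_funM => //; apply: measurableT_comp lg.1 _.
  by apply: measurable_funD => //; exact: measurable_funD.
have intF : (rho \x rho)%E.-integrable setT (EFin \o F).
  apply: (@bounded_integrable _ _ _ (rho \x rho)%E) => //.
  have [K gK] := lg.2 (M + (M + `|y|)); exists (M * K) => z.
  rewrite normrM ler_pM// gK//.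
  by do 2! rewrite (le_trans (ler_normD _ _))// lerD//.
transitivity (\int[(rho \x rho)%E]_z F z).
  rewrite Rintegral_prod1//; last first.
    move=> t; have := @spin_integrable (fun x => X t * g (X t + (x + y))).
    apply; apply: locally_boundedM; first exact: locally_bounded_cst.
    apply: locally_bounded_comp => //; do 2 (apply: locally_boundedD => //; try exact: locally_bounded_cst).
  apply: eq_Rintegral => t _ /=; rewrite -EspinZ; last first.
    exact: locally_bounded_shift.
  by apply: eq_Rintegral => t' _; rewrite /F/= addrCA.
rewrite Rintegral_prod2// => t; have := @spin_integrable (fun x => x * g (x + (X t + y))).
by apply; apply: locally_boundedM => //; exact: locally_bounded_shift.
Qed.

(** By exchangeability the [n.+1] summands of the factor [y] contribute equally. Peeling off one
    spin gives one such term; the others come from the induction hypothesis after the peeled spin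
    has been exchanged with the one singled out. *)
Lemma Esum_idM n g : locally_bounded g ->
  Esum n.+1 (fun y => y * g y) =
  n.+1%:R * Esum n (fun y => Espin (fun x => x * g (x + y))).
Proof.
elim: n g => [|n IH] g lg.
  rewrite EsumS ?mul1r ?Esum0//; last first.
    by apply: locally_boundedM => //; exact: locally_bounded_id.
  by congr Espin; apply/funext => x; rewrite !addr0.
have lid := @locally_bounded_id R.
have lg' y := locally_bounded_shift y lg.
have lT1 := Espin_shift_locally_bounded lid lg.
have lT : locally_bounded (fun y => Espin (fun x => g (x + y))).
  have := Espin_shift_locally_bounded (locally_bounded_cst 1) lg.
  by under eq_fun do under eq_fun do rewrite mul1r.
rewrite EsumS; last exact: locally_boundedM.
transitivity (Esum n.+1 (fun y => Espin (fun x => x * g (x + y)) +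
                                  y * Espin (fun x => g (x + y)))).
  congr Esum; apply/funext => y; rewrite -EspinZ// -EspinD; last 2 first.
  - exact: locally_boundedM.
  - by apply: locally_boundedM => //; exact: locally_bounded_cst.
  by congr Espin; apply/funext => x; rewrite mulrDl.
rewrite EsumD//; last exact: locally_boundedM.
rewrite IH// -[n.+2%:R]natr1 mulrDl mul1r addrC; congr (_ + _); congr (_ * _).
rewrite EsumS//; congr Esum; apply/funext => y.
exact: Espin_exchange.
Qed.

End iid_sum.

(** * Exponentially tilted spins *)

Ltac lb := repeat first
  [ assumption
  | exact: locally_bounded_cst
  | exact: locally_bounded_id
  | exact: locally_bounded_exp
  | apply: locally_boundedB
  | apply: locally_boundedD
  | apply: locally_boundedN
  | apply: locally_boundedM
  | apply: locally_boundedX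
  | exact: locally_bounded_shift ].

Section tilted_sum.
Context d (T : measurableType d) (R : realType) (rho : probability T R).
Context (X : T -> R) (mX : measurable_fun setT X) (M : R).
Hypotheses (M0 : 0 <= M) (bX : forall t, `|X t| <= M).
Implicit Types (f g h w : R -> R) (t y c : R).
Local Notation Esum := (Esum rho X).
Local Notation Espin := (Espin rho X).

Lemma Espin_cst c : Espin (fun=> c) = c.
Proof. exact: probability_Rintegral_cst. Qed.

Lemma Esum_cst n c : Esum n (fun=> c) = c.
Proof. exact: probability_Rintegral_cst. Qed.

Lemma normr_Espin_le f g : locally_bounded f -> locally_bounded g ->
  (forall x, `|x| <= M -> `|f x| <= g x) -> `|Espin f| <= Espin g.
Proof.
move=> lf lg fg; rewrite ler_norml; apply/andP; split.
  rewrite -[leLHS]mulN1r -(EspinZ _ mX bX)//; apply: (le_Espin _ mX bX); try by lb.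
  by move=> x /fg; rewrite ler_norml mulN1r => /andP[].
by apply: (le_Espin _ mX bX) => // x /fg; rewrite ler_norml => /andP[].
Qed.

Lemma normr_Esum_le n f g : locally_bounded f -> locally_bounded g ->
  (forall x, `|f x| <= g x) -> `|Esum n f| <= Esum n g.
Proof.
move=> lf lg fg; rewrite ler_norml; apply/andP; split.
  rewrite -[leLHS]mulN1r -(EsumZ _ mX bX)//; apply: (le_Esum _ mX bX); try by lb.
  by move=> x; have := fg x; rewrite ler_norml mulN1r => /andP[].
by apply: (le_Esum _ mX bX) => // x; have := fg x; rewrite ler_norml => /andP[].
Qed.

Lemma locally_bounded_Espin_shift g : locally_bounded g ->
  locally_bounded (fun y => Espin (fun x => g (x + y))).
Proof.
move=> lg; have := Espin_shift_locally_bounded rho mX bX (locally_bounded_cst 1) lg.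
by under eq_fun do under eq_fun do rewrite mul1r.
Qed.

Lemma Esum_centered n c g h : locally_bounded g -> locally_bounded h ->
  Esum n.+1 (fun s => (s - n.+1%:R * c) * g s - n.+1%:R * h s) =
  n.+1%:R * Esum n (fun y => Espin (fun x => (x - c) * g (x + y) - h (x + y))).
Proof.
move=> lg lh.
have l1 := Espin_shift_locally_bounded rho mX bX (@locally_bounded_id R) lg.
have l2 := locally_bounded_Espin_shift lg.
have l3 := locally_bounded_Espin_shift lh.
transitivity (Esum n.+1 (fun s => s * g s - (n.+1%:R * c * g s + n.+1%:R * h s))).
  by congr (Esum _ _); apply/funext => s; ring.
rewrite (EsumB _ mX bX) ?(EsumD _ mX bX) ?(EsumZ _ mX bX); try by lb.
rewrite (Esum_idM _ mX bX)// !(EsumS _ mX bX)//.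
rewrite -(mulrA _ c) -mulrDr -mulrBr; congr (_ * _).
rewrite -(EsumZ _ mX bX)// -(EsumD _ mX bX); try by lb.
rewrite -(EsumB _ mX bX); try by lb.
congr (Esum _ _); apply/funext => y.
rewrite -(EspinZ _ mX bX)  -?(EspinD _ mX bX) -?(EspinB _ mX bX); try by lb.
by congr (Espin _); apply/funext => x; ring.
Qed.

(** The [p]-th derivative of the moment generating function at [t]; division by [spin_moment 0 t]
    gives the moments of the tilted law. *)
Definition spin_moment p t := Espin (fun x => x ^+ p * expR (t * x)).
Definition tilted_mean t := spin_moment 1 t / spin_moment 0 t.
Definition tilted_var t := spin_moment 2 t / spin_moment 0 t - tilted_mean t ^+ 2.

Lemma spin_moment0_gt0 t : 0 < spin_moment 0 t.
Proof.
apply: (@lt_le_trans _ _ (Espin (fun=> expR (- (`|t| * M))))).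
  by rewrite Espin_cst expR_gt0.
rewrite /spin_moment; apply: (le_Espin _ mX bX); try by lb.
move=> x xM; rewrite expr0 mul1r ler_expR lerNl.
by rewrite (le_trans (ler_norm _))// normrN normrM ler_wpM2l.
Qed.

Let L0 t : spin_moment 0 t != 0. Proof. by rewrite gt_eqF// spin_moment0_gt0. Qed.

Lemma normr_spin_moment p t : `|spin_moment p t| <= M ^+ p * spin_moment 0 t.
Proof.
rewrite /spin_moment -(EspinZ _ mX bX); last by lb.
rewrite ler_norml -mulN1r -(EspinZ _ mX bX); last by lb.
apply/andP; split; apply: (le_Espin _ mX bX); try by lb.
  move=> x xM; rewrite expr0 mul1r mulrA ler_wpM2r ?expR_ge0//.
  by rewrite mulN1r lerNl (le_trans (ler_norm _))// normrN normrX lerXn2r ?nnegrE.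
move=> x xM; rewrite expr0 mul1r ler_wpM2r ?expR_ge0//.
by rewrite (le_trans (ler_norm _))// normrX lerXn2r ?nnegrE.
Qed.

Lemma normr_tilted_mean t : `|tilted_mean t| <= M.
Proof.
rewrite /tilted_mean normrM normfV (gtr0_norm (spin_moment0_gt0 _)).
by rewrite ler_pdivrMr ?spin_moment0_gt0//; exact: normr_spin_moment.
Qed.

Lemma Espin_tilted_centered t :
  Espin (fun x => expR (t * x) * (x - tilted_mean t)) = 0.
Proof.
transitivity (Espin (fun x => x ^+ 1 * expR (t * x) -
    tilted_mean t * (x ^+ 0 * expR (t * x)))).
  by congr (Espin _); apply/funext => x; rewrite expr0 expr1; ring.
rewrite (EspinB _ mX bX) ?(EspinZ _ mX bX (tilted_mean t)); try by lb.
by rewrite -/(spin_moment 1 t) -/(spin_moment 0 t) /tilted_mean divfK// subrr.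
Qed.

Lemma Espin_tilted_var t :
  Espin (fun x => expR (t * x) * (x - tilted_mean t) ^+ 2) =
  tilted_var t * spin_moment 0 t.
Proof.
set m := tilted_mean t.
transitivity (Espin (fun x => x ^+ 2 * expR (t * x) -
    (2 * m * (x ^+ 1 * expR (t * x)) - m ^+ 2 * (x ^+ 0 * expR (t * x))))).
  by congr (Espin _); apply/funext => x; rewrite expr0 expr1; ring.
rewrite !(EspinB _ mX bX) ?(EspinZ _ mX bX (2 * m)) ?(EspinZ _ mX bX (m ^+ 2)); try by lb.
rewrite -/(spin_moment 2 t) -/(spin_moment 1 t) -/(spin_moment 0 t) /tilted_var -/m.
have -> : spin_moment 1 t = m * spin_moment 0 t by rewrite /m /tilted_mean divfK.
by field; exact: L0.
Qed.

Lemma Espin_tilted_cov t :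
  Espin (fun x => expR (t * x) * ((x - tilted_mean t) * x)) =
  tilted_var t * spin_moment 0 t.
Proof.
rewrite -Espin_tilted_var -[LHS]subr0 -[X in _ - X](mulr0 (tilted_mean t)).
rewrite -(Espin_tilted_centered t) -(EspinZ _ mX bX) -?(EspinB _ mX bX); try by lb.
by congr (Espin _); apply/funext => x; ring.
Qed.

Lemma tilted_var_ge0 t : 0 <= tilted_var t.
Proof.
rewrite -(pmulr_lge0 _ (spin_moment0_gt0 t)) -Espin_tilted_var.
by apply: Rintegral_ge0 => x _; rewrite mulr_ge0 ?expR_ge0 ?sqr_ge0.
Qed.

Lemma tilted_var_le t : tilted_var t <= M ^+ 2.
Proof.
rewrite /tilted_var lerBlDr ler_wpDr ?sqr_ge0//.
rewrite ler_pdivrMr ?spin_moment0_gt0//.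
by rewrite (le_trans (ler_norm _))//; exact: normr_spin_moment.
Qed.

(** Let y be the sum without the singled out spin x. In (x - mean) g(x + y) the constant g(y) drops
    out by centring, and the linear term x D(y) averages to var D(y), which cancels against the
    second term; only remainders survive. [D] need not be a derivative: the two increment bounds
    suffice, and they allow it to jump. *)
Lemma tilted_stein n t g D E :
  locally_bounded g -> locally_bounded D -> locally_bounded E ->
  (forall s y, `|s - y| <= M -> `|D s - D y| <= E s) ->
  (forall s y, `|s - y| <= M -> `|g s - g y - (s - y) * D y| <= M * E s) ->
  `|Esum n.+1 (fun s => expR (t * s) *
     ((s - n.+1%:R * tilted_mean t) * g s - n.+1%:R * (tilted_var t * D s)))| <=
  n.+1%:R * (3 * M ^+ 2 * Esum n.+1 (fun s => expR (t * s) * E s)).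
Proof.
move=> lg lD lE DE gE; set m := tilted_mean t; set v := tilted_var t.
have [e eE] : exists e : R -> R, e = fun s => expR (t * s) by eexists.
have le : locally_bounded e by rewrite eE; lb.
have e0 s : 0 <= e s by rewrite eE expR_ge0.
have -> : (fun s => expR (t * s) * E s) = fun s => e s * E s by rewrite eE.
apply: (@le_trans _ _ `|n.+1%:R * Esum n (fun y => Espin (fun x =>
    (x - m) * (e (x + y) * g (x + y)) - v * (e (x + y) * D (x + y))))|).
  rewrite -(Esum_centered n m (g := fun s => e s * g s) (h := fun s => v * (e s * D s))); try by lb.
  rewrite le_eqVlt; apply/orP; left; apply/eqP; congr `|_|.
  by congr (Esum _ _); apply/funext => s; rewrite eE; ring.
rewrite normrM ger0_norm// ler_wpM2l//.
have lEs : locally_bounded (fun y => Espin (fun x => e (x + y) * E (x + y))).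
  by apply: (locally_bounded_Espin_shift (g := fun s => e s * E s)); lb.
have key y : `|Espin (fun x =>
    (x - m) * (e (x + y) * g (x + y)) - v * (e (x + y) * D (x + y)))| <=
    3 * M ^+ 2 * Espin (fun x => e (x + y) * E (x + y)).
  have lgy : locally_bounded (fun x => g (x + y)) by lb.
  have lDy : locally_bounded (fun x => D (x + y)) by lb.
  have lEy : locally_bounded (fun x => E (x + y)) by lb.
  have ley : locally_bounded (fun x => e (x + y)) by lb.
  have -> : Espin (fun x =>
    (x - m) * (e (x + y) * g (x + y)) - v * (e (x + y) * D (x + y))) =
    Espin (fun x => e (x + y) * ((x - m) * (g (x + y) - g y - x * D y)
       + v * (D y - D (x + y)))).
    apply/eqP; rewrite -subr_eq0 -(EspinB _ mX bX); try by lb.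
    apply/eqP; transitivity (Espin (fun x => e y * g y * (expR (t * x) * (x - m))
       + (e y * D y * (expR (t * x) * ((x - m) * x))
         - e y * D y * v * (x ^+ 0 * expR (t * x))))).
      by congr (Espin _); apply/funext => x; rewrite eE mulrDr expRD expr0; ring.
    rewrite (EspinD _ mX bX) ?(EspinB _ mX bX) ?(EspinZ _ mX bX (e y * g y)) ?(EspinZ _ mX bX (e y * D y)) ?(EspinZ _ mX bX (e y * D y * v)); try by lb.
    by rewrite Espin_tilted_centered Espin_tilted_cov -/(spin_moment _ _) -/v; ring.
  (* The factor 3: |x - mean| <= 2M multiplies the remainder M E, and var <= M^2 multiplies the
     increment E. *)
  have key2 x : `|x| <= M -> `|e (x + y) * ((x - m) * (g (x + y) - g y - x * D y)
       + v * (D y - D (x + y)))| <= 3 * M ^+ 2 * (e (x + y) * E (x + y)).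
    move=> xM; rewrite normrM (ger0_norm (e0 _)) mulrCA ler_wpM2l//.
    have sy : `|x + y - y| <= M by rewrite addrK.
    have h1 := DE _ _ sy; have := gE _ _ sy; rewrite addrK => h2.
    rewrite (le_trans (ler_normD _ _))//.
    have -> : 3 * M ^+ 2 * E (x + y) = (M + M) * (M * E (x + y)) + M ^+ 2 * E (x + y) by ring.
    rewrite lerD// normrM.
      by rewrite ler_pM// (le_trans (ler_normB _ _))// lerD// normr_tilted_mean.
    rewrite ger0_norm ?tilted_var_ge0// distrC ler_pM ?tilted_var_ge0//.
    exact: tilted_var_le.
  by rewrite -(EspinZ _ mX bX); [apply: normr_Espin_le => //; lb|lb].
(* Integrals of w(x) g(x + y) are known to be test functions of y, so the integrand is split into
   two pieces of that form. *)
have lPsi : locally_bounded (fun y => Espin (fun x =>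
    (x - m) * (e (x + y) * g (x + y)) - v * (e (x + y) * D (x + y)))).
  pose h z := m * (e z * g z) + v * (e z * D z).
  have lh : locally_bounded h by rewrite /h; lb.
  have leg : locally_bounded (fun z => e z * g z) by lb.
  rewrite (_ : (fun y => _) = fun y => Espin (fun x => x * (e (x + y) * g (x + y)))
      - Espin (fun x => h (x + y))).
    apply: locally_boundedB; last exact: locally_bounded_Espin_shift.
    exact: (Espin_shift_locally_bounded rho mX bX (@locally_bounded_id R) leg).
  have lgy y : locally_bounded (fun x => e (x + y) * g (x + y)).
    exact: (locally_bounded_shift y leg).
  have lhy y : locally_bounded (fun x => h (x + y)) by lb.
  apply/funext => y; rewrite -(EspinB _ mX bX); try by lb.
  by congr (Espin _); apply/funext => x; rewrite /h; ring.
rewrite [X in _ <= _ * X](@EsumS _ _ _ rho X mX M bX _ (fun s => e s * E s)); last by lb.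
by rewrite -(EsumZ _ mX bX)//; apply: normr_Esum_le => //; lb.
Qed.

(** The identity on [-r, r], constant beyond. It serves twice: as the truncated linear test function
    of the concentration bound, and as the truncation of a spin to [-M, M]. *)
Definition clamp r s : R := Num.max (- r) (Num.min s r).

Lemma clampE r s : - r <= s <= r -> clamp r s = s.
Proof.
by move=> /andP[rs sr]; rewrite /clamp (min_idPl sr) (max_idPr rs).
Qed.

Lemma normr_clamp r s : 0 <= r -> `|clamp r s| <= r.
Proof.
move=> r0; rewrite ler_norml /clamp le_max lexx /= ge_max ge_min lexx orbT andbT.
by rewrite (le_trans _ r0)// oppr_le0.
Qed.

Lemma clamp_homo r : {homo clamp r : x y / x <= y}.
Proof.
move=> x y xy; rewrite /clamp ge_max !le_max lexx /=; apply/orP; right.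
by rewrite le_min !ge_min xy lexx orbT.
Qed.

Lemma locally_bounded_clamp r c : locally_bounded (fun s => clamp r (s - c)).
Proof.
by apply: locally_bounded_max; [lb|apply: locally_bounded_min; lb].
Qed.

(* The inner factor [x - tilted_mean t] is centred, so [g (tilted_mean t + y)]
   may be subtracted; monotonicity of [g] then makes the integrand nonnegative. *)
Lemma tilted_concentration n t a b :
  n.+1%:R * (tilted_var t * Esum n.+1 (fun s => expR (t * s) * \1_(`[a, b]) s)) <=
  Esum n.+1 (fun s => expR (t * s) * ((s - n.+1%:R * tilted_mean t) *
    clamp ((b - a) / 2 + 2 * M) (s - (a + b) / 2))).
Proof.
pose g s := clamp ((b - a) / 2 + 2 * M) (s - (a + b) / 2); rewrite -/(g _).
set m := tilted_mean t; set v := tilted_var t.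
have [e eE] : exists e : R -> R, e = fun s => expR (t * s) by eexists.
have le : locally_bounded e by rewrite eE; lb.
have e0 s : 0 <= e s by rewrite eE expR_ge0.
have lg : locally_bounded g by exact: locally_bounded_clamp.
have lI : locally_bounded (\1_(`[a, b] : set R) : R -> R).
  exact: locally_bounded_indic.
have lgy y : locally_bounded (fun x => g (x + y)) by lb.
have lIy y : locally_bounded (fun x => \1_(`[a, b]) (x + y) : R) by lb.
have ley y : locally_bounded (fun x => e (x + y)) by lb.
have -> : (fun s => expR (t * s) * \1_(`[a, b]) s) = fun s => e s * \1_(`[a, b]) s by rewrite eE.
have leg : locally_bounded (fun z => e z * g z) by lb.
have -> : (fun s => expR (t * s) * ((s - n.+1%:R * m) * g s)) =
    fun s => (s - n.+1%:R * m) * (e s * g s) - n.+1%:R * 0.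
  by apply/funext => s; rewrite eE; ring.
rewrite (Esum_centered n m leg (locally_bounded_cst 0)) ler_wpM2l//.
rewrite (@EsumS _ _ _ rho X mX M bX _ (fun s => e s * \1_(`[a, b]) s)); last by lb.
rewrite -(EsumZ _ mX bX); last first.
  by apply: (locally_bounded_Espin_shift (g := fun s => e s * \1_(`[a, b]) s)); lb.
have lid := @locally_bounded_id R.
apply: (le_Esum _ mX bX).
- apply: locally_boundedM; first by lb.
  by apply: (locally_bounded_Espin_shift (g := fun s => e s * \1_(`[a, b]) s)); lb.
- rewrite (_ : (fun y => _) = fun y => Espin (fun x => x * (e (x + y) * g (x + y)))
      - m * Espin (fun x => e (x + y) * g (x + y))).
    apply: locally_boundedB; first exact: (Espin_shift_locally_bounded rho mX bX lid leg).
    by apply: locally_boundedM; [lb|exact: (locally_bounded_Espin_shift leg)].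
  apply/funext => y; rewrite -(EspinZ _ mX bX) -?(EspinB _ mX bX); try by lb.
  by congr (Espin _); apply/funext => x; rewrite subr0 mulrBl.
(* [J] marks that y is within M of [a, b]. It dominates the indicator at x + y. Where it is 1, both
   x + y and mean + y lie in [a - 2M, b + 2M], the linear part of the truncation, so the increment
   of [g] is x - mean and the integrand yields the variance. *)
move=> y; pose J : R := if (a - M <= y) && (y <= b + M) then 1 else 0.
have -> : Espin (fun x => (x - m) * (e (x + y) * g (x + y)) - 0) =
    Espin (fun x => e (x + y) * ((x - m) * (g (x + y) - g (m + y)))).
  apply/eqP; rewrite -subr_eq0 -(EspinB _ mX bX); try by lb.
  apply/eqP; transitivity (Espin (fun x => e y * g (m + y) * (expR (t * x) * (x - m)))).
    by congr (Espin _); apply/funext => x; rewrite eE mulrDr expRD; ring.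
  by rewrite (EspinZ _ mX bX (e y * g (m + y))) ?Espin_tilted_centered ?mulr0//; lb.
have mM : `|m| <= M by exact: normr_tilted_mean.
have {mM} [Mm mM] : - M <= m /\ m <= M by move: mM; rewrite ler_norml => /andP[].
apply: (@le_trans _ _ (J * e y * (v * spin_moment 0 t))).
  rewrite mulrCA; apply: ler_wpM2l; first exact: tilted_var_ge0.
  rewrite /spin_moment -(EspinZ _ mX bX); last by lb.
  apply: (le_Espin _ mX bX); try by lb.
  move=> x; rewrite ler_norml => /andP[xM1 xM2].
  rewrite expr0 mul1r -(mulrA J).
  have -> : e y * expR (t * x) = e (x + y) by rewrite eE mulrDr expRD mulrC.
  rewrite mulrC ler_wpM2r// indicE.
  have [|_] := boolP (x + y \in `[a, b]%classic); last by rewrite /J; case: ifP.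
  rewrite inE /= in_itv/= => /andP[ax xb].
  rewrite /J ifT//; apply/andP; split; lra.
rewrite -Espin_tilted_var -(EspinZ _ mX bX); last by lb.
apply: (le_Espin _ mX bX); try by lb.
move=> x; rewrite ler_norml => /andP[xM1 xM2].
rewrite -/m.
have -> : J * e y * (expR (t * x) * (x - m) ^+ 2) = e (x + y) * (J * (x - m) ^+ 2).
  by rewrite eE mulrDr expRD; ring.
rewrite ler_wpM2l// /J.
case: ifPn => [/andP[ay yb]|_]; last first.
  rewrite mul0r; have [xm|mx] := leP x m.
    apply: mulr_le0; rewrite subr_le0 //; apply: clamp_homo; lra.
  apply: mulr_ge0; rewrite subr_ge0 ?(ltW mx) //; apply: clamp_homo; lra.
rewrite mul1r /g !clampE; [|apply/andP; split; lra..].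
by rewrite le_eqVlt; apply/orP; left; apply/eqP; ring.
Qed.

End tilted_sum.

(** * Gaussian integrals *)

Section real_integrable.
Context d (T : measurableType d) (R : realType) (mu : {measure set T -> \bar R}).
Implicit Types f g : T -> R.

Lemma integrableRZ k f : mu.-integrable setT (EFin \o f) ->
  mu.-integrable setT (EFin \o (fun x => k * f x)).
Proof.
move=> intf; have := integrableZl measurableT k intf; congr (_.-integrable _ _).
Qed.

Lemma integrableRB f g : mu.-integrable setT (EFin \o f) ->
  mu.-integrable setT (EFin \o g) ->
  mu.-integrable setT (EFin \o (fun x => f x - g x)).
Proof.
by move=> intf intg; have := integrableB measurableT intf intg; congr (_.-integrable _ _).
Qed.

End real_integrable.

Section line_integrals.
Context (R : realType).
Local Notation leb := (@lebesgue_measure R).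
Implicit Types (f F : R -> R) (a c K : R).

Lemma Rintegral_itv_cvg f : leb.-integrable setT (EFin \o f) ->
  \int[leb]_(x in `[- n%:R, n%:R]) f x @[n --> \oo] --> \int[leb]_x f x.
Proof.
move=> intf; have mf : measurable_fun setT f.
  by apply/measurable_EFinP; case/integrableP : intf.
pose f_ n x : \bar R := (f \_ `[- n%:R, n%:R]%classic x)%:E.
have mf_ n : measurable_fun setT (f_ n).
  by apply/measurable_EFinP; apply: (measurable_restrictT f _).1 => //; exact: measurable_funTS.
have [] := @dominated_convergence _ _ _ leb setT measurableT f_ (EFin \o f)
  (fun x => `|f x|%:E) mf_ _ _ _ _.
- exact/measurable_EFinP.
- apply: aeW => x _; apply: cvg_near_cst; exists (Num.truncn `|x|).+1 => // n /= xn.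
  rewrite /f_ patchT// inE/= in_itv/= -ler_norml ltW//.
  by rewrite (lt_le_trans (truncnS_gt _))// ler_nat.
- by have := integrable_norm intf.
- apply: aeW => x n _; rewrite /f_ patchE; case: ifP => _ //.
  by rewrite abse0 lee_fin.
move=> _ _; rewrite -[X in _ --> X](fineK (integrable_fin_num measurableT intf)).
move=> /fine_cvg; apply: cvg_trans; apply: near_eq_cvg; apply: nearW => n /=.
by rewrite Rintegral_mkcond.
Qed.

(** Integrability makes the integrals over [-n, n] converge to the full one, so it is enough to
    control [F] at the integers. *)
Lemma Rintegral_derivative_eq0 f F :
  (forall x : R, is_derive x 1 F (f x)) -> continuous f ->
  leb.-integrable setT (EFin \o f) ->
  F n%:R @[n --> \oo] --> 0 -> F (- n%:R) @[n --> \oo] --> 0 ->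
  \int[leb]_x f x = 0.
Proof.
move=> dF cf intf Fy FNy.
have dF1 (x : R) : derivable F x 1 by case: (dF x).
have cF : continuous F by move=> x; apply/differentiable_continuous/derivable1_diffP.
apply/esym/(@cvg_unique _ (@norm_hausdorff _ R^o) (\int[leb]_(x in `[- n%:R, n%:R]) f x @[n --> \oo])).
  have : F n%:R - F (- n%:R) @[n --> \oo] --> 0 - 0 by exact: cvgB.
  rewrite subr0; apply: cvg_trans; apply: near_eq_cvg; near=> n.
  have n0 : - n%:R < n%:R :> R
    by rewrite -subr_gt0 opprK -natrD ltr0n addn_gt0 orbb; near: n; exact: nbhs_infty_gt.
  rewrite /Rintegral (@continuous_FTC2 _ f F)//.
  - exact: continuous_subspaceT.
  - split; [by move=> x _; exact: dF1| |].
      by apply: cvg_at_right_filter; exact: cF.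
    by apply: cvg_at_left_filter; exact: cF.
  - by move=> x _; rewrite derive1E; have [] := dF x.
exact: Rintegral_itv_cvg.
Unshelve. all: by end_near. Qed.

Lemma is_derive_expR_comp (h : R -> R) (h' x : R) : is_derive x 1 h h' ->
  is_derive x 1 (fun s => expR (h s)) (expR (h x) * h').
Proof.
move=> dh; exact: (@is_derive1_comp _ expR h x (expR (h x)) h').
Qed.

Lemma is_derive_exprn p (x : R) :
  is_derive x 1 (fun s : R => s ^+ p) (p%:R * x ^+ p.-1).
Proof.
split; first exact: exprn_derivable.
by rewrite exp_derive /GRing.scale/= mulr1.
Qed.

Definition gaussw (a s : R) : R := expR (- (a * s ^+ 2)).

Lemma measurable_gaussw a : measurable_fun setT (gaussw a).
Proof.
apply: measurableT_comp => //; apply: measurableT_comp => //.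
by apply: measurable_funM => //; exact: measurable_funX.
Qed.

Lemma integrable_gaussw a : 0 < a -> leb.-integrable setT (EFin \o gaussw a).
Proof.
move=> a0; pose s := Num.sqrt (2 * a)^-1.
have s0 : 0 < s by rewrite sqrtr_gt0 invr_gt0 mulr_gt0.
have -> : EFin \o gaussw a = fun x => ((normal_peak s)^-1%:E * (normal_pdf 0 s x)%:E)%E.
  apply/funext => x; rewrite normal_pdfE ?gt_eqF// -EFinM/= mulKf; last first.
    by rewrite gt_eqF// normal_peak_gt0// gt_eqF.
  rewrite /gaussw /normal_fun subr0 /s sqr_sqrtr; last first.
    by rewrite invr_ge0 mulr_ge0// ltW.
  congr (_ %:E); congr expR; field; exact: lt0r_neq0.
by apply: integrableZl => //; exact: integrable_normal_pdf.
Qed.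

Lemma Rintegral_gaussw_expR a c : 0 < a ->
  \int[leb]_s (gaussw a s * expR (c * s)) =
  expR (c ^+ 2 / (4 * a)) * Num.sqrt (pi / a).
Proof.
move=> a0; pose s := Num.sqrt (2 * a)^-1; pose m := c / (2 * a).
have s0 : 0 < s by rewrite sqrtr_gt0 invr_gt0 mulr_gt0.
have p0 : 0 < normal_peak s by rewrite normal_peak_gt0// gt_eqF.
have e x : gaussw a x * expR (c * x) =
    expR (c ^+ 2 / (4 * a)) * (normal_peak s)^-1 * normal_pdf m s x.
  rewrite normal_pdfE ?gt_eqF//= -mulrA mulKf ?gt_eqF//.
  rewrite /gaussw /normal_fun /s sqr_sqrtr; last first.
    by rewrite invr_ge0 mulr_ge0// ltW.
  by rewrite -!expRD; congr expR; rewrite /m; field; exact: lt0r_neq0.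
under eq_Rintegral do rewrite e.
rewrite RintegralZl//; last exact: integrable_normal_pdf.
rewrite /Rintegral integral_normal_pdf/= mulr1 /normal_peak invrK; congr (_ * Num.sqrt _).
rewrite /s sqr_sqrtr; last by rewrite invr_ge0 mulr_ge0// ltW.
by rewrite -mulr_natr; field; exact: lt0r_neq0.
Qed.

Lemma gaussw_dominates a c p : 0 < a -> exists K, 0 <= K /\
  forall s, (1 + `|s|) ^+ p * expR (c * `|s|) * gaussw a s <= K * gaussw (a / 2) s.
Proof.
move=> a0; set q := p%:R + `|c|.
(* Since (1 + |s|)^p <= exp(p |s|), the left side is at most exp(q |s| - a s^2); the witness is the
   maximum of exp(q x - a x^2 / 2). *)
exists (expR (q ^+ 2 / (2 * a))); split; first exact: expR_ge0.
move=> s; rewrite /gaussw -expRD.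
apply: (@le_trans _ _ (expR (q * `|s|) * expR (- (a * s ^+ 2)))).
  rewrite ler_wpM2r ?expR_ge0// /q mulrDl expRD ler_pM ?expR_ge0 ?exprn_ge0 ?addr_ge0//.
    by rewrite expRM_natl lerXn2r ?nnegrE ?addr_ge0 ?expR_ge0// expR_ge1Dx.
  by rewrite ler_expR ler_wpM2r// ler_norm.
rewrite -expRD ler_expR -subr_ge0 -(real_normK (num_real s)).
have -> : q ^+ 2 / (2 * a) + - (a / 2 * `|s| ^+ 2) - (q * `|s| + - (a * `|s| ^+ 2)) =
  (q - a * `|s|) ^+ 2 / (2 * a) by field; exact: lt0r_neq0.
by rewrite divr_ge0 ?sqr_ge0// mulr_ge0// ltW.
Qed.

Lemma integrable_le_gaussw a c p K f : 0 < a -> measurable_fun setT f ->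
  (forall s, `|f s| <= K * ((1 + `|s|) ^+ p * expR (c * `|s|) * gaussw a s)) ->
  leb.-integrable setT (EFin \o f).
Proof.
move=> a0 mf fK; have [L [L0 H]] := gaussw_dominates c p a0.
have iL : leb.-integrable setT (EFin \o (fun s => `|K| * L * gaussw (a / 2) s)).
  by apply: integrableRZ; apply: integrable_gaussw; rewrite divr_gt0.
apply: le_integrable iL => //; first exact/measurable_EFinP.
move=> s _ /=; rewrite lee_fin (le_trans (fK s))// [leRHS]ger0_norm; last first.
  by rewrite !mulr_ge0// expR_ge0.
rewrite -(mulrA `|K|); apply: (@le_trans _ _ (`|K| * ((1 + `|s|) ^+ p * expR (c * `|s|) * gaussw a s))).
  by rewrite ler_wpM2r ?ler_norm// !mulr_ge0 ?expR_ge0// exprn_ge0// addr_ge0.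
by rewrite ler_wpM2l.
Qed.

(** The difference of the two sides is, up to sign, the integral of the derivative of s^p exp(c s -
    a s^2), which vanishes at infinity. *)
Lemma gauss_ibp a c p : 0 < a ->
  \int[leb]_s (s ^+ p * (2 * a * s - c) * (gaussw a s * expR (c * s))) =
  p%:R * \int[leb]_s (s ^+ p.-1 * (gaussw a s * expR (c * s))).
Proof.
move=> a0.
have mg : measurable_fun setT (fun s => gaussw a s * expR (c * s)).
  apply: measurable_funM; first exact: measurable_gaussw.
  by apply: measurableT_comp => //; exact: mulrl_measurable.
have bound q s : `|s ^+ q * (gaussw a s * expR (c * s))| <=
    (1 + `|s|) ^+ q * expR (`|c| * `|s|) * gaussw a s.
  rewrite normrM normrX (ger0_norm (mulr_ge0 (expR_ge0 _) (expR_ge0 _))).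
  rewrite -mulrA ler_pM ?exprn_ge0 ?mulr_ge0 ?expR_ge0//.
    by rewrite lerXn2r ?nnegrE ?addr_ge0// lerDr.
  by rewrite mulrC ler_wpM2r ?expR_ge0// ler_expR -normrM ler_norm.
have iq q : leb.-integrable setT (EFin \o (fun s => s ^+ q * (gaussw a s * expR (c * s)))).
  apply: (@integrable_le_gaussw a `|c| q 1) => //.
    by apply: measurable_funM => //; exact: measurable_funX.
  by move=> s; rewrite mul1r; exact: bound.
have dG (s : R) : is_derive s 1 (fun s => gaussw a s * expR (c * s))
    ((c - 2 * a * s) * (gaussw a s * expR (c * s))).
  rewrite /gaussw; under eq_fun do rewrite -expRD.
  have dh : is_derive s 1 (fun s => - (a * s ^+ 2) + c * s) (c - 2 * a * s).
    by apply: is_derive_eq; rewrite /GRing.scale/=; ring.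
  by rewrite mulrC -expRD; exact: is_derive_expR_comp.
pose F s := s ^+ p * (gaussw a s * expR (c * s)).
pose f s := p%:R * (s ^+ p.-1 * (gaussw a s * expR (c * s))) -
  s ^+ p * (2 * a * s - c) * (gaussw a s * expR (c * s)).
have dF (s : R) : is_derive s 1 F (f s).
  have := is_deriveM (is_derive_exprn p s) (dG s); rewrite /GRing.scale/= => H.
  by apply: (@is_derive_eq _ _ _ _ _ _ _ _ H); rewrite /f; ring.
have cG : continuous (fun s => gaussw a s * expR (c * s)).
  move=> s; apply/differentiable_continuous/derivable1_diffP.
  by case: (dG s).
have cX q : continuous (fun s : R => s ^+ q) by exact: exprn_continuous.
have cf : continuous f.
  move=> s; apply: cvgB; first by apply: cvgMr; apply: cvgM; [exact: cX|exact: cG].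
  apply: cvgM; last exact: cG.
  apply: cvgM; first exact: cX.
  by apply: cvgB; [apply: cvgMr; exact: cvg_id|exact: cvg_cst].
have if1 := @integrableRZ _ _ _ leb p%:R _ (iq p.-1).
have if2 : leb.-integrable setT (EFin \o (fun s => s ^+ p * (2 * a * s - c) * (gaussw a s * expR (c * s)))).
  have := integrableRB (integrableRZ (2 * a) (iq p.+1)) (integrableRZ c (iq p)).
  congr (_.-integrable _ _); apply/funext => s /=; congr (_ %:E).
  by rewrite exprS; ring.
have intf : leb.-integrable setT (EFin \o f) by exact: integrableRB.
(* Stated for every sequence with absolute value n, so that it serves both ends of the line. *)
have Fn (u : nat -> R) : (forall n, `|u n| = n%:R) -> F (u n) @[n --> \oo] --> 0.
  move=> un; have [K [K0 FK]] := gaussw_dominates `|c| p a0.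
  apply: norm_cvg0; apply: (@squeeze_cvgr _ _ _ _ (cst 0) (fun n => K * expR (- (a / 2)) ^+ n)).
  - apply: nearW => n; rewrite normr_ge0/= (le_trans (bound p _))// (le_trans (FK _))//.
    rewrite ler_wpM2l// /gaussw -expRM_natl ler_expR -(real_normK (num_real (u n))) un.
    rewrite mulrN lerN2 mulrC ler_wpM2l ?divr_ge0 ?(ltW a0)//.
    by rewrite -natrX ler_nat; case: n => // n; rewrite expnS leq_pmulr.
  - exact: cvg_cst.
  - rewrite -[X in _ --> X](mulr0 K); apply: cvgMr; apply: cvg_expr.
    by rewrite ger0_norm ?expR_ge0// expR_lt1 oppr_lt0 divr_gt0.
have := Rintegral_derivative_eq0 dF cf intf (Fn _ _) (Fn _ _).
rewrite /f RintegralB// RintegralZl// => H; apply/esym/eqP; rewrite -subr_eq0 H//.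
  by move=> n; rewrite ger0_norm.
by move=> n; rewrite normrN ger0_norm.
Qed.

(** [K] depends on [q] alone, so the scaling in [a] is explicit; later [a] grows with n. Integration
    by parts gives the recursion K(q+1) = (2q+1)/2 K(q). *)
Lemma gaussw_moment q : exists K, 0 <= K /\ forall a, 0 < a ->
  \int[leb]_s (s ^+ (2 * q) * gaussw a s) = K / a ^+ q * Num.sqrt (pi / a).
Proof.
have e0 (s : R) : expR (0 * s) = 1 by rewrite mul0r expR0.
elim: q => [|q [K [K0 IH]]].
  exists 1; split=> // a a0; rewrite muln0 expr0 divr1 mul1r.
  have := Rintegral_gaussw_expR 0 a0; rewrite expr0n/= mul0r expR0 mul1r => <-.
  by apply: eq_Rintegral => s _; rewrite e0 expr0 mul1r mulr1.
exists ((2 * q).+1%:R / 2 * K); split; first by rewrite !mulr_ge0// ler0n.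
move=> a a0; have := gauss_ibp 0 (2 * q).+1 a0.
have -> : \int[leb]_s (s ^+ (2 * q).+1.-1 * (gaussw a s * expR (0 * s))) =
    \int[leb]_s (s ^+ (2 * q) * gaussw a s).
  by apply: eq_Rintegral => s _; rewrite e0 mulr1.
rewrite IH// => H.
have ig : leb.-integrable setT (EFin \o (fun s => s ^+ (2 * q.+1) * gaussw a s)).
  apply: (@integrable_le_gaussw a 0 (2 * q.+1) 1) => //.
    by apply: measurable_funM; [exact: measurable_funX|exact: measurable_gaussw].
  move=> s; rewrite mul1r e0 mulr1 normrM normrX (ger0_norm (expR_ge0 _)).
  by rewrite ler_wpM2r ?expR_ge0// lerXn2r ?nnegrE ?addr_ge0// lerDr.
have {}H : 2 * a * \int[leb]_s (s ^+ (2 * q.+1) * gaussw a s) =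
    (2 * q).+1%:R * (K / a ^+ q * Num.sqrt (pi / a)).
  rewrite -H -RintegralZl//; apply: eq_Rintegral => s _.
  by rewrite e0 mulnS !exprS; ring.
apply: (mulfI (lt0r_neq0 (mulr_gt0 (ltr0n _ 2) a0))); rewrite H exprS.
by field; rewrite expf_neq0 ?lt0r_neq0.
Qed.

End line_integrals.

(** * The Hubbard-Stratonovich coupling *)

Section bracket.
Context d (Om : measurableType d) (R : realType) (P : probability Om R).
Context (S : Om -> R) (mS : measurable_fun setT S) (B : R).
Hypothesis bS : forall x, `|S x| <= B.
Context (A b : R).
Hypothesis A0 : 0 < A.
Local Notation leb := (@lebesgue_measure R).
Implicit Types (H : R -> R -> R) (g h : R -> R) (K : R).

(** Polynomial growth in s is absorbed by the Gaussian factor, and only |y| <= B matters because [S]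
    takes its values there. *)
Definition admissible H :=
  measurable_fun setT (fun z : measurableTypeR R * measurableTypeR R => H z.1 z.2) /\
  exists K p, 0 <= K /\ forall s y, `|y| <= B -> `|H s y| <= K * (1 + `|s|) ^+ p.

Lemma admissible_snd h : locally_bounded h -> admissible (fun _ y => h y).
Proof.
move=> [mh bh]; split; first exact: (measurableT_comp mh measurable_snd).
have [K hK] := bh B; exists `|K|, 0%N; split => // s y yB.
by rewrite expr0 mulr1 (le_trans (hK _ yB))// ler_norm.
Qed.

Lemma admissible_fst h : measurable_fun setT h ->
  (exists K p, forall s, `|h s| <= K * (1 + `|s|) ^+ p) ->
  admissible (fun s _ => h s).
Proof.
move=> mh [K [p hK]]; split; first exact: (measurableT_comp mh measurable_fst).
exists `|K|, p; split=> // s y _; rewrite (le_trans (hK s))//.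
by rewrite ler_wpM2r ?ler_norm// exprn_ge0// addr_ge0.
Qed.

Lemma admissibleX p : admissible (fun s _ => s ^+ p).
Proof.
apply: admissible_fst; first exact: exprn_measurable.
by exists 1, p => s; rewrite mul1r normrX lerXn2r ?nnegrE ?addr_ge0// lerDr.
Qed.

Lemma admissible_cst K : admissible (fun _ _ => K).
Proof. by apply: (@admissible_snd (fun=> K)); exact: locally_bounded_cst. Qed.

Lemma admissibleD H1 H2 : admissible H1 -> admissible H2 ->
  admissible (fun s y => H1 s y + H2 s y).
Proof.
move=> [m1 [K1 [p1 [K10 b1]]]] [m2 [K2 [p2 [K20 b2]]]]; split.
  exact: measurable_funD.
exists (K1 + K2), (p1 + p2)%N; split; first exact: addr_ge0.
move=> s y yB; rewrite (le_trans (ler_normD _ _))// mulrDl.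
have X0 p : 0 <= (1 + `|s|) ^+ p by rewrite exprn_ge0// addr_ge0.
have X1 p : 1 <= (1 + `|s|) ^+ p by rewrite exprn_ege1// lerDl.
rewrite lerD//.
  by rewrite (le_trans (b1 _ _ yB))// ler_wpM2l// exprD ler_peMr.
by rewrite (le_trans (b2 _ _ yB))// ler_wpM2l// exprD ler_peMl.
Qed.

Lemma admissibleM H1 H2 : admissible H1 -> admissible H2 ->
  admissible (fun s y => H1 s y * H2 s y).
Proof.
move=> [m1 [K1 [p1 [K10 b1]]]] [m2 [K2 [p2 [K20 b2]]]]; split.
  exact: measurable_funM.
exists (K1 * K2), (p1 + p2)%N; split; first exact: mulr_ge0.
by move=> s y yB; rewrite normrM exprD mulrACA ler_pM ?b1 ?b2.
Qed.

Lemma admissibleN H : admissible H -> admissible (fun s y => - H s y).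
Proof.
move=> [mH [K [p [K0 bH]]]]; split; first exact: measurableT_comp.
by exists K, p; split=> // s y yB; rewrite normrN bH.
Qed.

Lemma admissibleB H1 H2 : admissible H1 -> admissible H2 ->
  admissible (fun s y => H1 s y - H2 s y).
Proof. by move=> a1 a2; apply: admissibleD => //; exact: admissibleN. Qed.

Definition coupling (s y : R) : R := gaussw A s * expR (b * s * y).

Definition bracket H : R :=
  \int[(leb \x P)%E]_z (coupling z.1 (S z.2) * H z.1 (S z.2)).

Lemma coupling_ge0 s y : 0 <= coupling s y.
Proof. by rewrite mulr_ge0 ?expR_ge0. Qed.

Let coupling_bound H : admissible H -> exists K p, 0 <= K /\
  forall s y, `|y| <= B -> `|coupling s y * H s y| <=
    K * ((1 + `|s|) ^+ p * expR (`|b| * B * `|s|) * gaussw A s).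
Proof.
move=> [mH [K [p [K0 bH]]]]; exists K, p; split=> // s y yB.
rewrite normrM (ger0_norm (coupling_ge0 _ _)) /coupling.
apply: (@le_trans _ _ (gaussw A s * expR (`|b| * B * `|s|) * (K * (1 + `|s|) ^+ p))).
  apply: ler_pM => //; [exact: coupling_ge0| |exact: bH].
  rewrite ler_wpM2l ?expR_ge0// ler_expR (le_trans (ler_norm _))//.
  by rewrite !normrM mulrAC ler_wpM2r// ler_wpM2l.
by rewrite le_eqVlt; apply/orP; left; apply/eqP; ring.
Qed.

Let measurable_coupling H : admissible H -> measurable_fun setT
  (fun z : measurableTypeR R * Om => coupling z.1 (S z.2) * H z.1 (S z.2)).
Proof.
move=> [mH _].
have m1 : measurable_fun setT (fun z : measurableTypeR R * Om => z.1).
  exact: measurable_fst.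
have m2 : measurable_fun setT (fun z : measurableTypeR R * Om => S z.2).
  exact: (measurableT_comp mS measurable_snd).
apply: measurable_funM.
  apply: measurable_funM; first exact: (measurableT_comp (measurable_gaussw A) m1).
  apply: measurableT_comp => //; apply: measurable_funM => //.
  by apply: measurable_funM.
have m12 : measurable_fun setT (fun z : measurableTypeR R * Om => (z.1, S z.2) : measurableTypeR R * measurableTypeR R).
  exact: measurable_fun_pair.
exact: (measurableT_comp mH m12).
Qed.

Lemma coupling_integrable_fst H y : admissible H -> `|y| <= B ->
  leb.-integrable setT (fun s => (coupling s y * H s y)%:E).
Proof.
move=> aH yB; have [K [p [K0 bH]]] := coupling_bound aH.
apply: (@integrable_le_gaussw _ A (`|b| * B) p K (fun s => coupling s y * H s y)) => //.
  apply: measurable_funM.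
    apply: measurable_funM; first exact: measurable_gaussw.
    apply: measurableT_comp => //; apply: measurable_funM => //.
  have m12 : measurable_fun setT (fun s : measurableTypeR R => (s, y) : measurableTypeR R * measurableTypeR R).
    exact: measurable_fun_pair.
  exact: (measurableT_comp aH.1 m12).
by move=> s; exact: bH.
Qed.

Lemma coupling_integrable_snd H s : admissible H ->
  P.-integrable setT (fun x => (coupling s (S x) * H s (S x))%:E).
Proof.
move=> aH; have [K [p [K0 bH]]] := coupling_bound aH.
apply: (@bounded_integrable _ _ _ P (fun x => coupling s (S x) * H s (S x))).
  have m12 : measurable_fun setT (fun x : Om => (s, x) : measurableTypeR R * Om).
    exact: measurable_fun_pair.
  exact: (measurableT_comp (measurable_coupling aH) m12).
by eexists => x; apply: bH.
Qed.

Lemma bracket_integrable H : admissible H ->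
  (leb \x P)%E.-integrable setT
    (EFin \o (fun z => coupling z.1 (S z.2) * H z.1 (S z.2))).
Proof.
move=> aH; have [K [p [K0 bH]]] := coupling_bound aH.
pose G s := K * ((1 + `|s|) ^+ p * expR (`|b| * B * `|s|) * gaussw A s).
have G0 s : 0 <= G s.
  by rewrite /G !mulr_ge0 ?expR_ge0// exprn_ge0// addr_ge0.
have mG : measurable_fun setT G.
  apply: measurable_funM => //; apply: measurable_funM; last exact: measurable_gaussw.
  apply: measurable_funM.
    apply: measurable_funX; apply: measurable_funD => //; exact: measurable_normr.
  by apply: measurableT_comp => //; apply: measurable_funM => //; exact: measurable_normr.
have iG : leb.-integrable setT (EFin \o G).
  apply: (@integrable_le_gaussw _ A (`|b| * B) p K) => // s.
  by rewrite ger0_norm.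
have mf : measurable_fun setT (EFin \o (fun z : measurableTypeR R * Om => coupling z.1 (S z.2) * H z.1 (S z.2))).
  by apply/measurable_EFinP; exact: measurable_coupling.
apply/(integrable12ltyP _ _ mf).
case/integrableP : iG => _; apply: le_lt_trans.
apply: ge0_le_integral => //.
- by move=> s _; exact: integral_ge0.
- have maf : measurable_fun setT (abse \o (EFin \o (fun z : measurableTypeR R * Om => coupling z.1 (S z.2) * H z.1 (S z.2)))).
    exact: measurableT_comp.
  exact: (@measurable_fun_fubini_tonelli_F _ _ (measurableTypeR R) Om R P _ maf
    (fun z => abse_ge0 _)).
- by apply: measurableT_comp => //; exact/measurable_EFinP.
move=> s _ /=.
apply: (@le_trans _ _ (\int[P]_y (G s)%:E)%E).
  apply: ge0_le_integral => //.
  - case/integrableP : (coupling_integrable_snd s aH) => /measurable_EFinP mm _.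
    by apply/measurable_EFinP; apply: measurableT_comp mm.
  - by move=> x _; rewrite lee_fin; exact: bH.
have PT : P setT = 1%E by exact: probability_setT.
have -> : (\int[P]_y (G s)%:E = (G s)%:E)%E.
  rewrite integral_cst//; transitivity ((G s)%:E * 1)%E; last exact: mule1.
  by congr (_ * _)%E.
by rewrite lee_fin ler_norm.
Qed.

Lemma bracket_fst H : admissible H ->
  bracket H = \int[leb]_s \int[P]_x (coupling s (S x) * H s (S x)).
Proof.
move=> aH; rewrite /bracket Rintegral_prod1//; first exact: bracket_integrable.
by move=> s; exact: coupling_integrable_snd.
Qed.

Lemma bracket_snd H : admissible H ->
  bracket H = \int[P]_x \int[leb]_s (coupling s (S x) * H s (S x)).
Proof.
move=> aH; rewrite /bracket Rintegral_prod2//; first exact: bracket_integrable.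
by move=> x; exact: (coupling_integrable_fst aH (bS x)).
Qed.

Lemma bracketD H1 H2 : admissible H1 -> admissible H2 ->
  bracket (fun s y => H1 s y + H2 s y) = bracket H1 + bracket H2.
Proof.
move=> a1 a2; rewrite /bracket -RintegralD//; try exact: bracket_integrable.
by apply: eq_Rintegral => z _; rewrite mulrDr.
Qed.

Lemma bracketB H1 H2 : admissible H1 -> admissible H2 ->
  bracket (fun s y => H1 s y - H2 s y) = bracket H1 - bracket H2.
Proof.
move=> a1 a2; rewrite /bracket -RintegralB//; try exact: bracket_integrable.
by apply: eq_Rintegral => z _; rewrite mulrBr.
Qed.

Lemma bracketZ K H : admissible H ->
  bracket (fun s y => K * H s y) = K * bracket H.
Proof.
move=> aH; rewrite /bracket -RintegralZl//; last exact: bracket_integrable.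
by apply: eq_Rintegral => z _; rewrite mulrCA.
Qed.

Lemma eq_bracket H1 H2 : (forall s y, `|y| <= B -> H1 s y = H2 s y) ->
  bracket H1 = bracket H2.
Proof. by move=> H12; apply: eq_Rintegral => z _; rewrite H12. Qed.

Lemma le_bracket H1 H2 : admissible H1 -> admissible H2 ->
  (forall s y, `|y| <= B -> H1 s y <= H2 s y) -> bracket H1 <= bracket H2.
Proof.
move=> a1 a2 H12; apply: le_Rintegral => //; try exact: bracket_integrable.
by move=> z _; rewrite ler_wpM2l ?coupling_ge0// H12.
Qed.

Lemma normr_bracket_le H1 H2 : admissible H1 -> admissible H2 ->
  (forall s y, `|y| <= B -> `|H1 s y| <= H2 s y) -> `|bracket H1| <= bracket H2.
Proof.
move=> a1 a2 H12; rewrite ler_norml; apply/andP; split.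
  rewrite -[leLHS]mulN1r -bracketZ//; apply: le_bracket => //.
    by apply: admissibleM => //; exact: admissible_cst.
  by move=> s y /(H12 s); rewrite ler_norml mulN1r => /andP[].
by apply: le_bracket => // s y /(H12 s); rewrite ler_norml => /andP[].
Qed.

Let bracket_fiber_integrable H : admissible H -> leb.-integrable setT
  (EFin \o (fun s => \int[P]_x (coupling s (S x) * H s (S x)))).
Proof.
move=> aH; have := integrable_fubini_F (bracket_integrable aH).
congr (_.-integrable _ _); apply/funext => s /=; rewrite /fubini_F fineK//.
exact: (integrable_fin_num measurableT (coupling_integrable_snd s aH)).
Qed.

(** The passage from estimates for tilted spins at fixed s to the coupling: the Gaussian factor does
    not depend on the spins and comes out of the inner integral. *)
Lemma normr_bracket_fiber_le H1 H2 : admissible H1 -> admissible H2 ->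
  (forall s, `|\int[P]_x (expR (b * s * S x) * H1 s (S x))| <=
    \int[P]_x (expR (b * s * S x) * H2 s (S x))) ->
  `|bracket H1| <= bracket H2.
Proof.
move=> a1 a2 H12; rewrite !bracket_fst//.
have i1 := bracket_fiber_integrable a1; have i2 := bracket_fiber_integrable a2.
apply: (le_trans (le_normr_Rintegral measurableT i1)).
apply: le_Rintegral => //; first exact: integrable_norm.
move=> s _.
have g0 : 0 < gaussw A s by exact: expR_gt0.
have E H : admissible H -> \int[P]_x (coupling s (S x) * H s (S x)) =
    gaussw A s * \int[P]_x (expR (b * s * S x) * H s (S x)).
  move=> aH; rewrite -RintegralZl//.
    by apply: eq_Rintegral => x _; rewrite mulrA.
  have := integrableRZ (gaussw A s)^-1 (coupling_integrable_snd s aH).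
  congr (_.-integrable _ _); apply/funext => x /=; congr (_ %:E).
  by rewrite mulrA /coupling mulrA mulVf ?mul1r// gt_eqF.
by rewrite !E// normrM gtr0_norm// ler_pM2l.
Qed.

Lemma bracket_ibp p h : locally_bounded h ->
  bracket (fun s y => s ^+ p * (2 * A * s - b * y) * h y) =
  p%:R * bracket (fun s y => s ^+ p.-1 * h y).
Proof.
move=> lh; have ah := admissible_snd lh.
have lid : locally_bounded (fun y => b * y).
  by apply: locally_boundedM; [exact: locally_bounded_cst|exact: locally_bounded_id].
have a1 : admissible (fun s y => s ^+ p * (2 * A * s - b * y) * h y).
  apply: admissibleM => //; apply: admissibleM; first exact: admissibleX.
  apply: admissibleB; last exact: admissible_snd.
  by apply: admissibleM; [exact: admissible_cst|exact: (admissibleX 1)].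
have a2 q : admissible (fun s y => s ^+ q * h y).
  by apply: admissibleM => //; exact: admissibleX.
rewrite -bracketZ// !bracket_snd//; last first.
  by apply: admissibleM => //; exact: admissible_cst.
apply: eq_Rintegral => x _; set y := S x.
transitivity (h y * \int[leb]_s (s ^+ p * (2 * A * s - b * y) * (gaussw A s * expR (b * y * s)))).
  rewrite -RintegralZl//.
    by apply: eq_Rintegral => s _; rewrite /coupling (mulrAC b y s); ring.
  have a3 : admissible (fun s y => s ^+ p * (2 * A * s - b * y)).
    apply: admissibleM; first exact: admissibleX.
    apply: admissibleB; last exact: admissible_snd.
    by apply: admissibleM; [exact: admissible_cst|exact: (admissibleX 1)].
  have := coupling_integrable_fst a3 (bS x); congr (_.-integrable _ _).
  by apply/funext => s /=; congr (_ %:E); rewrite /coupling (mulrAC b y s) mulrC.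
rewrite gauss_ibp// mulrCA.
have i2 : leb.-integrable setT (EFin \o (fun s => s ^+ p.-1 * (gaussw A s * expR (b * y * s)))).
  have := coupling_integrable_fst (admissibleX p.-1) (bS x); congr (_.-integrable _ _).
  by apply/funext => s /=; congr (_ %:E); rewrite /coupling (mulrAC b y s) mulrC.
rewrite -RintegralZl// -RintegralZl//; last exact: integrableRZ.
by apply: eq_Rintegral => s _; rewrite /coupling (mulrAC b y s); ring.
Qed.

(** The Hubbard-Stratonovich identity: integrating exp(b s y - A s^2) over s produces exp(b^2 y^2 /
    (4A)). With A = n beta / 2 and b = beta the exponent is beta y^2 / (2n), the Curie-Weiss
    interaction. *)
Lemma bracket_marginal h : locally_bounded h ->
  bracket (fun _ y => h y) =
  Num.sqrt (pi / A) * \int[P]_x (h (S x) * expR (b ^+ 2 / (4 * A) * S x ^+ 2)).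
Proof.
move=> lh; rewrite bracket_snd; last exact: admissible_snd.
have lg : locally_bounded (fun y => h y * expR (b ^+ 2 / (4 * A) * y ^+ 2)).
  apply: locally_boundedM => //.
  apply: (locally_bounded_comp (locally_bounded_exp (b ^+ 2 / (4 * A)))).
  exact: (locally_boundedX 2 (@locally_bounded_id R)).
rewrite -RintegralZl//; last first.
  apply: (@bounded_integrable _ _ _ P (fun x => h (S x) * expR (b ^+ 2 / (4 * A) * S x ^+ 2))).
    exact: (measurableT_comp lg.1 mS).
  by have [K HK] := lg.2 B; exists K => x; exact: HK.
apply: eq_Rintegral => x _; set y := S x.
have -> : \int[leb]_s (coupling s y * h y) =
    \int[leb]_s (h y * (gaussw A s * expR (b * y * s))).
  by apply: eq_Rintegral => s _; rewrite /coupling (mulrAC b y s) mulrC.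
rewrite RintegralZl//; last first.
  have := coupling_integrable_fst (admissible_cst 1) (bS x); congr (_.-integrable _ _).
  by apply/funext => s /=; congr (_ %:E); rewrite /coupling (mulrAC b y s) mulr1.
rewrite Rintegral_gaussw_expR//.
have -> : (b * y) ^+ 2 / (4 * A) = b ^+ 2 / (4 * A) * y ^+ 2.
  by field; exact: lt0r_neq0.
by ring.
Qed.

End bracket.

(** * Elementary inequalities for powers *)

Section power_inequalities.
Context (R : realFieldType).
Implicit Types a b x y m : R.

Lemma bernoulli_le a b q : 0 <= a -> 0 <= b ->
  b ^+ q + q%:R * b ^+ q.-1 * (a - b) <= a ^+ q.
Proof.
move=> a0 b0; elim: q => [|[|q] IH]; first by rewrite !expr0 !mul0r addr0.
  by rewrite !expr1 expr0 !mul1r addrC subrK.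
rewrite [leRHS]exprS; apply: le_trans (ler_wpM2l a0 IH).
rewrite -subr_ge0 /=.
have -> : a * (b ^+ q.+1 + q.+1%:R * b ^+ q * (a - b)) -
   (b ^+ q.+2 + q.+2%:R * b ^+ q.+1 * (a - b)) = q.+1%:R * b ^+ q * (a - b) ^+ 2.
  by rewrite !exprS -[q.+2%:R]natr1; ring.
by rewrite mulr_ge0 ?sqr_ge0// mulr_ge0// exprn_ge0.
Qed.

(** The even power lies above its tangents. The tangent inequality is applied first in the squares
    and then in x^2 - y^2 >= 2 y (x - y). It serves to run Jensen's inequality without conditional
    expectations. *)
Lemma even_power_tangent x y q :
  y ^+ (2 * q) + (2 * q)%:R * y ^+ (2 * q).-1 * (x - y) <= x ^+ (2 * q).
Proof.
rewrite [leRHS]exprM; apply: le_trans (bernoulli_le q (sqr_ge0 x) (sqr_ge0 y)).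
rewrite exprM lerD2l; case: q => [|q]; first by rewrite muln0 !mul0r.
rewrite (_ : (2 * q.+1).-1 = (2 * q).+1); last by rewrite mulnS.
rewrite -exprM /= exprS natrM -subr_ge0.
have -> : q.+1%:R * y ^+ (2 * q) * (x ^+ 2 - y ^+ 2) -
   2 * q.+1%:R * (y * y ^+ (2 * q)) * (x - y) = q.+1%:R * y ^+ (2 * q) * (x - y) ^+ 2.
  by ring.
rewrite mulr_ge0 ?sqr_ge0// mulr_ge0//.
by rewrite exprM exprn_ge0 ?sqr_ge0.
Qed.

(** A quadratic Taylor remainder by induction on [r]; the crude constant survives because (r+2)^2 +
    (r+2) <= (r+3)^2. *)
Lemma power_second_order x y m r : `|x| <= m -> `|y| <= m ->
  `|x ^+ r.+2 - y ^+ r.+2 - r.+2%:R * y ^+ r.+1 * (x - y)| <=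
  r.+2%:R ^+ 2 * (m ^+ r * (x - y) ^+ 2).
Proof.
move=> xm ym; have m0 : 0 <= m by rewrite (le_trans _ xm).
elim: r => [|r IH].
  have -> : x ^+ 2 - y ^+ 2 - 2 * y ^+ 1 * (x - y) = (x - y) ^+ 2 by ring.
  by rewrite expr0 mul1r ger0_norm ?sqr_ge0// ler_peMl ?sqr_ge0// -natrX ler1n.
have -> : x ^+ r.+3 - y ^+ r.+3 - r.+3%:R * y ^+ r.+2 * (x - y) =
    x * (x ^+ r.+2 - y ^+ r.+2 - r.+2%:R * y ^+ r.+1 * (x - y)) +
    r.+2%:R * y ^+ r.+1 * (x - y) ^+ 2.
  by rewrite -[r.+3%:R]natr1 !exprS; ring.
rewrite (le_trans (ler_normD _ _))//.
apply: (@le_trans _ _ (r.+2%:R ^+ 2 * (m ^+ r.+1 * (x - y) ^+ 2) +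
    r.+2%:R * (m ^+ r.+1 * (x - y) ^+ 2))).
  apply: lerD; last first.
    rewrite normrM [X in _ * X <= _]ger0_norm ?sqr_ge0// normrM normrX -mulrA.
    rewrite (ger0_norm (ler0n _ _)) ler_wpM2l//.
    by rewrite ler_wpM2r ?sqr_ge0// lerXn2r ?nnegrE.
  apply: (@le_trans _ _ (m * (r.+2%:R ^+ 2 * (m ^+ r * (x - y) ^+ 2)))).
    by rewrite normrM ler_pM.
  by rewrite [m ^+ r.+1]exprS le_eqVlt; apply/orP; left; apply/eqP; ring.
rewrite -mulrDl ler_wpM2r ?(mulr_ge0 (exprn_ge0 _ m0) (sqr_ge0 _))//.
rewrite -[r.+3%:R]natr1 -subr_ge0.
have -> : (r.+2%:R + 1) ^+ 2 - (r.+2%:R ^+ 2 + r.+2%:R) = r.+2%:R + 1 :> R by ring.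
by rewrite addr_ge0.
Qed.

Lemma ler_exprn_even x p q : (p <= 2 * q)%N -> `|x| ^+ p <= 1 + x ^+ (2 * q).
Proof.
move=> pq; have x2 : 0 <= x ^+ (2 * q) by rewrite exprM exprn_ge0 ?sqr_ge0.
have [x1|x1] := leP `|x| 1.
  by rewrite (@le_trans _ _ 1) ?exprn_ile1// lerDl.
rewrite (@le_trans _ _ (`|x| ^+ (2 * q)))// ?ler_weXn2l// ?(ltW x1)//.
by rewrite -normrX ger0_norm// lerDr.
Qed.

Lemma max_exprn_even x y q :
  Num.max `|x| `|y| ^+ (2 * q) <= x ^+ (2 * q) + y ^+ (2 * q).
Proof.
have x2 z : 0 <= z ^+ (2 * q) :> R by rewrite exprM exprn_ge0 ?sqr_ge0.
have e z : `|z| ^+ (2 * q) = z ^+ (2 * q) :> R by rewrite -normrX ger0_norm.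
by have [_|_] := leP `|x| `|y|; rewrite e ?lerDl ?lerDr.
Qed.

Lemma mulr_exprn_even x y p q : (p.+1 = 2 * q)%N ->
  `|x| ^+ p * `|y| <= x ^+ (2 * q) + y ^+ (2 * q).
Proof.
move=> pq; rewrite (le_trans _ (max_exprn_even x y q))// -pq exprSr.
rewrite ler_pM ?exprn_ge0 ?le_max ?lexx ?orbT//.
by rewrite lerXn2r ?nnegrE ?le_max ?normr_ge0 ?lexx.
Qed.

End power_inequalities.

(** * The approximate Stein identity *)

Section scaled_coupling.
Context d (T : measurableType d) (R : realType) (rho : probability T R).
Context (X : T -> R) (mX : measurable_fun setT X) (M : R).
Hypotheses (M0 : 0 <= M) (bX : forall t, `|X t| <= M).
Context (n0 : nat) (beta : R) (k' : nat) (lam : R).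
Hypothesis b0 : 0 < beta.
Local Notation n := n0.+1.
Local Notation k := k'.+1.
Local Notation r := (2 * k).-1.
Local Notation N := (n%:R : R).
Hypotheses (lam1 : 1 <= lam) (lamk : lam ^+ (2 * k) = N).
Context (mean var : R -> R).
Hypotheses (meanE : forall s, tilted_mean rho X (beta * s) = mean s)
  (varE : forall s, tilted_var rho X (beta * s) = var s).
Implicit Types (H : R -> R -> R) (f g h D e : R -> R) (K c z : R).

(** With this width s is, given the spin sum y, Gaussian with mean y / N and variance 1 / (N
    beta). *)
Let A := N * beta / 2.
Let Br := bracket (power_probability rho n) (@iid_sum _ T R X n) A beta.
Let NM := N * M.

Let A0 : 0 < A. Proof. by rewrite /A divr_gt0// mulr_gt0. Qed.
Let bS := iid_sum_bounded bX (n := n).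
Let mS := measurable_iid_sum mX (n := n).
Let lam0 : 0 < lam. Proof. exact: lt_le_trans lam1. Qed.
Let N0 : 0 < N. Proof. by []. Qed.

Definition scaled_admissible H :=
  admissible NM (fun s y => H (lam * s) (lam * y / N)).

(* The expectation of [H U W] when [W] has the law of the rescaled magnetisation
   and, given [W], the Hubbard-Stratonovich variable [U] is Gaussian around [W]. *)
Definition cw_expect H : R :=
  Br (fun s y => H (lam * s) (lam * y / N)) / Br (fun _ _ => 1).

Local Notation E := cw_expect.
Local Notation adm := scaled_admissible.

Lemma bracket1_gt0 : 0 < Br (fun _ _ => 1).
Proof.
rewrite /Br (bracket_marginal _ mS bS _ A0 (locally_bounded_cst 1)).
rewrite mulr_gt0 ?sqrtr_gt0 ?(divr_gt0 (pi_gt0 R) A0)//.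
have lg : locally_bounded (fun y : R => 1 * expR (beta ^+ 2 / (4 * A) * y ^+ 2)).
  apply: locally_boundedM; first exact: locally_bounded_cst.
  apply: (locally_bounded_comp (locally_bounded_exp (beta ^+ 2 / (4 * A)))).
  exact: (locally_boundedX 2 (@locally_bounded_id R)).
suff H : Esum rho X n (fun=> 1) <= Esum rho X n (fun y : R => 1 * expR (beta ^+ 2 / (4 * A) * y ^+ 2)).
  by apply: lt_le_trans H; rewrite Esum_cst.
apply: (le_Esum _ mX bX) => //; first exact: locally_bounded_cst.
move=> y; rewrite mul1r -expR0 ler_expR mulr_ge0 ?sqr_ge0//.
by rewrite divr_ge0 ?sqr_ge0// mulr_ge0// ltW.
Qed.

Let scale_snd h : locally_bounded h -> locally_bounded (fun y => h (lam * y / N)).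
Proof.
move=> lh; apply: (locally_bounded_comp lh).
apply: locally_boundedM; last exact: locally_bounded_cst.
by apply: locally_boundedM; [exact: locally_bounded_cst|exact: locally_bounded_id].
Qed.

Lemma adm_snd h : locally_bounded h -> adm (fun _ w => h w).
Proof. by move=> /scale_snd lh; exact: admissible_snd. Qed.

Lemma adm_fst h : measurable_fun setT h ->
  (exists K p, 0 <= K /\ forall s, `|h s| <= K * (1 + `|s|) ^+ p) -> adm (fun u _ => h u).
Proof.
move=> mh [K [p [K0 hK]]]; apply: (admissible_fst _ (h := fun s => h (lam * s))).
  by apply: measurableT_comp => //; exact: mulrl_measurable.
exists (K * lam ^+ p), p => s; rewrite (le_trans (hK _))// -mulrA ler_wpM2l//.
rewrite -exprMn lerXn2r ?nnegrE ?mulr_ge0 ?addr_ge0// ?(ltW lam0)//.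
by rewrite normrM (ger0_norm (ltW lam0)) mulrDr mulr1 lerD2r.
Qed.

Lemma admX p : adm (fun u _ => u ^+ p).
Proof.
apply: adm_fst; first exact: exprn_measurable.
by exists 1, p; split=> // s; rewrite mul1r normrX lerXn2r ?nnegrE ?addr_ge0// lerDr.
Qed.

Lemma adm_cst K : adm (fun _ _ => K).
Proof. by apply: (@adm_snd (fun=> K)); exact: locally_bounded_cst. Qed.

Lemma admD H1 H2 : adm H1 -> adm H2 -> adm (fun s y => H1 s y + H2 s y).
Proof. exact: admissibleD. Qed.

Lemma admM H1 H2 : adm H1 -> adm H2 -> adm (fun s y => H1 s y * H2 s y).
Proof. exact: admissibleM. Qed.

Lemma admB H1 H2 : adm H1 -> adm H2 -> adm (fun s y => H1 s y - H2 s y).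
Proof. exact: admissibleB. Qed.

Lemma admN H : adm H -> adm (fun s y => - H s y).
Proof. exact: admissibleN. Qed.

Lemma admXH p H : adm H -> adm (fun u w => H u w ^+ p).
Proof.
move=> aH; elim: p => [|p IH].
  by under eq_fun do under eq_fun do rewrite expr0; exact: adm_cst.
by under eq_fun do under eq_fun do rewrite exprS; exact: admM.
Qed.

Lemma adm_norm H : adm H -> adm (fun u w => `|H u w|).
Proof.
move=> [mH [K [p [K0 bH]]]]; split; first exact: measurableT_comp.
by exists K, p; split=> // s y yB; rewrite normr_id bH.
Qed.

Lemma adm_id : adm (fun u _ => u).
Proof. exact: (admX 1). Qed.

Lemma cw_expectD H1 H2 : adm H1 -> adm H2 ->
  E (fun u w => H1 u w + H2 u w) = E H1 + E H2.
Proof. by move=> a1 a2; rewrite /E /Br (bracketD _ mS bS _ A0)// mulrDl. Qed.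

Lemma cw_expectB H1 H2 : adm H1 -> adm H2 ->
  E (fun u w => H1 u w - H2 u w) = E H1 - E H2.
Proof. by move=> a1 a2; rewrite /E /Br (bracketB _ mS bS _ A0)// mulrBl. Qed.

Lemma cw_expectZ K H : adm H -> E (fun u w => K * H u w) = K * E H.
Proof. by move=> aH; rewrite /E /Br (bracketZ _ mS bS _ A0)// mulrA. Qed.

Lemma cw_expect_cst K : E (fun _ _ => K) = K.
Proof.
transitivity (E (fun _ _ => K * 1)).
  by congr (_ / _); apply: (eq_bracket _ bS) => s y _; rewrite mulr1.
by rewrite (cw_expectZ K (adm_cst 1)) /E divff ?gt_eqF ?bracket1_gt0// mulr1.
Qed.

Lemma eq_cw_expect H1 H2 : (forall u w, H1 u w = H2 u w) -> E H1 = E H2.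
Proof. by move=> H12; congr (_ / _); apply: (eq_bracket _ bS). Qed.

Lemma le_cw_expect H1 H2 : adm H1 -> adm H2 ->
  (forall u w, H1 u w <= H2 u w) -> E H1 <= E H2.
Proof.
move=> a1 a2 H12; rewrite ler_pM2r ?invr_gt0 ?bracket1_gt0//.
by apply: (le_bracket _ mS bS _ A0).
Qed.

Lemma normr_cw_expect_le H1 H2 : adm H1 -> adm H2 ->
  (forall u w, `|H1 u w| <= H2 u w) -> `|E H1| <= E H2.
Proof.
move=> a1 a2 H12; rewrite normrM [X in _ * X]ger0_norm ?invr_ge0 ?(ltW bracket1_gt0)//.
rewrite ler_pM2r ?invr_gt0 ?bracket1_gt0//.
by apply: (normr_bracket_le _ mS bS _ A0).
Qed.

Ltac adm := repeat first
  [ assumption | exact: adm_cst | exact: adm_id | exact: admX | exact: adm_snd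
  | apply: admB | apply: admD | apply: admN | apply: admM | apply: admXH
  | apply: adm_norm | (apply: adm_snd; lb; fail) ].

(** The conditional variance of U given W. It equals lam^(2-2k) / beta, hence is O(lam^-2) only for
    k >= 2. *)
Local Notation eps2 := (lam ^+ 2 / (N * beta)).

(** Gaussian integration by parts for U given W. For p = 0 the right side vanishes, which says that
    U - W is centred given W. *)
Lemma cw_expect_ibp p h : locally_bounded h ->
  E (fun u w => u ^+ p * (u - w) * h w) =
  p%:R * eps2 * E (fun u w => u ^+ p.-1 * h w).
Proof.
move=> lh; rewrite /E mulrA; congr (_ / _).
pose h' y := h (lam * y / N).
have lh' : locally_bounded h' by exact: scale_snd.
have ah' := admissible_snd NM lh'.
have a1 q : admissible NM (fun s y => s ^+ q * h' y).
  by apply: admissibleM => //; exact: admissibleX.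
have a2 : admissible NM (fun s y => s ^+ p * (2 * A * s - beta * y) * h' y).
  apply: admissibleM => //; apply: admissibleM; first exact: admissibleX.
  apply: admissibleB; first by apply: admissibleM; [exact: admissible_cst|exact: (admissibleX NM 1)].
  by apply: admissibleM; [exact: admissible_cst|apply: admissible_snd; exact: locally_bounded_id].
transitivity (Br (fun s y => lam ^+ p.+1 / (N * beta) *
    (s ^+ p * (2 * A * s - beta * y) * h' y))).
  apply: (eq_bracket _ bS) => s y _; rewrite /A exprS exprMn /h'; field.
  by rewrite (lt0r_neq0 b0) nat1r (lt0r_neq0 N0).
rewrite /Br (bracketZ _ mS bS _ A0)// (bracket_ibp _ mS bS _ A0)//.
case: p a2 => [|p] a2; first by rewrite !mul0r mulr0.
transitivity (p.+1%:R * eps2 * Br (fun s y => lam ^+ p * (s ^+ p * h' y))).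
  rewrite /Br (bracketZ _ mS bS _ A0)//= !exprS; field.
  by rewrite (lt0r_neq0 b0) nat1r (lt0r_neq0 N0).
by congr (_ * _); apply: (eq_bracket _ bS) => s y _; rewrite /= exprMn mulrA.
Qed.

(** Moment bounds for U. In the end they are chosen independently of n and [lam], and every constant
    below is built from them. *)
Context (Km : nat -> R).
Hypothesis hK : forall q, E (fun u _ => u ^+ (2 * q)) <= Km q.

Let lX p : locally_bounded (fun w : R => w ^+ p).
Proof. exact: locally_boundedX (@locally_bounded_id R). Qed.

Let x2ge0 q (x : R) : 0 <= x ^+ (2 * q).
Proof. by rewrite exprM exprn_ge0 ?sqr_ge0. Qed.

Lemma cw_expect_ge0 H : adm H -> (forall u w, 0 <= H u w) -> 0 <= E H.
Proof. by move=> aH H0; rewrite -(cw_expect_cst 0); apply: le_cw_expect => //; adm. Qed.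

Lemma moment_bound_ge0 q : 0 <= Km q.
Proof. by apply: le_trans (hK q); apply: cw_expect_ge0 => //; adm. Qed.

(** Jensen's inequality, as W is the conditional mean of U: the linear term of the tangent at W
    integrates to zero. *)
Lemma cw_expect_W q : E (fun _ w => w ^+ (2 * q)) <= Km q.
Proof.
apply: le_trans (hK q).
have -> : E (fun _ w => w ^+ (2 * q)) =
    E (fun u w => w ^+ (2 * q) + (2 * q)%:R * (u ^+ 0 * (u - w) * w ^+ (2 * q).-1)).
  have lw := lX (2 * q).-1.
  rewrite cw_expectD ?cw_expectZ ?cw_expect_ibp//; adm.
  by rewrite !mul0r mulr0 addr0.
apply: le_cw_expect; adm.
move=> u w; rewrite expr0 mul1r (mulrC (u - w)) mulrA.
exact: even_power_tangent.
Qed.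

Lemma cw_expect_sqdiff_W h : locally_bounded h ->
  E (fun u w => (u - w) ^+ 2 * h w) = eps2 * E (fun _ w => h w).
Proof.
move=> lh.
have lwh : locally_bounded (fun w => w * h w).
  by apply: locally_boundedM => //; exact: locally_bounded_id.
transitivity (E (fun u w => u ^+ 1 * (u - w) * h w - u ^+ 0 * (u - w) * (w * h w))).
  by apply: eq_cw_expect => u w; ring.
rewrite cw_expectB; adm.
rewrite !cw_expect_ibp// !mul0r subr0 mul1r; congr (_ * _).
by apply: eq_cw_expect => u w; rewrite expr0 mul1r.
Qed.

(** Integration by parts leaves [eps2] times (2q+1) E U^(2q) - 2q E(U^(2q-1) W). The mixed moment is
    at most 2 [Km q] in absolute value, and 2q + 1 + 4q = 6q + 1. *)
Lemma cw_expect_sqdiff_U q :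
  E (fun u w => (u - w) ^+ 2 * u ^+ (2 * q)) <= eps2 * ((6 * q)%:R + 1) * Km q.
Proof.
have lid := @locally_bounded_id R.
have l1 := locally_bounded_cst (1 : R).
have -> : E (fun u w => (u - w) ^+ 2 * u ^+ (2 * q)) =
    E (fun u w => u ^+ (2 * q).+1 * (u - w) * 1 - u ^+ (2 * q) * (u - w) * w).
  by apply: eq_cw_expect => u w; rewrite [u ^+ (2 * q).+1]exprS; ring.
have lw : locally_bounded (fun w : R => w) by [].
rewrite cw_expectB; adm.
rewrite !cw_expect_ibp//=.
have -> : E (fun u w => u ^+ (2 * q) * 1) = E (fun u w => u ^+ (2 * q)).
  by apply: eq_cw_expect => u w; rewrite mulr1.
have e0 : 0 <= eps2 by rewrite divr_ge0 ?sqr_ge0// ltW// mulr_gt0.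
set a := E _; set b := E _.
have ha : a <= Km q by exact: hK.
have hb : (2 * q)%:R * - b <= (2 * q)%:R * (2 * Km q).
  case: (posnP q) => [->|q0]; first by rewrite !mul0r.
  rewrite ler_wpM2l// (le_trans (ler_norm _))// normrN.
  have H1 : `|b| <= E (fun u w => u ^+ (2 * q) + w ^+ (2 * q)).
    apply: normr_cw_expect_le; adm.
    move=> u w; rewrite normrM normrX; apply: mulr_exprn_even.
    by rewrite prednK// muln_gt0.
  rewrite (le_trans H1)// cw_expectD; adm.
  have l2q := lX (2 * q).
  by rewrite mulr_natl mulr2n lerD ?hK ?cw_expect_W//; exact: adm_snd.
rewrite -natr1 (_ : _ - _ = eps2 * (((2 * q)%:R + 1) * a + (2 * q)%:R * - b)); last by ring.
apply: (@le_trans _ _ (eps2 * (((2 * q)%:R + 1) * Km q + (2 * q)%:R * (2 * Km q)))).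
  by rewrite ler_wpM2l// lerD// ler_wpM2l// addr_ge0.
by rewrite le_eqVlt; apply/orP; left; apply/eqP; rewrite !natrM; ring.
Qed.

Definition replace_const : R :=
  r%:R ^+ 2 * (1 + 2 * (((6 * k')%:R + 1) * Km k' + Km k')).

Lemma replace_const_ge0 : 0 <= replace_const.
Proof.
have := moment_bound_ge0 k' => H.
by rewrite mulr_ge0 ?sqr_ge0// addr_ge0// mulr_ge0// addr_ge0// mulr_ge0// addr_ge0.
Qed.

(** When U^r is expanded around W, the linear term integrates to zero by centring, and the quadratic
    remainder costs one conditional variance. *)
Lemma cw_expect_replace f K : locally_bounded f -> 0 <= K ->
  (forall w, `|f w| <= K * (1 + `|w|)) ->
  `|E (fun u w => u ^+ r * f w) - E (fun _ w => w ^+ r * f w)| <=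
  K * (replace_const / beta / lam ^+ 2).
Proof.
move=> lf K0 fK.
have af := adm_snd lf.
have awr := adm_snd (lX r).
have := replace_const_ge0; rewrite /replace_const.
have : forall j, Km j >= 0 by exact: moment_bound_ge0.
have := @cw_expect_sqdiff_U; have := cw_expect_W.
(* For k = 1 the conditional variance is not small, but then r = 1 and the centring gives an exact
   equality. *)
case: k' lamk awr => [|j] lamk' awr EW EU K0' rc0.
  suff -> : E (fun u w => u ^+ (2 * 1).-1 * f w) - E (fun _ w => w ^+ (2 * 1).-1 * f w) = 0.
    by rewrite normr0 mulr_ge0// divr_ge0 ?sqr_ge0// divr_ge0// ltW.
  rewrite -cw_expectB; adm.
  transitivity (E (fun u w => u ^+ 0 * (u - w) * f w)).
    by apply: eq_cw_expect => u w; rewrite !muln1 /= !expr1 expr0; ring.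
  by rewrite cw_expect_ibp// !mul0r.
have er : (2 * j.+2).-1 = (2 * j).+3 by rewrite !mulnS.
rewrite er in awr rc0 *.
have lwf : locally_bounded (fun w => w ^+ (2 * j).+2 * f w).
  by apply: locally_boundedM.
have awr' := adm_snd (lX (2 * j).+2).
have aw2 := adm_snd (lX (2 * j.+1)).
have -> : E (fun u w => u ^+ (2 * j).+3 * f w) - E (fun _ w => w ^+ (2 * j).+3 * f w) =
    E (fun u w => (u ^+ (2 * j).+3 - w ^+ (2 * j).+3 -
       (2 * j).+3%:R * w ^+ (2 * j).+2 * (u - w)) * f w).
  have aid := adm_snd (@locally_bounded_id R).
  rewrite -cw_expectB; adm.
  transitivity (E (fun u w => (u ^+ (2 * j).+3 - w ^+ (2 * j).+3 -
       (2 * j).+3%:R * w ^+ (2 * j).+2 * (u - w)) * f w +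
     (2 * j).+3%:R * (u ^+ 0 * (u - w) * (w ^+ (2 * j).+2 * f w)))).
    by apply: eq_cw_expect => u w; rewrite expr0; ring.
  rewrite cw_expectD ?cw_expectZ ?cw_expect_ibp//; adm.
  by rewrite !mul0r mulr0 addr0.
have aid := adm_snd (@locally_bounded_id R).
apply: (@le_trans _ _ (E (fun u w => K * (2 * j).+3%:R ^+ 2 *
   ((u - w) ^+ 2 * 1 + 2 * ((u - w) ^+ 2 * u ^+ (2 * j.+1) + (u - w) ^+ 2 * w ^+ (2 * j.+1)))))).
  apply: normr_cw_expect_le; adm.
  move=> u w; set m := Num.max `|u| `|w|.
  have um : `|u| <= m by rewrite le_max lexx.
  have wm : `|w| <= m by rewrite le_max lexx orbT.
  have m0 : 0 <= m by rewrite (le_trans _ um).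
  have H1 := power_second_order (2 * j).+1 um wm.
  rewrite normrM; apply: (le_trans (ler_pM _ _ H1 (fK w))) => //.
  have H2 : m ^+ (2 * j).+1 * (1 + `|w|) <= 1 + 2 * (u ^+ (2 * j.+1) + w ^+ (2 * j.+1)).
    have H3 := max_exprn_even u w j.+1.
    have H4 : m ^+ (2 * j).+1 <= 1 + m ^+ (2 * j.+1).
      rewrite -[X in X ^+ (2 * j).+1 <= _](ger0_norm m0).
      by apply: ler_exprn_even; rewrite mulnS.
    have H5 : m ^+ (2 * j).+1 * `|w| <= m ^+ (2 * j.+1).
      have -> : (2 * j.+1 = (2 * j).+2)%N by rewrite mulnS.
      by rewrite [leRHS]exprSr ler_wpM2l// exprn_ge0.
    rewrite mulrDr mulr1; apply: (le_trans (lerD H4 H5)).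
    by rewrite -/m in H3; lra.
  have P0 : 0 <= K * (2 * j).+3%:R ^+ 2 * (u - w) ^+ 2.
    by rewrite mulr_ge0 ?sqr_ge0// mulr_ge0 ?sqr_ge0.
  have := ler_wpM2l P0 H2; congr (_ <= _); ring.
have lw2 := lX (2 * j.+1).
have l1 := locally_bounded_cst (1 : R).
rewrite cw_expectZ; adm.
rewrite cw_expectD; adm.
rewrite cw_expectZ; adm.
rewrite cw_expectD; adm.
rewrite !cw_expect_sqdiff_W// cw_expect_cst mulr1.
have e0 : 0 <= eps2 by rewrite divr_ge0 ?sqr_ge0// ltW// mulr_gt0.
(* Here k >= 2, so N = lam^(2k) is at least lam^4. *)
have ee : eps2 <= beta^-1 / lam ^+ 2.
  rewrite -lamk' invfM mulrA mulrC ler_wpM2l ?invr_ge0 ?(ltW b0)//.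
  rewrite (_ : 2 * j.+2 = 2 + 2 + 2 * j)%N; last by rewrite !mulnS addnA.
  have -> : lam ^+ 2 / lam ^+ (2 + 2 + 2 * j) = (lam ^+ 2)^-1 * (lam ^+ (2 * j))^-1.
    by rewrite 2!exprD; field; rewrite !expf_neq0 ?lt0r_neq0.
  rewrite ler_piMr ?invr_ge0 ?sqr_ge0// invf_le1 ?exprn_gt0//.
  exact: exprn_ege1.
apply: (@le_trans _ _ (K * (2 * j).+3%:R ^+ 2 * (eps2 * (1 +
    2 * (((6 * j.+1)%:R + 1) * Km j.+1 + Km j.+1))))).
  rewrite ler_wpM2l ?(mulr_ge0 K0 (sqr_ge0 _))//.
  rewrite [leRHS](_ : _ = eps2 + 2 * (eps2 * ((6 * j.+1)%:R + 1) * Km j.+1 + eps2 * Km j.+1)).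
    rewrite lerD2l ler_wpM2l//; apply: lerD; first exact: EU.
    by apply: ler_wpM2l => //; exact: EW.
  by ring.
rewrite [leRHS](_ : _ = K * (2 * j).+3%:R ^+ 2 * (beta^-1 / lam ^+ 2 *
   (1 + 2 * (((6 * j.+1)%:R + 1) * Km j.+1 + Km j.+1)))); last by ring.
rewrite ler_wpM2l ?(mulr_ge0 K0 (sqr_ge0 _))// ler_wpM2r//.
by rewrite addr_ge0// mulr_ge0// addr_ge0// mulr_ge0// addr_ge0.
Qed.

Hypothesis mmean : measurable_fun setT mean.
Hypothesis mvar : measurable_fun setT var.

Let meanM s : `|mean s| <= M. Proof. by rewrite -meanE; exact: normr_tilted_mean. Qed.
Let var0 s : 0 <= var s. Proof. by rewrite -varE; exact: tilted_var_ge0. Qed.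
Let varM s : var s <= M ^+ 2. Proof. by rewrite -varE; exact: tilted_var_le. Qed.

Let amean : admissible NM (fun s _ => mean s).
Proof. by apply: admissible_fst => //; exists M, 0%N => s; rewrite expr0 mulr1 meanM. Qed.

Let avar : admissible NM (fun s _ => var s).
Proof.
apply: admissible_fst => //; exists (M ^+ 2), 0%N => s.
by rewrite expr0 mulr1 ger0_norm ?varM.
Qed.

Let smean : adm (fun u _ => mean (u / lam)).
Proof.
have := amean; rewrite /adm; congr (admissible _ _).
by apply/funext => s; apply/funext => y; rewrite mulrAC mulfV ?mul1r// gt_eqF.
Qed.

Let svar : adm (fun u _ => var (u / lam)).
Proof.
have := avar; rewrite /adm; congr (admissible _ _).
by apply/funext => s; apply/funext => y; rewrite mulrAC mulfV ?mul1r// gt_eqF.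
Qed.

Let lamr : lam * lam ^+ r = N.
Proof. by rewrite -exprS -lamk mulnS. Qed.

(** The integration by parts with p = 0; against functions of the spin sum y it allows y to be
    exchanged for N s. *)
Let Br_centered g : locally_bounded g ->
  Br (fun s y => (N * s - y) * g y) = 0.
Proof.
move=> lg; have := bracket_ibp (power_probability rho n) mS bS beta A0 0 lg.
rewrite mul0r => H; apply: (mulfI (lt0r_neq0 b0)); rewrite mulr0 -{}H.
have ag := admissible_snd NM lg.
have ay := admissible_snd NM (@locally_bounded_id R).
have as1 := admissibleX NM 1.
rewrite /Br -(bracketZ _ mS bS _ A0).
  by apply: (eq_bracket _ bS) => s y _; rewrite /A expr0; field.
apply: admissibleM => //; apply: admissibleB => //.
by apply: admissibleM => //; exact: admissible_cst.
Qed.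

Let shift_bound y y0 : `|y - y0| <= M ->
  `|lam * y / N - lam * y0 / N| <= M * lam / N.
Proof.
move=> H; rewrite -mulrBl -mulrBr normrM (normrM lam) (gtr0_norm lam0).
rewrite [X in _ * X <= _]ger0_norm ?invr_ge0 ?(ltW N0)// ler_wpM2r ?invr_ge0 ?(ltW N0)//.
by rewrite mulrC ler_wpM2r// ltW.
Qed.

(** A spin of size at most M changes W by at most M lam / N, so increments of [f] and [D] matter
    only at that distance. The tilted identity contains y - N mean; adding the null term (N s - y) g
    turns it into the drift N (s - mean). *)
Lemma cw_stein f D e : locally_bounded f -> locally_bounded D -> locally_bounded e ->
  (forall w v, `|w - v| <= M * lam / N -> `|D w - D v| <= e w) ->
  (forall w v, `|w - v| <= M * lam / N ->
     `|f w - f v - (w - v) * D v| <= M * lam / N * e w) ->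
  `|E (fun u w => lam ^+ r * (u / lam - mean (u / lam)) * f w - var (u / lam) * D w)| <=
  3 * M ^+ 2 * E (fun _ w => e w).
Proof.
move=> lf lD le De fe.
pose g y := f (lam * y / N); pose Dg y := lam / N * D (lam * y / N).
pose Er y := lam / N * e (lam * y / N).
have lg : locally_bounded g by exact: scale_snd.
have lDg : locally_bounded Dg by apply: locally_boundedM; [exact: locally_bounded_cst|exact: scale_snd].
have lEr : locally_bounded Er by apply: locally_boundedM; [exact: locally_bounded_cst|exact: scale_snd].
have lN0 : 0 <= lam / N by rewrite divr_ge0// ltW.
have DgE s y : `|s - y| <= M -> `|Dg s - Dg y| <= Er s.
  move=> /shift_bound /De H; rewrite /Dg /Er -mulrBr normrM ger0_norm//.
  by rewrite ler_wpM2l.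
have gE s y : `|s - y| <= M -> `|g s - g y - (s - y) * Dg y| <= M * Er s.
  move=> /shift_bound /fe H; rewrite /g /Er mulrA (mulrA M lam).
  apply: le_trans H; rewrite le_eqVlt; apply/orP; left; apply/eqP.
  by congr `|_|; rewrite /Dg; ring.
have fib s := tilted_stein rho mX M0 bX n0 (beta * s) lg lDg lEr DgE gE.
have ag := admissible_snd NM lg; have aDg := admissible_snd NM lDg.
have aEr := admissible_snd NM lEr.
have ay := admissible_snd NM (@locally_bounded_id R).
have ac c := admissible_cst NM c.
have as1 : admissible NM (fun s _ => s) by exact: (admissibleX NM 1).
pose H1 s y := (y - N * mean s) * g y - N * (var s * Dg y).
have aH1 : admissible NM H1.
  apply: admissibleB; apply: admissibleM => //; first by apply: admissibleB => //; exact: admissibleM.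
  exact: admissibleM.
have HB : `|Br H1| <= Br (fun _ y => N * (3 * M ^+ 2) * Er y).
  apply: (normr_bracket_fiber_le mS bS A0) => //; first exact: admissibleM.
  move=> s; have := fib s; rewrite meanE varE => fibs; apply: le_trans fibs _.
  have lE : locally_bounded (fun y => expR (beta * s * y) * Er y).
    by apply: locally_boundedM => //; exact: locally_bounded_exp.
  rewrite mulrA -(EsumZ _ mX bX _ _ lE).
  rewrite le_eqVlt; apply/orP; left; apply/eqP; apply: eq_Rintegral => x _.
  by ring.
have -> : E (fun u w => lam ^+ r * (u / lam - mean (u / lam)) * f w - var (u / lam) * D w) =
    lam^-1 * (Br H1 + Br (fun s y => (N * s - y) * g y)) / Br (fun _ _ => 1).
  rewrite /E -(bracketD _ mS bS _ A0)//; last first.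
    by apply: admissibleM => //; apply: admissibleB => //; exact: admissibleM.
  rewrite -(bracketZ _ mS bS _ A0); last first.
    apply: admissibleD => //; apply: admissibleM => //.
    by apply: admissibleB => //; exact: admissibleM.
  congr (_ / _); apply: (eq_bracket _ bS) => s y _.
  have -> : lam * s / lam = s by rewrite mulrAC mulfV ?mul1r// gt_eqF.
  have -> : lam ^+ r = N / lam by rewrite -lamr mulrAC mulfV ?mul1r// gt_eqF.
  rewrite /H1 /g /Dg; field.
  by rewrite nat1r (lt0r_neq0 N0) gt_eqF.
rewrite Br_centered// addr0 /E mulrA normrM (ger0_norm (_ : 0 <= _^-1)); last first.
  by rewrite invr_ge0 ltW// bracket1_gt0.
rewrite ler_wpM2r ?invr_ge0 ?(ltW bracket1_gt0)//.
rewrite normrM gtr0_norm ?invr_gt0// ler_pdivrMl//.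
apply: (le_trans HB); rewrite mulrCA -!(bracketZ _ mS bS _ A0).
  rewrite le_eqVlt; apply/orP; left; apply/eqP; apply: (eq_bracket _ bS) => s y _.
  by rewrite /Er; field; rewrite nat1r (lt0r_neq0 N0).
- exact: (admissibleM (ac _) (adm_snd le)).
- exact: (adm_snd le).
Qed.

(** In terms of the spin sum the window has length 2M, so the truncated linear test function is
    bounded by M + 2M; this is the factor 3M. *)
Lemma cw_concentration z :
  E (fun u w => var (u / lam) * \1_(`[z - M * lam / N, z + M * lam / N]) w) <=
  3 * M * E (fun u _ => `|u / lam - mean (u / lam)|).
Proof.
pose a := z * N / lam - M; pose b := z * N / lam + M.
pose g y := clamp ((b - a) / 2 + 2 * M) (y - (a + b) / 2).
have lg : locally_bounded g by exact: locally_bounded_clamp.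
have lI : locally_bounded (\1_(`[a, b] : set R) : R -> R) by exact: locally_bounded_indic.
have lI' : locally_bounded (\1_(`[z - M * lam / N, z + M * lam / N] : set R) : R -> R).
  exact: locally_bounded_indic.
have ag := admissible_snd NM lg; have aI := admissible_snd NM lI.
have ay := admissible_snd NM (@locally_bounded_id R).
have ac c := admissible_cst NM c.
have as1 : admissible NM (fun s _ => s) by exact: (admissibleX NM 1).
have II y : \1_(`[z - M * lam / N, z + M * lam / N]) (lam * y / N) = \1_(`[a, b]) y :> R.
  have e1 : (z - M * lam / N <= lam * y / N) = (a <= y).
    rewrite /a -(ler_pM2l (divr_gt0 N0 lam0)).
    have -> : N / lam * (lam * y / N) = y by field; rewrite nat1r (lt0r_neq0 N0) gt_eqF.
    by congr (_ <= _); field; rewrite nat1r (lt0r_neq0 N0) gt_eqF.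
  have e2 : (lam * y / N <= z + M * lam / N) = (y <= b).
    rewrite /b -(ler_pM2l (divr_gt0 N0 lam0)).
    have -> : N / lam * (lam * y / N) = y by field; rewrite nat1r (lt0r_neq0 N0) gt_eqF.
    by congr (_ <= _); field; rewrite nat1r (lt0r_neq0 N0) gt_eqF.
  by rewrite !indicE !mem_setE !in_itv/= e1 e2.
pose H1 s y := (y - N * mean s) * g y.
have aH1 : admissible NM H1.
  by apply: admissibleM => //; apply: admissibleB => //; exact: admissibleM.
have aH2 : admissible NM (fun s y => N * (var s * \1_(`[a, b]) y)).
  by apply: admissibleM => //; exact: admissibleM.
have aH3 : admissible NM (fun s y => (N * s - y) * g y).
  by apply: admissibleM => //; apply: admissibleB => //; exact: admissibleM.
(* Comparison with the zero function turns the nonnegativity at each fixed s into nonnegativity of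
   the whole integral. *)
have HB : 0 <= Br (fun s y => H1 s y - N * (var s * \1_(`[a, b]) y)).
  apply: (le_trans (normr_ge0 (Br (fun _ _ => 0)))).
  apply: (normr_bracket_fiber_le mS bS A0) => //; first exact: admissibleB.
  move=> s; rewrite (_ : Rintegral _ _ _ = 0) ?normr0; last first.
    by under eq_Rintegral do rewrite mulr0; exact: probability_Rintegral_cst.
  have lE := locally_boundedM (locally_bounded_exp (beta * s)) lI.
  have lG : locally_bounded (fun y => expR (beta * s * y) * ((y - N * mean s) * g y)).
    lb.
  have := tilted_concentration rho mX M0 bX n0 (beta * s) a b; rewrite meanE varE.
  rewrite mulrA -(EsumZ _ mX bX _ _ lE) -subr_ge0 -(EsumB _ mX bX)//; last first.
    by apply: locally_boundedM => //; exact: locally_bounded_cst.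
  congr (0 <= _); apply: eq_Rintegral => x _; rewrite /H1 /g; ring.
have HE : N * Br (fun s y => var s * \1_(`[a, b]) y) <= N * (3 * M * Br (fun s _ => `|s - mean s|)).
  have am : admissible NM (fun s y => `|s - mean s|).
    have := admissibleB as1 amean => -[mm [K [p [K0 bK]]]]; split.
      exact: measurableT_comp.
    by exists K, p; split=> // s y yB; rewrite normr_id; exact: (bK s y yB).
  rewrite -subr_ge0; apply: (le_trans HB).
  rewrite /Br -!(bracketZ _ mS bS _ A0)//; try exact: admissibleM.
  (* Adding the null term replaces y - N mean by N (s - mean), a function of s alone. *)
  rewrite -(addr0 (bracket _ _ _ _ (fun s y => H1 s y - _))) -(Br_centered lg) -(bracketD _ mS bS _ A0)//; last exact: admissibleB.
  rewrite -(bracketB _ mS bS _ A0)//; try by do 2 apply: admissibleM => //.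
  apply: (le_bracket _ mS bS _ A0).
  - by apply: admissibleD => //; exact: admissibleB.
  - by apply: admissibleB => //; apply: admissibleM => //; exact: admissibleM.
  move=> s y _; rewrite /H1.
  have -> : (y - N * mean s) * g y - N * (var s * \1_(`[a, b]) y) + (N * s - y) * g y =
    N * ((s - mean s) * g y) - N * (var s * \1_(`[a, b]) y) by ring.
  rewrite lerB// ler_wpM2l ?(ltW N0)//.
  rewrite (le_trans (ler_norm _))// normrM mulrC ler_wpM2r//.
  have -> : g y = clamp (3 * M) (y - (a + b) / 2).
    by rewrite /g; congr (clamp _ _); rewrite /a /b; field; exact: lt0r_neq0.
  by rewrite normr_clamp// mulr_ge0.
rewrite ler_pM2l// in HE.
rewrite /E mulrA; apply: ler_wpM2r; first by rewrite invr_ge0 ltW// bracket1_gt0.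
have e1 : lam != 0 by rewrite gt_eqF.
have -> : Br (fun s y => var (lam * s / lam) *
   \1_(`[z - M * lam / N, z + M * lam / N]) (lam * y / N)) =
   Br (fun s y => var s * \1_(`[a, b]) y).
  by apply: (eq_bracket _ bS) => s y _; rewrite II mulrAC mulfV ?mul1r.
have -> : Br (fun s y => `|lam * s / lam - mean (lam * s / lam)|) =
   Br (fun s y => `|s - mean s|).
  by apply: (eq_bracket _ bS) => s y _; rewrite mulrAC mulfV ?mul1r.
exact: HE.
Qed.

Context (c C1 : R).
Hypotheses (c0 : 0 <= c) (C10 : 0 <= C1).
(** Both bounds are global because U / lam ranges over the whole line. The order 2k + 1 in the
    second one, two above the leading power, is the gain from parity. *)
Hypothesis varC : forall s, `|var s - 1| <= C1 * s ^+ 2.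
Hypothesis meanC : forall s, `|s - mean s - c * s ^+ r| <= C1 * `|s| ^+ (2 * k).+1.

Let drift u := lam ^+ r * (u / lam - mean (u / lam)).

Let adrift : adm (fun u _ => drift u).
Proof.
apply: admM; first exact: adm_cst.
by apply: admB => //; apply: admM; [exact: adm_id|exact: adm_cst].
Qed.

Let lam2 : lam ^+ r * lam ^+ 2 = lam ^+ (2 * k).+1.
Proof. by rewrite -exprD; congr (_ ^+ _); rewrite addn2 prednK// muln_gt0. Qed.

Let drift_approx u : `|drift u - c * u ^+ r| <= C1 / lam ^+ 2 * `|u| ^+ (2 * k).+1.
Proof.
have l0 : lam != 0 by rewrite gt_eqF.
have -> : drift u - c * u ^+ r = lam ^+ r *
    (u / lam - mean (u / lam) - c * (u / lam) ^+ r).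
  by rewrite /drift expr_div_n; field; rewrite expf_neq0.
rewrite normrM ger0_norm ?exprn_ge0 ?(ltW lam0)//.
apply: (le_trans (ler_wpM2l _ (meanC _))); first by rewrite exprn_ge0// ltW.
rewrite normrM normfV (gtr0_norm lam0) expr_div_n -lam2 le_eqVlt; apply/orP; left.
by apply/eqP; field; rewrite l0 expf_neq0.
Qed.

Let var_approx u : `|var (u / lam) - 1| <= C1 / lam ^+ 2 * u ^+ 2.
Proof.
apply: (le_trans (varC _)); rewrite expr_div_n le_eqVlt; apply/orP; left.
by apply/eqP; field; rewrite gt_eqF.
Qed.

Let lam2_ge0 : 0 <= C1 / lam ^+ 2. Proof. by rewrite divr_ge0// sqr_ge0. Qed.

(** The three summands pay for replacing the drift by c U^r, the variance by 1, and U^r by W^r. *)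
Definition main_const : R :=
  C1 * (1 + 3 * Km k.+1) + C1 * Km 1 + c * (replace_const / beta).

Lemma cw_main f D e K :
  locally_bounded f -> locally_bounded D -> locally_bounded e ->
  (forall w v, `|w - v| <= M * lam / N -> `|D w - D v| <= e w) ->
  (forall w v, `|w - v| <= M * lam / N ->
     `|f w - f v - (w - v) * D v| <= M * lam / N * e w) ->
  0 <= K -> (forall w, `|f w| <= K * (1 + `|w|)) -> (forall w, `|D w| <= K) ->
  `|c * E (fun _ w => w ^+ r * f w) - E (fun _ w => D w)| <=
  3 * M ^+ 2 * E (fun _ w => e w) + K * (main_const / lam ^+ 2).
Proof.
move=> lf lD le De fe K0 fK DK.
have af := adm_snd lf; have aD := adm_snd lD.
have arf : adm (fun u w => u ^+ r * f w) by apply: admM => //; exact: admX.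
have awf : adm (fun _ w => w ^+ r * f w) by apply: admM => //; exact: adm_snd.
have H1 := cw_stein lf lD le De fe.
have H2 := cw_expect_replace lf K0 fK.
have adf : adm (fun u w => drift u * f w) by exact: admM.
have avD : adm (fun u w => var (u / lam) * D w) by exact: admM.
have aw2 := adm_snd (lX (2 * k.+1)).
have H3 : `|E (fun u w => (drift u - c * u ^+ r) * f w)| <=
    C1 / lam ^+ 2 * K * (1 + 3 * Km k.+1).
  apply: (@le_trans _ _ (E (fun u w => C1 / lam ^+ 2 * K *
      (1 + (2 * u ^+ (2 * k.+1) + w ^+ (2 * k.+1)))))).
    apply: normr_cw_expect_le; adm.
    move=> u w; rewrite normrM.
    apply: (le_trans (ler_pM _ _ (drift_approx u) (fK w))) => //.
    rewrite [leLHS](_ : _ = C1 / lam ^+ 2 * K *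
      (`|u| ^+ (2 * k).+1 + `|u| ^+ (2 * k).+1 * `|w|)); last by ring.
    apply: ler_wpM2l; first exact: mulr_ge0.
    have h1 : `|u| ^+ (2 * k).+1 <= 1 + u ^+ (2 * k.+1).
      by apply: ler_exprn_even; rewrite !mulnS.
    have h2 : `|u| ^+ (2 * k).+1 * `|w| <= u ^+ (2 * k.+1) + w ^+ (2 * k.+1).
      by apply: mulr_exprn_even; rewrite !mulnS.
    by rewrite (le_trans (lerD h1 h2))// le_eqVlt; apply/orP; left; apply/eqP; ring.
  rewrite cw_expectZ; adm.
  rewrite cw_expectD; adm.
  rewrite cw_expectD; adm.
  rewrite cw_expectZ; adm.
  rewrite cw_expect_cst ler_wpM2l ?(mulr_ge0 lam2_ge0 K0)// lerD2l.
  have h1 := hK k.+1; have h2 := cw_expect_W k.+1.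
  lra.
have H4 : `|E (fun u w => (var (u / lam) - 1) * D w)| <= C1 / lam ^+ 2 * K * Km 1.
  apply: (@le_trans _ _ (E (fun u w => C1 / lam ^+ 2 * K * u ^+ (2 * 1)))).
    apply: normr_cw_expect_le; adm.
    move=> u w; rewrite normrM mulrAC.
    by apply: (le_trans (ler_pM _ _ (var_approx u) (DK w))).
  by rewrite cw_expectZ; adm; rewrite ler_wpM2l ?(mulr_ge0 lam2_ge0 K0)//; exact: hK.
have -> : c * E (fun _ w => w ^+ r * f w) - E (fun _ w => D w) =
    E (fun u w => drift u * f w - var (u / lam) * D w) -
    (E (fun u w => (drift u - c * u ^+ r) * f w)) +
    E (fun u w => (var (u / lam) - 1) * D w) -
    c * (E (fun u w => u ^+ r * f w) - E (fun _ w => w ^+ r * f w)).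
  have -> : E (fun u w => (drift u - c * u ^+ r) * f w) =
      E (fun u w => drift u * f w) - c * E (fun u w => u ^+ r * f w).
    rewrite -cw_expectZ// -cw_expectB//; last by apply: admM => //; exact: adm_cst.
    by apply: eq_cw_expect => u w; ring.
  have -> : E (fun u w => (var (u / lam) - 1) * D w) =
      E (fun u w => var (u / lam) * D w) - E (fun _ w => D w).
    by rewrite -cw_expectB//; apply: eq_cw_expect => u w; ring.
  by rewrite cw_expectB//; ring.
have -> : 3 * M ^+ 2 * E (fun _ w => e w) + K * (main_const / lam ^+ 2) =
   3 * M ^+ 2 * E (fun _ w => e w) + C1 / lam ^+ 2 * K * (1 + 3 * Km k.+1) +
   C1 / lam ^+ 2 * K * Km 1 + c * (K * (replace_const / beta / lam ^+ 2)).
  by rewrite /main_const; ring.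
apply: (le_trans (ler_normB _ _)); apply: lerD; last first.
  by rewrite normrM (ger0_norm c0) ler_wpM2l.
apply: (le_trans (ler_normD _ _)); apply: lerD => //.
by apply: (le_trans (ler_normB _ _)); exact: lerD.
Qed.

(** For f = id the derivative is constant, so the remainder [e] is zero and no window probability
    enters; the error is purely of order lam^-2. *)
Lemma cw_moment : `|c * E (fun _ w => w ^+ (2 * k)) - 1| <= main_const / lam ^+ 2.
Proof.
have lid := @locally_bounded_id R.
have l1 := locally_bounded_cst (1 : R); have l0 := locally_bounded_cst (0 : R).
have : `|c * E (fun _ w => w ^+ r * w) - E (fun _ _ => 1)| <=
    3 * M ^+ 2 * E (fun _ _ => 0) + 1 * (main_const / lam ^+ 2).
  apply: (cw_main lid l1 l0) => //.
  - by move=> w v _; rewrite subrr normr0.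
  - by move=> w v _; rewrite mulr1 subrr normr0 mulr0.
  - by move=> w; rewrite mul1r lerDr.
  - by move=> w; rewrite normr1.
rewrite !cw_expect_cst mulr0 add0r mul1r.
have -> // : E (fun _ w => w ^+ r * w) = E (fun _ w => w ^+ (2 * k)).
by apply: eq_cw_expect => u w; rewrite -exprSr prednK// muln_gt0.
Qed.

Definition concentration_const : R :=
  3 * M * (c * (1 + Km k) + C1 * (1 + Km k.+1)).

(** The concentration bound carries the weight var; writing 1 = var - (var - 1) removes it at the
    cost of a lam^-2 term. The factor lam^-r appears because |s - mean| is |drift| / lam^r, and the
    drift has bounded mean absolute value. *)
Lemma cw_concentration_le z :
  E (fun _ w => \1_(`[z - M * lam / N, z + M * lam / N]) w) <=
  concentration_const / lam ^+ r + C1 * Km 1 / lam ^+ 2.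
Proof.
set I := `[_, _]%classic.
have lI : locally_bounded (\1_I : R -> R) by apply: locally_bounded_indic; exact: measurable_itv.
have aI := adm_snd lI.
have -> : E (fun _ w => \1_I w) =
    E (fun u w => var (u / lam) * \1_I w) - E (fun u w => (var (u / lam) - 1) * \1_I w).
  rewrite -cw_expectB; [|by adm|by adm].
  by apply: eq_cw_expect => u w; ring.
apply: lerD.
  apply: (le_trans (cw_concentration z)).
  rewrite [leRHS](_ : _ = 3 * M * ((lam ^+ r)^-1 *
    (c * (1 + Km k) + C1 * (1 + Km k.+1)))); last by rewrite /concentration_const; ring.
  apply: ler_wpM2l; first exact: mulr_ge0.
  have -> : E (fun u _ => `|u / lam - mean (u / lam)|) =
      (lam ^+ r)^-1 * E (fun u _ => `|drift u|).
    rewrite -cw_expectZ; last exact: adm_norm.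
    apply: eq_cw_expect => u w; rewrite /drift normrM ger0_norm ?exprn_ge0 ?(ltW lam0)//.
    by rewrite mulKf// expf_neq0// gt_eqF.
  apply: ler_wpM2l; first by rewrite invr_ge0 exprn_ge0// ltW.
  apply: (@le_trans _ _ (E (fun u _ => c * (1 + u ^+ (2 * k)) + C1 * (1 + u ^+ (2 * k.+1))))).
    apply: le_cw_expect; adm.
    move=> u _; rewrite -[drift u](subrK (c * u ^+ r)) (le_trans (ler_normD _ _))// addrC.
    apply: lerD.
      rewrite normrM (ger0_norm c0) ler_wpM2l// normrX.
      by apply: ler_exprn_even; exact: leq_pred.
    apply: (le_trans (drift_approx u)); apply: ler_pM => //.
      by rewrite ler_pdivrMr ?exprn_gt0// ler_peMr// exprn_ege1.
    by apply: ler_exprn_even; rewrite !mulnS.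
  do 2 (rewrite ?cw_expectD ?cw_expectZ; adm).
  by rewrite !cw_expect_cst lerD// ler_wpM2l// lerD2l hK.
apply: (le_trans (ler_norm _)); rewrite normrN.
apply: (@le_trans _ _ (E (fun u _ => C1 / lam ^+ 2 * u ^+ (2 * 1)))).
  apply: normr_cw_expect_le; adm.
  move=> u w; rewrite normrM -[leRHS]mulr1 muln1; apply: ler_pM => //.
  by rewrite indicE; case: (_ \in _); rewrite ?normr1 ?normr0.
rewrite cw_expectZ; adm.
rewrite [leRHS](_ : _ = C1 / lam ^+ 2 * Km 1); last by ring.
by rewrite ler_wpM2l//; exact: hK.
Qed.

(** The coefficient [a] of Stein's equation is kept apart from [c], since it will be 1 / E(W^(2k));
    the last term pays for the difference. [D] is the derivative that Stein's equation prescribes,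
    and [e] bounds its oscillation: a smooth part, and the indicator of the window in which the jump
    at z is felt. *)
Lemma cw_stein_bound a z Fz f K L :
  let D w := a * w ^+ r * f w + \1_(`]-oo, z]) w - Fz in
  let e w := M * lam / N * (L * (1 + `|w| ^+ r)) +
             \1_(`[z - M * lam / N, z + M * lam / N]) w in
  locally_bounded f -> 0 <= K -> 0 <= L ->
  (forall w, `|f w| <= K) -> (forall w, `|D w| <= K) ->
  (forall w v, `|w - v| <= M * lam / N -> `|D w - D v| <= e w) ->
  (forall w v, `|w - v| <= M * lam / N ->
     `|f w - f v - (w - v) * D v| <= M * lam / N * e w) ->
  `|E (fun _ w => \1_(`]-oo, z]) w) - Fz| <=
  (3 * M ^+ 2 * (M * (L * (2 + Km k)) + concentration_const)) / lam ^+ r +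
  (3 * M ^+ 2 * (C1 * Km 1) + K * main_const) / lam ^+ 2 +
  `|c - a| * (K * (1 + Km k)).
Proof.
move=> D e lf K0 L0 fK DK De fe.
have lI : locally_bounded (\1_(`]-oo, z] : set R) : R -> R).
  by apply: locally_bounded_indic; exact: measurable_itv.
set I := `[_, _]%classic in e De fe.
have lJ : locally_bounded (\1_I : R -> R) by apply: locally_bounded_indic; exact: measurable_itv.
have lr : locally_bounded (fun w : R => `|w| ^+ r).
  by apply: locally_boundedX; apply: locally_bounded_norm; exact: locally_bounded_id.
have lwf : locally_bounded (fun w => w ^+ r * f w) by exact: locally_boundedM.
have lD : locally_bounded D.
  rewrite /D; under eq_fun do rewrite -mulrA; lb.
have le : locally_bounded e by rewrite /e; lb.
have fK1 w : `|f w| <= K * (1 + `|w|).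
  by rewrite (le_trans (fK w))// ler_peMr// lerDl.
have := cw_main lf lD le De fe K0 fK1 DK.
have aI := adm_snd lI; have awf := adm_snd lwf; have ar := adm_snd lr; have aJ := adm_snd lJ.
have -> : E (fun _ w => D w) = a * E (fun _ w => w ^+ r * f w) +
    E (fun _ w => \1_(`]-oo, z]) w) - Fz.
  transitivity (E (fun u w => a * (w ^+ r * f w) + \1_(`]-oo, z]) w - Fz)).
    by apply: eq_cw_expect => u w; rewrite /D mulrA.
  rewrite cw_expectB; adm.
  rewrite cw_expectD; adm.
  rewrite cw_expectZ; adm.
  by rewrite cw_expect_cst.
have rK : E (fun _ w => `|w| ^+ r) <= 1 + Km k.
  have aw2 := adm_snd (lX (2 * k)).
  apply: (@le_trans _ _ (E (fun _ w => 1 + w ^+ (2 * k)))).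
    apply: le_cw_expect; adm.
    by move=> _ w; apply: ler_exprn_even; exact: leq_pred.
  rewrite cw_expectD; adm.
  by rewrite cw_expect_cst lerD2l cw_expect_W.
have eE : E (fun _ w => e w) <= M / lam ^+ r * (L * (2 + Km k)) +
    (concentration_const / lam ^+ r + C1 * Km 1 / lam ^+ 2).
  rewrite /e cw_expectD; adm.
  apply: lerD; last exact: cw_concentration_le.
  rewrite cw_expectZ; adm.
  rewrite cw_expectZ; adm.
  rewrite cw_expectD; adm.
  rewrite cw_expect_cst.
  have -> : M * lam / N = M / lam ^+ r.
    by rewrite -lamr; field; rewrite expf_neq0 gt_eqF.
  rewrite ler_wpM2l ?divr_ge0 ?exprn_ge0 ?(ltW lam0)// ler_wpM2l//.
  by rewrite -[2]natr1 -addrA lerD2l.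
have fE : `|E (fun _ w => w ^+ r * f w)| <= K * (1 + Km k).
  apply: (@le_trans _ _ (E (fun _ w => K * `|w| ^+ r))).
    apply: normr_cw_expect_le; adm.
    by move=> _ w; rewrite normrM normrX mulrC ler_wpM2r// exprn_ge0.
  by rewrite cw_expectZ; adm; rewrite ler_wpM2l.
set x := E (fun _ w => w ^+ r * f w) in fE *.
set p := E (fun _ w => \1_(`]-oo, z]) w).
move=> H.
have -> : p - Fz = - (c * x - (a * x + p - Fz)) + (c - a) * x by ring.
apply: (le_trans (ler_normD _ _)); apply: lerD; last by rewrite normrM ler_wpM2l.
rewrite normrN (le_trans H)//.
apply: (@le_trans _ _ (3 * M ^+ 2 * (M / lam ^+ r * (L * (2 + Km k)) +
    (concentration_const / lam ^+ r + C1 * Km 1 / lam ^+ 2)) + K * (main_const / lam ^+ 2))).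
  by rewrite lerD2r ler_wpM2l// mulr_ge0// sqr_ge0.
by rewrite le_eqVlt; apply/orP; left; apply/eqP; ring.
Qed.

End scaled_coupling.

(** * Stein's equation *)

Section mean_value_inequality.
Context (R : realType).
Implicit Types (f df : R -> R) (x y z K : R).

Lemma mean_value_le_lt f df x y K : x <= y -> continuous f ->
  (forall t, x < t < y -> is_derive t 1 f (df t) /\ `|df t| <= K) ->
  `|f y - f x| <= K * (y - x).
Proof.
rewrite le_eqVlt => /predU1P[->|xy] cf dfK; first by rewrite !subrr normr0 mulr0.
have [||c] := @MVT _ f df x y xy.
- by move=> t; rewrite in_itv/= => /dfK[].
- exact: continuous_subspaceT.
rewrite in_itv/= => /dfK[_ cK] ->.
by rewrite normrM (@ger0_norm _ (y - x)) ?ler_wpM2r// subr_ge0 ltW.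
Qed.

(** One exceptional point is allowed because the Stein solution has a kink at z; the interval is cut
    there. *)
Lemma mean_value_le_except f df x y z K : x <= y -> continuous f ->
  (forall t, x < t < y -> t != z -> is_derive t 1 f (df t) /\ `|df t| <= K) ->
  `|f y - f x| <= K * (y - x).
Proof.
move=> xy cf dfK; have [/andP[xz zy]|nz] := boolP (x < z < y); last first.
  apply: (mean_value_le_lt (df := df)) => // t txy; apply: dfK => //.
  by apply: contraNneq nz => <-.
have -> : f y - f x = (f y - f z) + (f z - f x) by rewrite addrA subrK.
have -> : K * (y - x) = K * (y - z) + K * (z - x) by ring.
apply: (le_trans (ler_normD _ _)); apply: lerD;
  apply: (mean_value_le_lt (df := df)) => //; try exact: ltW.
  by move=> t /andP[zt ty]; apply: dfK; rewrite ?ty ?(lt_trans xz)// gt_eqF.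
by move=> t /andP[xt tz]; apply: dfK; rewrite ?xt ?(lt_trans tz)// lt_eqF.
Qed.

Lemma mean_value_norm_le f df x y z K : continuous f ->
  (forall t, Num.min x y < t < Num.max x y -> t != z ->
    is_derive t 1 f (df t) /\ `|df t| <= K) ->
  `|f x - f y| <= K * `|x - y|.
Proof.
move=> cf; have [xy|yx] := leP x y => dfK.
  rewrite distrC (distrC x) (@ger0_norm _ (y - x)) ?subr_ge0//.
  exact: (mean_value_le_except (df := df) (z := z)).
rewrite (@ger0_norm _ (x - y)) ?subr_ge0 ?(ltW yx)//.
by apply: (mean_value_le_except (df := df) (z := z)) => //; exact: ltW.
Qed.

End mean_value_inequality.

Section stein_solution.
Context (R : realType) (k' : nat) (a : R).
Hypothesis a0 : 0 < a.
Local Notation k := k'.+1.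
Local Notation r := (2 * k).-1.
Local Notation leb := (@lebesgue_measure R).
Implicit Types x y z l s t : R.

Definition potential x : R := a * x ^+ (2 * k) / (2 * k)%:R.
Definition weight x : R := expR (- potential x).
Local Notation q := potential.
Local Notation w := weight.

Let k2 : (2 * k)%:R != 0 :> R. Proof. by rewrite pnatr_eq0. Qed.
Let x2k x : 0 <= x ^+ (2 * k). Proof. by rewrite exprM exprn_ge0 ?sqr_ge0. Qed.

Lemma potentialN x : q (- x) = q x.
Proof. by rewrite /q exprM sqrrN -exprM. Qed.

Lemma potential_ge0 x : 0 <= q x.
Proof. by rewrite /q divr_ge0// mulr_ge0// ltW. Qed.

Lemma weight_le1 x : w x <= 1. Proof. by rewrite expR_le1 oppr_le0 potential_ge0. Qed.

Lemma is_derive_potential x : is_derive x 1 q (a * x ^+ r).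
Proof.
rewrite /q.
have := is_deriveZ (a / (2 * k)%:R) (is_derive_exprn (2 * k) x).
rewrite /GRing.scale/= => H.
have -> : (fun x => a * x ^+ (2 * k) / (2 * k)%:R) = (fun x => a / (2 * k)%:R * x ^+ (2 * k)).
  by apply/funext => y; rewrite mulrAC.
by apply: (@is_derive_eq _ _ _ _ _ _ _ _ H); rewrite mulrA divfK.
Qed.

Lemma is_derive_weight x : is_derive x 1 w (- (a * x ^+ r) * w x).
Proof.
have H := is_derive_expR_comp (is_deriveN (is_derive_potential x)).
by apply: (@is_derive_eq _ _ _ _ _ _ _ _ H); rewrite mulrC.
Qed.

Lemma is_derive_expq x : is_derive x 1 (fun x => expR (q x)) (a * x ^+ r * expR (q x)).
Proof.
have H := is_derive_expR_comp (is_derive_potential x).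
by apply: (@is_derive_eq _ _ _ _ _ _ _ _ H); rewrite mulrC.
Qed.

Lemma is_derive_continuous (f df : R -> R) :
  (forall x, is_derive x 1 f (df x)) -> continuous f.
Proof.
move=> H x; apply/differentiable_continuous/derivable1_diffP.
by case: (H x).
Qed.

Lemma continuous_weight : continuous w.
Proof. exact: is_derive_continuous is_derive_weight. Qed.

Lemma integrable_weight : leb.-integrable setT (EFin \o w).
Proof.
have a'0 : 0 < a / (2 * k)%:R by rewrite divr_gt0.
apply: (@integrable_le_gaussw _ (a / (2 * k)%:R) 0 0 (expR (a / (2 * k)%:R))) => //.
  by apply: continuous_measurable_fun; exact: continuous_weight.
move=> x; rewrite expr0 mul0r expR0 !mul1r ger0_norm ?expR_ge0// -expRD ler_expR.
have : `|x| ^+ 2 <= 1 + x ^+ (2 * k) by apply: ler_exprn_even; rewrite mulnS.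
rewrite real_normK ?num_real// => H.
rewrite -[X in X + _]mulr1 -mulrBr /q mulrAC -mulrN ler_pM2l//.
by rewrite lerNl opprB lerBlDl.
Qed.

(** Unnormalised distribution function. The weight is even, so [cumul (- x)] is the upper tail at
    x. *)
Definition cumul x : R := \int[leb]_(t in `]-oo, x]) w t.
Local Notation F := cumul.
Definition total : R := \int[leb]_t w t.

Let iw D : measurable D -> leb.-integrable D (EFin \o w).
Proof. by move=> mD; apply: integrableS integrable_weight. Qed.

Lemma is_derive_cumul x : is_derive x 1 F (w x).
Proof.
have [] := @continuous_FTC1 _ w (BInfty _ true) x (x + 1) _ _ _ _.
- by rewrite ltrDl.
- exact: iw.
- by rewrite ltNyr.
- exact: continuous_weight.
by move=> d1 d2; split; [exact: d1|rewrite -derive1E].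
Qed.

Lemma cumul_ge0 x : 0 <= F x.
Proof. by apply: Rintegral_ge0 => t _; exact: expR_ge0. Qed.

Lemma cumul_opp x : F (- x) = \int[leb]_(t in `[x, +oo[) w t.
Proof.
rewrite /F /Rintegral; congr fine.
transitivity (\int[leb]_(t in `[x, +oo[) ((w \o -%R) t)%:E)%E.
  apply: (@ge0_integration_by_substitutionNy _ w x).
    exact/continuous_subspaceT/continuous_weight.
  by move=> t _; exact: expR_ge0.
by apply: eq_integral => t _; rewrite /w/= potentialN.
Qed.

Lemma cumulD x : F x + F (- x) = total.
Proof.
rewrite cumul_opp /total -(@setUv _ `]-oo, x]%classic) setCitvl.
rewrite Rintegral_setU//=; last 2 first.
- by rewrite -setCitvl setUv; exact: integrable_weight.
- by rewrite -setCitvl; apply/disj_setPCl.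
congr (_ + _); rewrite -Rintegral_itv_obnd_cbnd//.
exact: iw.
Qed.

Lemma continuous_cumul : continuous F.
Proof. exact: is_derive_continuous is_derive_cumul. Qed.

Lemma cumul_homo : {homo F : x y / x <= y}.
Proof.
move=> x y; rewrite le_eqVlt => /predU1P[->//|xy].
have [||c _ Fxy] := @MVT _ F w x y xy.
- by move=> t _; exact: is_derive_cumul.
- exact/continuous_subspaceT/continuous_cumul.
by rewrite -subr_ge0 Fxy mulr_ge0 ?expR_ge0// subr_ge0 ltW.
Qed.

Lemma cumul_increment x y : x <= y -> F y - F x <= y - x.
Proof.
move=> xy; rewrite (le_trans (ler_norm _))// -[leRHS]mul1r.
apply: (mean_value_le_lt (df := w)) => //; first exact: continuous_cumul.
move=> t _; split; first exact: is_derive_cumul.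
by rewrite ger0_norm ?expR_ge0// weight_le1.
Qed.

Lemma cumul_le_total x : F x <= total.
Proof. by rewrite -(cumulD x) lerDl cumul_ge0. Qed.

Lemma total_gt0 : 0 < total.
Proof.
rewrite /total; have -> : \int[leb]_t w t = F 0 + F 0 by rewrite -{2}oppr0 cumulD.
have [||c _ H] := @MVT _ F w (-1) 0 (ltrN10 _).
- by move=> t _; exact: is_derive_cumul.
- exact/continuous_subspaceT/continuous_cumul.
have : 0 < F 0.
  rewrite -(subrK (F (-1)) (F 0)) H sub0r opprK mulr1 ltr_wpDr ?cumul_ge0//.
  exact: expR_gt0.
by move=> F0; rewrite addr_gt0.
Qed.

Lemma weight_cvg0 : w x @[x --> +oo] --> 0.
Proof.
have c0 : 0 < a / (2 * k)%:R by rewrite divr_gt0.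
apply: (@squeeze_cvgr _ _ _ _ (cst 0) (fun x => expR (- (a / (2 * k)%:R * x)))).
- near=> x; rewrite expR_ge0/= ler_expR lerN2 /q [leRHS]mulrAC ler_wpM2l ?(ltW c0)//.
  have x1 : 1 <= x by near: x; exact: nbhs_pinfty_ge.
  by rewrite -[leLHS]expr1 ler_weXn2l// muln_gt0.
- exact: cvg_cst.
- have H : a / (2 * k)%:R * x @[x --> +oo] --> +oo.
    by apply: (gt0_cvgMry c0); exact: cvg_id.
  exact: (@cvg_comp _ _ _ (fun x => a / (2 * k)%:R * x) (fun y => expR (- y)) _ _ _ H (@cvgr_expR R)).
Unshelve. all: by end_near. Qed.

(** A Mills inequality: beyond x the factor x^r is at most t^r, and a t^r w(t) is the exact
    derivative of -w(t). *)
Lemma mills x : 0 <= x -> a * x ^+ r * F (- x) <= w x.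
Proof.
move=> x0; rewrite cumul_opp -RintegralZl//; last exact: iw.
have mtw : measurable_fun setT (fun t : R => a * t ^+ r * w t).
  apply: measurable_funM; first by apply: measurable_funM => //; exact: measurable_funX.
  by apply: continuous_measurable_fun; exact: continuous_weight.
have a'0 : 0 < a / (2 * k)%:R by rewrite divr_gt0.
have itw : leb.-integrable setT (EFin \o (fun t : R => a * t ^+ r * w t)).
  apply: (@integrable_le_gaussw _ (a / (2 * k)%:R) 0 r (a * expR (a / (2 * k)%:R))) => //.
  move=> t; rewrite mul0r expR0 mulr1 normrM (ger0_norm (expR_ge0 _)) normrM (gtr0_norm a0).
  rewrite normrX -!mulrA ler_wpM2l ?(ltW a0)// mulrCA ler_pM ?exprn_ge0 ?expR_ge0//.
    by rewrite lerXn2r ?nnegrE ?addr_ge0// lerDr.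
  rewrite -expRD ler_expR.
  have : `|t| ^+ 2 <= 1 + t ^+ (2 * k) by apply: ler_exprn_even; rewrite mulnS.
  rewrite real_normK ?num_real// => H.
  rewrite -[X in X + _]mulr1 -mulrBr /q mulrAC -mulrN ler_pM2l//.
  by rewrite lerNl opprB lerBlDl.
apply: (@le_trans _ _ (\int[leb]_(t in `[x, +oo[) (a * t ^+ r * w t))).
  apply: le_Rintegral => //.
  - have := integrableRZ (a * x ^+ r) integrable_weight.
    exact: (integrableS measurableT _ (subsetT _)).
  - exact: (integrableS measurableT _ (subsetT _) itw).
  move=> t; rewrite /= in_itv/= andbT => xt; rewrite ler_wpM2r ?expR_ge0//.
  by rewrite ler_wpM2l ?(ltW a0)// lerXn2r ?nnegrE// (le_trans x0).
rewrite (@Rintegral_ge0_continuous_FTC2y _ _ (fun t => - w t) x 0).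
- by rewrite sub0r opprK.
- by move=> t xt; rewrite !mulr_ge0 ?expR_ge0 ?(ltW a0)// exprn_ge0// (le_trans x0).
- apply: continuous_subspaceT => t; apply: cvgM; last exact: continuous_weight.
  by apply: cvgMr; exact: exprn_continuous.
- by rewrite -oppr0; apply: cvgN; exact: weight_cvg0.
- by move=> t _; apply: derivableN; case: (is_derive_weight t).
- by apply: cvgN; apply: cvg_at_right_filter; exact: continuous_weight.
- move=> t _; rewrite derive1E deriveN; last by case: (is_derive_weight t).
  by have [_ ->] := is_derive_weight t; rewrite mulNr opprK.
Qed.

Definition tail_ratio x : R := expR (q x) * F x.
Local Notation u := tail_ratio.

Lemma tail_ratio_ge0 x : 0 <= u x.
Proof. by rewrite mulr_ge0 ?expR_ge0 ?cumul_ge0. Qed.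

Lemma mills_ratio x : 0 <= x -> a * x ^+ r * u (- x) <= 1.
Proof.
move=> x0; rewrite /u potentialN mulrCA -[leRHS](expR0 R) -(subrr (q x)) expRD.
by rewrite ler_wpM2l ?expR_ge0//; exact: mills.
Qed.

(** Beyond distance 1 the Mills inequality gives 1/a. Within distance 1 the exponential is at most
    exp(a), and the tail at most F(-1) + 1 <= 1/a + 1. The formula is explicit in [a] because the
    coefficient will vary with n. *)
Definition ratio_bound : R := expR a * (a^-1 + 1).

Lemma ratio_bound_ge0 : 0 <= ratio_bound.
Proof. by rewrite mulr_ge0 ?expR_ge0// addr_ge0// invr_ge0 ltW. Qed.

Let u1 x : 1 <= x -> u (- x) <= a^-1.
Proof.
move=> x1; have x0 : 0 <= x by rewrite (le_trans _ x1).
rewrite -[leRHS]mul1r ler_pdivlMr// mulrC; apply: le_trans (mills_ratio x0).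
by rewrite ler_wpM2r ?tail_ratio_ge0// ler_peMr ?(ltW a0)// exprn_ege1.
Qed.

Lemma tail_ratio_le x : 0 <= x -> u (- x) <= ratio_bound.
Proof.
move=> x0; have [x1|x1] := leP 1 x.
  rewrite (le_trans (u1 x1))// /ratio_bound.
  apply: (@le_trans _ _ (a^-1 + 1)); first by rewrite lerDl.
  by rewrite ler_peMl ?addr_ge0 ?invr_ge0 ?(ltW a0)// -expR0 ler_expR ltW.
rewrite /u /ratio_bound ler_pM ?expR_ge0 ?cumul_ge0//.
  rewrite ler_expR potentialN /q ler_pdivrMr ?ltr0n// ler_wpM2l ?(ltW a0)//.
  rewrite (@le_trans _ _ 1)// ?exprn_ile1// ?(ltW x1)//.
  by rewrite ler1n muln_gt0.
have h1 : F (- x) <= F 0 by apply: cumul_homo; rewrite oppr_le0.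
have h2 : F 0 - F (-1) <= 1 by have := @cumul_increment (-1) 0 (lerN10 _); rewrite sub0r opprK.
have h3 : F (-1) <= a^-1.
  apply: le_trans (u1 (lexx 1)); rewrite /u ler_peMl ?cumul_ge0// -expR0 ler_expR.
  exact: potential_ge0.
lra.
Qed.

Section stein_function.
Context (z : R).

(** Both branches of the Stein solution at once: left of z the variable enters through the lower
    tail, right of z through the upper tail, which by symmetry is [F] at the opposite point. *)
Definition stein_fun x : R :=
  expR (q x) * (F (Num.min x z) * F (- (Num.max x z)) / total).

(** Stein's equation solved for the derivative; it also assigns a value at the kink z. *)
Definition stein_deriv x : R :=
  a * x ^+ r * stein_fun x + \1_(`]-oo, z]) x - F z / total.

Local Notation f := stein_fun.
Local Notation D := stein_deriv.

Let T0 : 0 < total := total_gt0.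

Lemma stein_fun_ge0 x : 0 <= f x.
Proof. by rewrite mulr_ge0 ?expR_ge0// divr_ge0 ?mulr_ge0 ?cumul_ge0// ltW. Qed.

(** Of the two factors F(x) and F(-x), the larger is absorbed by [total], and the smaller is the
    tail at distance |x|. *)
Lemma stein_fun_le x : f x <= u (- `|x|).
Proof.
have H : f x <= expR (q x) * (F x * F (- x) / total).
  rewrite ler_wpM2l ?expR_ge0// ler_wpM2r ?invr_ge0 ?(ltW T0)//.
  by rewrite ler_pM ?cumul_ge0 ?cumul_homo ?ge_min ?lexx// lerN2 le_max lexx.
apply: (le_trans H); rewrite /u potentialN.
have -> : q `|x| = q x by case: (ger0P x) => _; rewrite ?potentialN.
rewrite ler_wpM2l ?expR_ge0// ler_pdivrMr//.
case: (ger0P x) => _; first by rewrite mulrC ler_wpM2l ?cumul_ge0 ?cumul_le_total.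
by rewrite opprK ler_wpM2l ?cumul_ge0 ?cumul_le_total.
Qed.

Lemma normr_stein_fun x : `|f x| <= ratio_bound.
Proof.
rewrite ger0_norm ?stein_fun_ge0// (le_trans (stein_fun_le x))//.
exact: tail_ratio_le.
Qed.

Lemma normr_drift_stein_fun x : `|a * x ^+ r * f x| <= 1.
Proof.
rewrite normrM [X in X * _]normrM normrX (gtr0_norm a0) (ger0_norm (stein_fun_ge0 x)).
apply: le_trans (mills_ratio (normr_ge0 x)).
by rewrite ler_wpM2l ?stein_fun_le// mulr_ge0 ?exprn_ge0// ltW.
Qed.

Let Fz1 : 0 <= F z / total <= 1.
Proof.
rewrite divr_ge0 ?cumul_ge0 ?(ltW T0)//= ler_pdivrMr// mul1r.
exact: cumul_le_total.
Qed.

Lemma normr_stein_deriv x : `|D x| <= 2.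
Proof.
rewrite /D -addrA (le_trans (ler_normD _ _))// (_ : 2 = 1 + 1)// lerD//.
  exact: normr_drift_stein_fun.
have /andP[h0 h1] := Fz1.
by rewrite indicE; case: (_ \in _) => /=; rewrite ler_norml; apply/andP; split; lra.
Qed.

Let continuous_expq : continuous (fun x => expR (q x)).
Proof. exact: is_derive_continuous is_derive_expq. Qed.

Lemma continuous_stein_fun : continuous f.
Proof.
move=> x; apply: cvgM; first exact: continuous_expq.
apply: cvgMl; apply: cvgM.
  apply: (@cvg_comp _ _ _ (fun x => Num.min x z) F); last exact: continuous_cumul.
  by apply: (@continuous_min _ _ (fun x : R => x) (cst z)); [exact: cvg_id|exact: cvg_cst].
apply: (@cvg_comp _ _ _ (fun x => - Num.max x z) F); last exact: continuous_cumul.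
apply: cvgN.
by apply: (@continuous_max _ _ (fun x : R => x) (cst z)); [exact: cvg_id|exact: cvg_cst].
Qed.

Let is_derive_tail c x : is_derive x 1 (fun x => expR (q x) * F x * c)
  ((a * x ^+ r * (expR (q x) * F x) + 1) * c).
Proof.
have := is_deriveZ c (is_deriveM (is_derive_expq x) (is_derive_cumul x)).
rewrite /GRing.scale/= => H.
rewrite (_ : (fun x => _) = (fun x => c * (expR (q x) * F x))); last first.
  by apply/funext => y; rewrite mulrC.
apply: (@is_derive_eq _ _ _ _ _ _ _ _ H).
by rewrite /w -expRD subrr expR0; ring.
Qed.

Let is_derive_tailN c x : is_derive x 1 (fun x => expR (q x) * F (- x) * c)
  ((a * x ^+ r * (expR (q x) * F (- x)) - 1) * c).
Proof.
have e y : F (- y) = total - F y by rewrite -(cumulD y) addrC addKr.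
have := is_deriveZ c (is_deriveM (is_derive_expq x) (is_deriveB (is_derive_cst total x 1) (is_derive_cumul x))).
rewrite /GRing.scale/= => H.
rewrite (_ : (fun x => _) = (fun x => c * (expR (q x) * (total - F x)))); last first.
  by apply/funext => y; rewrite mulrC e.
apply: (@is_derive_eq _ _ _ _ _ _ _ _ H).
rewrite e /w expRN /cst -[((fun=> total) - F) x]/(total - F x).
by field; rewrite gt_eqF ?expR_gt0.
Qed.

Lemma is_derive_stein_fun x : x != z -> is_derive x 1 f (D x).
Proof.
have FE : F z + F (- z) = total := cumulD z.
have T1 : total != 0 by rewrite gt_eqF.
case: (ltgtP x z) => // xz _.
  apply: (@near_eq_is_derive _ _ _ (fun x => expR (q x) * F x * (F (- z) / total))).
    near=> t; have tz : t < z by near: t; exact: lt_nbhsl.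
    rewrite /f (min_idPl (ltW tz)) (max_idPr (ltW tz)); ring.
  apply: (is_derive_eq (is_derive_tail _ _)).
  rewrite /D /f (min_idPl (ltW xz)) (max_idPr (ltW xz)) indicE mem_set/= ?in_itv/= ?(ltW xz)//.
  by rewrite -FE in T1 *; field.
apply: (@near_eq_is_derive _ _ _ (fun x => expR (q x) * F (- x) * (F z / total))).
  near=> t; have tz : z < t by near: t; exact: lt_nbhsr.
  rewrite /f (min_idPr (ltW tz)) (max_idPl (ltW tz)); ring.
apply: (is_derive_eq (is_derive_tailN _ _)).
rewrite /D /f (min_idPr (ltW xz)) (max_idPl (ltW xz)) indicE memNset/= ?in_itv/= ?leNgt ?xz//.
by field.
Unshelve. all: by end_near. Qed.

Section local_oscillation.
Context (M : R).
Hypothesis M0 : 0 <= M.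

(** The terms with [ratio_bound] and 2 bound the two parts of the derivative of a y^r f(y). The last
    factor combines 1 + |y| <= (1 + M)(1 + |x|) for |y - x| <= M with (1 + |x|)^r <= 2^r (1 +
    |x|^r). *)
Definition stein_lip : R :=
  a * (r%:R * ratio_bound + 2) * (2 * (1 + M)) ^+ r.

Lemma stein_lip_ge0 : 0 <= stein_lip.
Proof.
rewrite mulr_ge0//; last by rewrite exprn_ge0// mulr_ge0// addr_ge0.
by rewrite mulr_ge0 ?(ltW a0)// addr_ge0// mulr_ge0// ratio_bound_ge0.
Qed.

Lemma drift_stein_lip x s t : `|s - x| <= M -> `|t - x| <= M ->
  `|a * s ^+ r * f s - a * t ^+ r * f t| <= stein_lip * (1 + `|x| ^+ r) * `|s - t|.
Proof.
move=> sx tx; pose G s := a * s ^+ r * f s.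
have cG : continuous G.
  move=> y; apply: cvgM; last exact: continuous_stein_fun.
  by apply: cvgMr; exact: exprn_continuous.
apply: (mean_value_norm_le (f := G) (z := z)
  (df := fun y => a * (r%:R * y ^+ r.-1) * f y + a * y ^+ r * D y)) => // y ymm yz.
split.
  have := is_deriveM (is_deriveZ a (is_derive_exprn r y)) (is_derive_stein_fun yz).
  rewrite /GRing.scale/= => H.
  by apply: (@is_derive_eq _ _ _ _ _ _ _ _ H); rewrite addrC; congr (_ + _); ring.
have yx : `|y - x| <= M.
  move: sx tx ymm; rewrite !ler_norml => /andP[s1 s2] /andP[t1 t2] /andP[].
  by rewrite gt_min lt_max => /orP[] ? /orP[] ?; apply/andP; split; lra.
have y1 : 1 + `|y| <= (1 + M) * (1 + `|x|).
  have : `|y| <= M + `|x| by rewrite -[y](subrK x) (le_trans (ler_normD _ _))// lerD2r.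
  have : 0 <= M * `|x| by rewrite mulr_ge0.
  nra.
have x0 : 0 <= `|x| := normr_ge0 x.
have x2 : (1 + `|x|) ^+ r <= 2 ^+ r * (1 + `|x| ^+ r).
  have [x1|x1] := leP `|x| 1.
    apply: (@le_trans _ _ (2 ^+ r)); first by rewrite lerXn2r ?nnegrE ?addr_ge0//; lra.
    by rewrite ler_peMr ?exprn_ge0// lerDl exprn_ge0.
  apply: (@le_trans _ _ ((2 * `|x|) ^+ r)).
    by rewrite lerXn2r ?nnegrE ?addr_ge0 ?mulr_ge0//; lra.
  by rewrite exprMn ler_wpM2l ?exprn_ge0// lerDr.
have yr : (1 + `|y|) ^+ r <= (2 * (1 + M)) ^+ r * (1 + `|x| ^+ r).
  apply: (@le_trans _ _ (((1 + M) * (1 + `|x|)) ^+ r)).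
    by rewrite lerXn2r ?nnegrE ?mulr_ge0 ?addr_ge0.
  rewrite [2 * _]mulrC !exprMn -mulrA ler_wpM2l// exprn_ge0// addr_ge0//.
apply: (@le_trans _ _ (a * (r%:R * ratio_bound + 2) * (1 + `|y|) ^+ r)); last first.
  rewrite /stein_lip -[leRHS]mulrA ler_wpM2l//.
  by rewrite mulr_ge0 ?(ltW a0)// addr_ge0// mulr_ge0// ratio_bound_ge0.
have y0 : 0 <= `|y| := normr_ge0 y.
have -> : a * (r%:R * ratio_bound + 2) * (1 + `|y|) ^+ r =
  a * (r%:R * (1 + `|y|) ^+ r) * ratio_bound + a * (1 + `|y|) ^+ r * 2 by ring.
apply: (le_trans (ler_normD _ _)); apply: lerD.
  rewrite normrM ler_pM ?normr_stein_fun//.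
  rewrite normrM (gtr0_norm a0) ler_wpM2l ?(ltW a0)// normrM ger0_norm// ler_wpM2l//.
  rewrite normrX (@le_trans _ _ ((1 + `|y|) ^+ r.-1))//.
    by rewrite lerXn2r ?nnegrE ?addr_ge0// lerDr.
  by rewrite ler_weXn2l ?lerDl// leq_pred.
rewrite normrM ler_pM ?normr_stein_deriv//.
rewrite normrM (gtr0_norm a0) ler_wpM2l ?(ltW a0)// normrX.
by rewrite lerXn2r ?nnegrE ?addr_ge0// lerDr.
Qed.

Definition stein_osc l x : R :=
  l * (stein_lip * (1 + `|x| ^+ r)) + \1_(`[z - l, z + l]) x.

(** If the indicator separates s from t, then z lies between them, hence within [l] of x. *)
Let indic_osc l x s t : `|s - x| <= l -> `|t - x| <= l ->
  `|\1_(`]-oo, z]) s - \1_(`]-oo, z]) t| <= \1_(`[z - l, z + l]) x :> R.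
Proof.
move=> sx tx; have i01 (A : set R) : 0 <= \1_A x :> R by rewrite indicE.
have key s' t' : `|s' - x| <= l -> `|t' - x| <= l -> s' <= z -> z < t' ->
    \1_(`[z - l, z + l]) x = 1 :> R.
  rewrite !ler_norml => /andP[s1 s2] /andP[t1 t2] sz zt.
  by rewrite indicE mem_set//= in_itv/=; apply/andP; split; lra.
rewrite [\1_(`]-oo, z]) s]indicE [\1_(`]-oo, z]) t]indicE !mem_setE !in_itv/=.
have [sz|zs] := leP s z; have [tz|zt] := leP t z; rewrite ?subrr ?normr0//.
  by rewrite subr0 normr1 (key s t).
by rewrite sub0r normrN normr1 (key t s).
Qed.

Lemma stein_deriv_osc l x s t : 0 <= l -> l <= M ->
  `|s - x| <= l -> `|t - x| <= l -> `|s - t| <= l ->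
  `|D s - D t| <= stein_osc l x.
Proof.
move=> l0 lM sx tx st.
have -> : D s - D t = (a * s ^+ r * f s - a * t ^+ r * f t) +
    (\1_(`]-oo, z]) s - \1_(`]-oo, z]) t) by rewrite /D; ring.
apply: (le_trans (ler_normD _ _)); apply: lerD; last exact: indic_osc.
apply: (le_trans (drift_stein_lip (le_trans sx lM) (le_trans tx lM))).
rewrite mulrC ler_wpM2r// mulr_ge0 ?stein_lip_ge0// addr_ge0// exprn_ge0//.
Qed.

(** The mean value inequality for f(t) - t D(y), whose derivative D(t) - D(y) is an oscillation of
    [D]. *)
Lemma stein_fun_taylor l x y : 0 <= l -> l <= M -> `|x - y| <= l ->
  `|f x - f y - (x - y) * D y| <= l * stein_osc l x.
Proof.
move=> l0 lM xy; pose g t := f t - D y * t.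
have -> : f x - f y - (x - y) * D y = g x - g y by rewrite /g; ring.
have cg : continuous g.
  move=> t; apply: cvgB; first exact: continuous_stein_fun.
  by apply: cvgMr; exact: cvg_id.
have osc0 : 0 <= stein_osc l x.
  by rewrite /stein_osc addr_ge0// mulr_ge0// mulr_ge0 ?stein_lip_ge0.
apply: (@le_trans _ _ (stein_osc l x * `|x - y|)); last by rewrite mulrC ler_wpM2r.
apply: (mean_value_norm_le (df := fun t => D t - D y) (z := z)) => // t txy tz.
split.
  have := is_deriveB (is_derive_stein_fun tz) (is_deriveZ (D y) (is_derive_id t 1)).
  by rewrite /GRing.scale/= => H; apply: (@is_derive_eq _ _ _ _ _ _ _ _ H); rewrite mulr1.
move: xy txy; rewrite ler_norml => /andP[h1 h2]; rewrite gt_min lt_max => /andP[h3 h4].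
apply: stein_deriv_osc => //; rewrite ler_norml; apply/andP; split;
  by move: h3 h4 => /orP[] ? /orP[] ?; lra.
Qed.

End local_oscillation.
End stein_function.
End stein_solution.

(** * Expansions at the origin *)

Section polynomial_approximation.
Context (R : realType).
Implicit Types (f g : R -> R) (p : {poly R}) (N : nat).

(** A Taylor expansion at 0 without named derivatives, uniform on each bounded set. *)
Definition poly_approx N f p :=
  forall b : R, exists K : R, forall s : R, `|s| <= b -> `|f s - p.[s]| <= K * `|s| ^+ N.

Lemma poly_primitive p (c : R) : exists P : {poly R}, P^`() = p /\ P.[0] = c.
Proof.
exists (\poly_(i < (size p).+1) (if i is j.+1 then p`_j / j.+1%:R else c)); split.
  apply/polyP => i; rewrite coef_deriv coef_poly ltnS.
  case: ltnP => [_|pi]; last by rewrite mul0rn nth_default.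
  by rewrite -[LHS]mulr_natr divfK// pnatr_eq0.
by rewrite horner_coef0 coef_poly.
Qed.

Lemma poly_approx_primitive N f g p : (forall x : R, is_derive x 1 f (g x)) ->
  poly_approx N g p ->
  exists P : {poly R}, P^`() = p /\ poly_approx N.+1 f P.
Proof.
move=> fg gp; have [P [dP P0]] := poly_primitive p (f 0).
exists P; split=> // b; have [K HK] := gp b; exists K => s sb.
have d (t : R) : is_derive t 1 (fun s => f s - P.[s]) (g t - p.[t]).
  by have := is_deriveB (fg t) (is_derive_poly P t); rewrite dP.
have -> : f s - P.[s] = (f s - P.[s]) - (f 0 - P.[0]) by rewrite P0 subrr subr0.
rewrite exprSr mulrA -[X in _ * `|X|]subr0.
apply: (mean_value_norm_le (f := fun s => f s - P.[s]) (z := s) (df := fun t => g t - p.[t])).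
  exact: is_derive_continuous d.
move=> t; rewrite gt_min lt_max => /andP[t1 t2] _; split=> //.
have ts : `|t| <= `|s|.
  by rewrite ler_norml; case: (ger0P s) => s0; apply/andP; split;
    move: t1 t2 => /orP[] ? /orP[] ?; lra.
apply: (le_trans (HK _ (le_trans ts sb))).
have K0 : 0 <= K * `|s| ^+ N := le_trans (normr_ge0 _) (HK _ sb).
have [K0'|K0'] := leP 0 K; first by rewrite ler_wpM2l// lerXn2r ?nnegrE.
have := normr_ge0 (g t - p.[t]); move=> H.
have H2 := le_trans H (HK _ (le_trans ts sb)).
apply: le_trans K0; rewrite -oppr_ge0 -mulNr mulr_ge0 ?exprn_ge0//.
by rewrite oppr_ge0 ltW.
Qed.

(** Smoothness is encoded as membership in a class closed under differentiation: expansions of every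
    order arise by integrating the expansion of the derivative. *)
Lemma poly_approx_class (S : (R -> R) -> Prop) N f :
  (forall f, S f -> exists2 g, S g & forall x : R, is_derive x 1 f (g x)) ->
  S f -> exists p, poly_approx N f p.
Proof.
move=> HS; elim: N f => [|N IH] f Sf; have [g Sg fg] := HS _ Sf.
  exists 0 => b; have [K HK] := (locally_bounded_continuous (is_derive_continuous fg)).2 b.
  by exists K => s sb; rewrite horner0 subr0 expr0 mulr1 HK.
have [p gp] := IH _ Sg; have [P [_ HP]] := poly_approx_primitive fg gp.
by exists P.
Qed.

Lemma poly_small_coef p N (K d : R) : 0 < d ->
  (forall s, 0 < s <= d -> `|p.[s]| <= K * s ^+ N) ->
  forall j, (j < N)%N -> p`_j = 0.
Proof.
move=> d0; elim: N p => [//|N IH] p pK.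
have [q [c pE]] : exists q c, p = q * 'X + c%:P.
  by elim/poly_ind: p {pK} => [|q c _]; [exists 0, 0; rewrite mul0r addr0|exists q, c].
have [B HB] := (locally_bounded_continuous (@continuous_horner R q)).2 d.
have c0 : c = 0.
  apply/eqP; rewrite -normr_le0; apply/ler_addgt0Pr => e e0; rewrite add0r.
  (* Chosen so that |c| <= L s for 0 < s <= d; the summand 1 keeps [L] positive. Any s at most e / L
     then gives |c| <= e. *)
  pose L := `|K| * d ^+ N + `|B| + 1.
  have L0 : 0 < L by rewrite ltr_wpDl// addr_ge0// mulr_ge0// exprn_ge0// ltW.
  pose s := Num.min d (e / L).
  have s0 : 0 < s by rewrite lt_min d0 divr_gt0.
  have sd : s <= d by rewrite ge_min lexx.
  have := pK s; rewrite s0 sd => /(_ isT); rewrite pE !hornerE => H.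
  have qs : `|q.[s] * s| <= `|B| * s.
    rewrite normrM (gtr0_norm s0) ler_wpM2r ?(ltW s0)// (le_trans (HB _ _))// ?ler_norm//.
    by rewrite gtr0_norm.
  have Ks : K * s ^+ N.+1 <= `|K| * d ^+ N * s.
    rewrite exprSr mulrA ler_wpM2r ?(ltW s0)//.
    apply: (@le_trans _ _ (`|K| * s ^+ N)); first by rewrite ler_wpM2r ?ler_norm// exprn_ge0// ltW.
    by rewrite ler_wpM2l// lerXn2r ?nnegrE ?(ltW s0)// ltW.
  have -> : c = (q.[s] * s + c) - q.[s] * s by rewrite addrC addKr.
  apply: (le_trans (ler_normB _ _)); apply: (le_trans (lerD (le_trans H Ks) qs)).
  rewrite -mulrDl; apply: (@le_trans _ _ (L * s)).
    by rewrite ler_wpM2r ?(ltW s0)// lerDl.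
  by rewrite mulrC -ler_pdivlMr// ge_min lexx orbT.
rewrite c0 addr0 in pE.
have Hq : forall j, (j < N)%N -> q`_j = 0.
  apply: IH => s /[dup] s0d /pK; rewrite pE hornerMX normrM exprSr mulrA.
  by case/andP: s0d => s0 _; rewrite (gtr0_norm s0) ler_pM2r.
by case=> [|j] jN; rewrite pE coefMX//=; exact: Hq.
Qed.

Lemma poly_coef_small p N : (forall j, (j < N)%N -> p`_j = 0) ->
  forall b : R, exists K : R, forall s, `|s| <= b -> `|p.[s]| <= K * `|s| ^+ N.
Proof.
move=> pN b; have [K HK] := (locally_bounded_continuous (@continuous_horner R (drop_poly N p))).2 b.
exists K => s sb.
have t0 : take_poly N p = 0.
  by apply/polyP => i; rewrite coef_take_poly coef0; case: ltnP => // /pN.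
rewrite -(poly_take_drop N p) t0 add0r hornerM hornerXn normrM normrX.
by rewrite ler_wpM2r ?exprn_ge0// HK.
Qed.

(** The polynomials p(s) and p(-s) approximate the same function, so the coefficients of their
    difference vanish below N. *)
Lemma poly_approx_even N f p : (forall s, f (- s) = f s) -> poly_approx N f p ->
  forall j, (j < N)%N -> odd j -> p`_j = 0.
Proof.
move=> fe fp j jN oj; have [K HK] := fp 1.
pose q : {poly R} := \poly_(i < size p) ((-1) ^+ i * p`_i).
have qE s : q.[s] = p.[- s].
  rewrite /q horner_poly horner_coef; apply: eq_bigr => i _.
  by rewrite [(- s) ^+ i]exprNn; ring.
have : (p - q)`_j = 0.
  apply: (@poly_small_coef _ N (K + K) 1 ltr01 _ j jN) => s /andP[s0 s1].
  rewrite hornerD hornerN qE.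
  have -> : p.[s] - p.[- s] = (f (- s) - p.[- s]) - (f s - p.[s]) by rewrite fe; ring.
  have s1' : `|s| <= 1 by rewrite gtr0_norm.
  rewrite (le_trans (ler_normB _ _))// mulrDl lerD//.
    by have := HK (- s); rewrite normrN (gtr0_norm s0); apply.
  by have := HK s; rewrite (gtr0_norm s0); apply.
rewrite coefB coef_poly; case: ltnP => [_|pj _]; last exact: nth_default.
rewrite -signr_odd oj expr1 mulN1r opprK -mulr2n => /eqP.
by rewrite mulrn_eq0 => /eqP.
Qed.

(* A function with [f' = g] that agrees with a single even monomial up to the
   next order has, by parity, no term of that next order; hence [g] agrees with
   the derivative of the monomial up to two orders. *)
Lemma even_expansion_derivative k f g p (c e K : R) :
  (0 < k)%N -> (forall s : R, is_derive s 1 f (g s)) -> (forall s, f (- s) = f s) ->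
  poly_approx (2 * k).+1 g p -> 0 < e ->
  (forall s, `|s| <= e -> `|f s - c * s ^+ (2 * k)| <= K * `|s| ^+ (2 * k).+1) ->
  exists L : R, forall s, `|s| <= 1 ->
    `|g s - c * (2 * k)%:R * s ^+ (2 * k).-1| <= L * `|s| ^+ (2 * k).+1.
Proof.
move=> k0 fg fe gp e0 fK.
have [P [dP fP]] := poly_approx_primitive fg gp.
have k2 : (0 < 2 * k)%N by rewrite muln_gt0.
have [K1 HK1] := fP 1.
have P1 j : (j < (2 * k).+1)%N -> (P - c *: 'X^(2 * k))`_j = 0.
  move=> jk; have m0 : 0 < Num.min e 1 by rewrite lt_min e0 ltr01.
  apply: (@poly_small_coef _ (2 * k).+1 (`|K1| + K) _ m0 _ j jk) => s /andP[s0].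
  rewrite le_min => /andP[se s1].
  rewrite hornerD hornerN hornerZ hornerXn.
  have -> : P.[s] - c * s ^+ (2 * k) = (f s - c * s ^+ (2 * k)) - (f s - P.[s]) by ring.
  have ns : `|s| = s by rewrite gtr0_norm.
  rewrite (le_trans (ler_normB _ _))// mulrDl addrC lerD//; last first.
    by have := fK s; rewrite ns; exact.
  have := HK1 s; rewrite ns => /(_ s1) H; apply: (le_trans H).
  rewrite exprS mulrA ler_wpM2r ?exprn_ge0 ?(ltW s0)//.
  by apply: (@le_trans _ _ (`|K1| * s)); [rewrite ler_wpM2r ?ler_norm// ltW|rewrite ler_piMr].
have P2 : P`_(2 * k).+1 = 0.
  by apply: (poly_approx_even fe fP) => //; rewrite /= oddM.
have pE j : (j < (2 * k).+1)%N -> (p - (c * (2 * k)%:R) *: 'X^((2 * k).-1))`_j = 0.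
  move=> jk; rewrite -dP coefB coef_deriv coefZ coefXn.
  have [->|jne] := eqVneq j (2 * k)%N.
    by rewrite P2 mul0rn gtn_eqF ?mulr0 ?subr0// prednK.
  have jk' : (j.+1 < (2 * k).+1)%N by rewrite ltnS ltn_neqAle jne -ltnS.
  have := P1 _ jk'; rewrite coefB coefZ coefXn => /eqP; rewrite subr_eq0 => /eqP ->.
  have -> : (j.+1 == 2 * k)%N = (j == (2 * k).-1) by case: (2 * k)%N k2 => // ? _; rewrite eqSS.
  by case: eqP => [->|_]; rewrite ?mulr0 ?mul0rn ?subrr// !mulr1 prednK// mulr_natr subrr.
have [K2 HK2] := poly_coef_small pE 1.
have [K3 HK3] := gp 1.
exists (K3 + K2) => s s1.
have -> : g s - c * (2 * k)%:R * s ^+ (2 * k).-1 = (g s - p.[s]) +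
    (p - (c * (2 * k)%:R) *: 'X^((2 * k).-1)).[s].
  by rewrite hornerD hornerN hornerZ hornerXn; ring.
by rewrite (le_trans (ler_normD _ _))// mulrDl lerD ?HK2 ?HK3.
Qed.

End polynomial_approximation.

(** * Derivatives and expansions of the tilted mean, the tilted variance and G *)

Section cumulant_expansion.
Context d (T : measurableType d) (R : realType) (rho : probability T R).
Context (X : T -> R) (mX : measurable_fun setT X) (M : R).
Hypotheses (M0 : 0 <= M) (bX : forall t, `|X t| <= M).
Local Notation mom := (spin_moment rho X).
Local Notation Espin := (Espin rho X).
Implicit Types (t s b K : R).

(** Differentiation under the integral sign; for a bounded spin a constant dominates the derivative
    on ]t - 1, t + 1[. *)
Lemma is_derive_spin_moment (p : nat) t : is_derive t 1 (mom p) (mom p.+1 t).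
Proof.
pose f (x : R) (y : T) := X y ^+ p * expR (x * X y).
have df (x : R) (y : T) : is_derive x 1 (f^~ y) (X y ^+ p.+1 * expR (x * X y)).
  have h1 : is_derive x 1 (fun x => x * X y) (X y).
    by apply: is_derive_eq; rewrite /GRing.scale/=; ring.
  have := is_deriveZ (X y ^+ p) (is_derive_expR_comp h1); rewrite /GRing.scale/= => H.
  by apply: (@is_derive_eq _ _ _ _ _ _ _ _ H); rewrite exprS; ring.
have d1f x y : partial1of2 f x y = X y ^+ p.+1 * expR (x * X y).
  by rewrite partial1of2E; case: (df x y).
have intf x : rho.-integrable setT (EFin \o f x).
  apply: (spin_integrable rho mX bX (h := fun z => z ^+ p * expR (x * z))); lb.
have I t' : `]t - 1, t + 1[%classic t' -> `|t'| <= `|t| + 1.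
  rewrite /= in_itv/= => /andP[h1 h2]; rewrite ler_norml.
  by case: (ger0P t) => ?; apply/andP; split; lra.
have It : `]t - 1, t + 1[%classic t by rewrite /= in_itv/=; apply/andP; split; lra.
pose G := M ^+ p.+1 * expR ((`|t| + 1) * M).
have G0 : 0 <= G by rewrite mulr_ge0 ?expR_ge0 ?exprn_ge0.
have fG x y : `]t - 1, t + 1[%classic x -> setT y -> `|partial1of2 f x y| <= G.
  move=> /I xt _; rewrite d1f normrM (ger0_norm (expR_ge0 _)) normrX.
  rewrite ler_pM ?exprn_ge0 ?expR_ge0//; first by rewrite lerXn2r ?nnegrE.
  by rewrite ler_expR (le_trans (ler_norm _))// normrM ler_pM.
have intG : rho.-integrable setT (EFin \o cst G).
  by apply: (@bounded_integrable _ _ _ rho (cst G)) => //; exists `|G|.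
have dff (x : R) (y : T) : derivable (f^~ y) x 1 by case: (df x y).
have H := @cvg_differentiation_under_integral R d T rho f setT measurableT t (t - 1) (t + 1)
  It (fun x _ => intf x) (fun x y _ _ => dff x y) (cst G) (fun=> G0) intG fG.
split.
  apply/cvg_ex; exists (\int[rho]_y partial1of2 f t y).
  by under eq_fun do rewrite scaler1.
rewrite /derive; under eq_fun do rewrite scaler1.
rewrite (cvg_lim _ H)//; apply: eq_Rintegral => y _; exact: d1f.
Qed.

Lemma spin_moment00 : mom 0 0 = 1.
Proof.
rewrite /spin_moment -[RHS](Espin_cst rho X 1); apply: eq_Rintegral => y _.
by rewrite expr0 mul0r expR0 mulr1.
Qed.

(** A class to which [poly_approx_class] applies and which contains the tilted mean and variance:
    the derivative of a moment ratio is a polynomial in moment ratios. *)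
Inductive cumulant_class (beta : R) : (R -> R) -> Prop :=
| cumulant_cst c : cumulant_class beta (fun=> c)
| cumulant_id : cumulant_class beta id
| cumulant_ratio p : cumulant_class beta (fun s => mom p (beta * s) / mom 0 (beta * s))
| cumulant_add f g : cumulant_class beta f -> cumulant_class beta g ->
    cumulant_class beta (fun s => f s + g s)
| cumulant_mul f g : cumulant_class beta f -> cumulant_class beta g ->
    cumulant_class beta (fun s => f s * g s).

Lemma is_derive_ratio beta p s :
  is_derive s 1 (fun s => mom p (beta * s) / mom 0 (beta * s))
    (beta * (mom p.+1 (beta * s) / mom 0 (beta * s)) +
     (- beta) * ((mom p (beta * s) / mom 0 (beta * s)) *
                 (mom 1 (beta * s) / mom 0 (beta * s)))).
Proof.
have h1 : is_derive s 1 (fun x => beta * x) beta.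
  by have := is_deriveZ beta (is_derive_id s 1); rewrite /GRing.scale/= mulr1.
have hm q : is_derive s 1 (fun x => mom q (beta * x)) (mom q.+1 (beta * s) * beta).
  exact: (@is_derive1_comp _ (mom q) (fun x => beta * x) s _ _ (is_derive_spin_moment q (beta * s)) h1).
have n0 : mom 0 (beta * s) != 0.
  by rewrite gt_eqF// (spin_moment0_gt0 rho mX bX).
have := is_deriveM (hm p) (@is_deriveV _ (fun x => mom 0 (beta * x)) s _ 1 n0 (hm 0%N)); rewrite /GRing.scale/= => H.
by apply: (@is_derive_eq _ _ _ _ _ _ _ _ H); field.
Qed.

Lemma cumulant_class_derive beta f : cumulant_class beta f ->
  exists2 g, cumulant_class beta g & forall x : R, is_derive x 1 f (g x).
Proof.
elim=> [c| |p|{}f g _ [f' Sf' df] _ [g' Sg' dg]|{}f g Sf [f' Sf' df] Sg [g' Sg' dg]].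
- by exists (fun=> 0); [exact: cumulant_cst|move=> x; exact: is_derive_cst].
- by exists (fun=> 1); [exact: cumulant_cst|move=> x; exact: is_derive_id].
- eexists; last by move=> x; exact: is_derive_ratio.
  apply: cumulant_add; apply: cumulant_mul; try exact: cumulant_cst.
    exact: cumulant_ratio.
  by apply: cumulant_mul; exact: cumulant_ratio.
- exists (fun s => f' s + g' s); first exact: cumulant_add.
  by move=> x; exact: is_deriveD.
- exists (fun s => f s * g' s + g s * f' s).
    by apply: cumulant_add; exact: cumulant_mul.
  by move=> x; exact: is_deriveM.
Qed.

Lemma poly_approx_cumulant beta N f : cumulant_class beta f ->
  exists p, poly_approx N f p.
Proof. exact: (poly_approx_class N (@cumulant_class_derive beta)). Qed.

Lemma locally_bounded_cumulant beta f : cumulant_class beta f -> locally_bounded f.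
Proof.
move=> /cumulant_class_derive[g _ fg].
exact: locally_bounded_continuous (is_derive_continuous fg).
Qed.

Lemma cumulant_mean beta : cumulant_class beta (fun s => tilted_mean rho X (beta * s)).
Proof. exact: cumulant_ratio. Qed.

Lemma cumulant_var beta : cumulant_class beta (fun s => tilted_var rho X (beta * s)).
Proof.
rewrite (_ : (fun s => _) = fun s => mom 2 (beta * s) / mom 0 (beta * s) + (-1) *
   ((mom 1 (beta * s) / mom 0 (beta * s)) * (mom 1 (beta * s) / mom 0 (beta * s)))).
  apply: cumulant_add; first exact: cumulant_ratio.
  apply: cumulant_mul; first exact: cumulant_cst.
  by apply: cumulant_mul; exact: cumulant_ratio.
by apply/funext => s; rewrite mulN1r.
Qed.

Hypothesis symX : forall h : R -> R, locally_bounded h ->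
  Espin (fun x => h (- x)) = Espin h.

Lemma spin_momentN p t : mom p (- t) = (-1) ^+ p * mom p t.
Proof.
have lh : locally_bounded (fun x => x ^+ p * expR (t * x)) by lb.
rewrite /spin_moment -(symX lh) -(EspinZ _ mX bX); last first.
  apply: locally_boundedM; first by apply: locally_boundedX; lb.
  have := locally_bounded_exp (- t); congr locally_bounded.
  by apply/funext => x; rewrite mulrN mulNr.
apply: eq_Rintegral => y _.
have e1 : (-1) ^+ p * (-1) ^+ p = 1 :> R by rewrite -exprD -signr_odd oddD addbb.
by rewrite [(- X y) ^+ p]exprNn mulrN mulNr !mulrA e1 mul1r.
Qed.

Lemma tilted_meanN t : tilted_mean rho X (- t) = - tilted_mean rho X t.
Proof. by rewrite /tilted_mean !spin_momentN expr1 expr0 mul1r mulN1r mulNr. Qed.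

Lemma tilted_varN t : tilted_var rho X (- t) = tilted_var rho X t.
Proof.
by rewrite /tilted_var tilted_meanN sqrrN !spin_momentN expr0 -signr_odd expr0 !mul1r.
Qed.

(** An even function has no linear term, and the value at 0 is the second moment. For |s| > 1 the
    trivial bound [M ^+ 2 + 1] makes the estimate global. *)
Lemma tilted_var_expansion beta : mom 2 0 = 1 ->
  exists C, 0 <= C /\ forall s, `|tilted_var rho X (beta * s) - 1| <= C * s ^+ 2.
Proof.
move=> m2; have [p Hp] := poly_approx_cumulant 2 (cumulant_var beta).
have m1 : mom 1 0 = 0.
  have := spin_momentN 1 0; rewrite oppr0 expr1 mulN1r => H.
  by apply/eqP; rewrite -[_ == _](mulrn_eq0 _ 2)// mulr2n {1}H addNr.
have p1 : p`_1 = 0.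
  apply: (poly_approx_even _ Hp); [by move=> s; rewrite mulrN tilted_varN|by []..].
have p0 : p`_0 = 1.
  have [K HK] := Hp 0; have := HK 0; rewrite normr0 expr0n/= !mulr0 => /(_ (lexx _)).
  rewrite normr_le0 subr_eq0 horner_coef0 => /eqP <-.
  by rewrite /tilted_var /tilted_mean m2 m1 spin_moment00 mul0r expr0n subr0 divr1.
have Hc j : (j < 2)%N -> (p - 1)`_j = 0.
  by case: j => [|[|//]] _; rewrite coefB coef1 ?p0 ?p1 ?subrr// subr0.
have [K1 HK1] := poly_coef_small Hc 1; have [K2 HK2] := Hp 1.
exists (`|K1| + `|K2| + M ^+ 2 + 1); split.
  by rewrite !addr_ge0// sqr_ge0.
move=> s; rewrite -(real_normK (num_real s)); have [s1|s1] := leP `|s| 1.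
  have -> : tilted_var rho X (beta * s) - 1 =
      (tilted_var rho X (beta * s) - p.[s]) + (p - 1).[s] by rewrite hornerD hornerN -polyC1 hornerC addrA subrK.
  apply: (le_trans (ler_normD _ _)).
  apply: (@le_trans _ _ (`|K2| * `|s| ^+ 2 + `|K1| * `|s| ^+ 2)).
    apply: lerD; first by rewrite (le_trans (HK2 _ s1))// ler_wpM2r ?sqr_ge0// ler_norm.
    by rewrite (le_trans (HK1 _ s1))// ler_wpM2r ?sqr_ge0// ler_norm.
  have := sqr_ge0 `|s|; have := sqr_ge0 M; nra.
have v0 := tilted_var_ge0 rho mX bX (beta * s).
have vM := tilted_var_le rho mX M0 bX (beta * s).
apply: (@le_trans _ _ (M ^+ 2 + 1)).
  by rewrite ler_norml; apply/andP; split; have := sqr_ge0 M; lra.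
have s2 : 1 <= `|s| ^+ 2 by rewrite exprn_ege1// ltW.
have := sqr_ge0 M; have := normr_ge0 K1; have := normr_ge0 K2; nra.
Qed.

Definition mean_field beta s := beta * s ^+ 2 / 2 - ln (mom 0 (beta * s)).

Lemma mean_fieldN beta s : mean_field beta (- s) = mean_field beta s.
Proof. by rewrite /mean_field sqrrN mulrN spin_momentN expr0 mul1r. Qed.

Lemma mean_field0 beta : mean_field beta 0 = 0.
Proof. by rewrite /mean_field expr0n !mulr0 mul0r spin_moment00 ln1 subrr. Qed.

Lemma is_derive_mean_field beta s :
  is_derive s 1 (mean_field beta) (beta * (s - tilted_mean rho X (beta * s))).
Proof.
have h1 : is_derive s 1 (fun x => beta * x) beta.
  by have := is_deriveZ beta (is_derive_id s 1); rewrite /GRing.scale/= mulr1.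
have hm : is_derive s 1 (fun x => mom 0 (beta * x)) (mom 1 (beta * s) * beta).
  exact: (@is_derive1_comp _ (mom 0) (fun x => beta * x) s _ _ (is_derive_spin_moment 0 (beta * s)) h1).
have p0 : 0 < mom 0 (beta * s) by exact: (spin_moment0_gt0 rho mX bX).
have hl := @is_derive1_comp _ (@ln R) (fun x => mom 0 (beta * x)) s _ _ (is_derive1_ln p0) hm.
have h2 : is_derive s 1 (fun s => beta * s ^+ 2 / 2) (beta * s).
  have := is_deriveZ (beta / 2) (is_derive_exprn 2 s); rewrite /GRing.scale/= => H.
  rewrite (_ : (fun s => beta * s ^+ 2 / 2) = (fun s => beta / 2 * s ^+ 2)); last first.
    by apply/funext => x; rewrite mulrAC.
  by apply: (@is_derive_eq _ _ _ _ _ _ _ _ H); field.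
have := is_deriveB h2 hl => H.
apply: (@is_derive_eq _ _ _ _ _ _ _ _ H).
by rewrite /tilted_mean; field; rewrite gt_eqF.
Qed.

(** Up to the factor beta, s - mean is the derivative of [mean_field], so
    [even_expansion_derivative] applies. For |s| > 1 each term is dominated by |s|^(2k+1), which
    makes the bound global. *)
Lemma tilted_mean_expansion beta k c e K : 0 < beta -> 0 <= c -> (0 < k)%N -> 0 < e ->
  (forall s, `|s| <= e -> `|mean_field beta s - c * s ^+ (2 * k)| <= K * `|s| ^+ (2 * k).+1) ->
  exists C, 0 <= C /\ forall s, `|s - tilted_mean rho X (beta * s) -
    c * (2 * k)%:R / beta * s ^+ (2 * k).-1| <= C * `|s| ^+ (2 * k).+1.
Proof.
move=> b0 c0 k0 e0 HK.
have Sg : cumulant_class beta (fun s => beta * (s + (-1) * tilted_mean rho X (beta * s))).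
  apply: cumulant_mul; first exact: cumulant_cst.
  apply: cumulant_add; first exact: cumulant_id.
  by apply: cumulant_mul; [exact: cumulant_cst|exact: cumulant_mean].
have [p Hp] := poly_approx_cumulant (2 * k).+1 Sg.
have dG s : is_derive s 1 (mean_field beta) (beta * (s + (-1) * tilted_mean rho X (beta * s))).
  by rewrite mulN1r; exact: is_derive_mean_field.
have [L HL] := even_expansion_derivative k0 dG (mean_fieldN beta) Hp e0 HK.
set c' := c * (2 * k)%:R / beta.
have c'0 : 0 <= c' by rewrite divr_ge0 ?mulr_ge0// ltW.
exists (`|L| / beta + 1 + M + c'); split.
  by rewrite !addr_ge0// divr_ge0// ltW.
move=> s; set m := tilted_mean rho X (beta * s).
have P0 q : 0 <= `|s| ^+ q by rewrite exprn_ge0.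
have [s1|s1] := leP `|s| 1.
  have -> : s - m - c' * s ^+ (2 * k).-1 = beta^-1 *
      (beta * (s + (-1) * m) - c * (2 * k)%:R * s ^+ (2 * k).-1).
    by rewrite /c'; field; rewrite gt_eqF.
  rewrite normrM gtr0_norm ?invr_gt0//.
  apply: (@le_trans _ _ (beta^-1 * (`|L| * `|s| ^+ (2 * k).+1))).
    rewrite ler_wpM2l ?invr_ge0 ?(ltW b0)// (le_trans (HL _ s1))//.
    by rewrite ler_wpM2r// ler_norm.
  rewrite mulrA [beta^-1 * _]mulrC ler_wpM2r// -!addrA lerDl.
  by rewrite !addr_ge0.
have s1' := ltW s1.
have q1 j : (j <= (2 * k).+1)%N -> `|s| ^+ j <= `|s| ^+ (2 * k).+1.
  by move=> jk; rewrite ler_weXn2l.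
apply: (@le_trans _ _ (`|s| ^+ (2 * k).+1 + M * `|s| ^+ (2 * k).+1 + c' * `|s| ^+ (2 * k).+1)).
  apply: (le_trans (ler_normB _ _)); apply: lerD; last first.
    by rewrite normrM normrX (ger0_norm c'0) ler_wpM2l// q1// (leq_trans (leq_pred _)).
  apply: (le_trans (ler_normB _ _)); apply: lerD; first by have := q1 1%N isT; rewrite expr1.
  rewrite (le_trans (normr_tilted_mean rho mX M0 bX _))// ler_peMr//.
  by have := q1 0%N isT; rewrite expr0.
rewrite -[X in X + _ + _]mul1r -!mulrDl ler_wpM2r// -!addrA lerDr.
by rewrite divr_ge0// ltW.
Qed.

(** Three zones: near 0 the expansion gives half of the leading term; in between, continuity and
    positivity give a positive minimum on a compact interval; far out the quadratic term beats the
    cumulant, which grows at most linearly for a bounded spin. *)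
Lemma mean_field_lower beta k c e K : 0 < beta -> 0 < c -> (0 < k)%N -> 0 < e ->
  (forall s, `|s| <= e -> `|mean_field beta s - c * s ^+ (2 * k)| <= K * `|s| ^+ (2 * k).+1) ->
  (forall s, s != 0 -> 0 < mean_field beta s) ->
  exists kap b, [/\ 0 < kap,
    forall s, `|s| <= b -> kap * s ^+ (2 * k) <= mean_field beta s &
    forall s, b <= `|s| -> kap * s ^+ 2 <= mean_field beta s].
Proof.
move=> b0 c0 k0 e0 HK Gpos.
set G := mean_field beta in HK Gpos *.
have cG : continuous G by exact: is_derive_continuous (is_derive_mean_field beta).
(* Within [dl] the remainder is at most half of the leading term. *)
pose dl := Num.min e (c / (2 * (`|K| + 1))).
have K10 : 0 < `|K| + 1 by rewrite ltr_wpDl.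
have dl0 : 0 < dl by rewrite lt_min e0 divr_gt0// mulr_gt0.
(* Beyond 4M the cumulant, at most beta |s| M, is at most beta s^2 / 4, so at least beta s^2 / 4 is
   left of beta s^2 / 2. *)
pose b := 4 * M + dl.
have db : dl <= b by rewrite lerDr mulr_ge0.
have x2k s : 0 <= s ^+ (2 * k) :> R by rewrite exprM exprn_ge0 ?sqr_ge0.
have near0 s : `|s| <= dl -> c / 2 * s ^+ (2 * k) <= G s.
  rewrite le_min => /andP[se sc]; have := HK s se.
  have : K * `|s| ^+ (2 * k).+1 <= c / 2 * s ^+ (2 * k).
    rewrite exprS mulrA -normrX (ger0_norm (x2k s)) ler_wpM2r//.
    apply: (@le_trans _ _ ((`|K| + 1) * `|s|)).
      by rewrite ler_wpM2r// (le_trans (ler_norm _))// lerDl.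
    rewrite -ler_pdivlMl//; apply: le_trans sc _.
    by rewrite le_eqVlt; apply/orP; left; apply/eqP; field; rewrite gt_eqF.
  by rewrite ler_norml => h1 /andP[h2 h3]; lra.
have [s0 s0b Hs0] := EVT_min db (continuous_subspaceT cG).
have s00 : 0 < s0 by move: s0b; rewrite in_itv/= => /andP[h _]; exact: lt_le_trans h.
have Gs0 : 0 < G s0 by apply: Gpos; rewrite gt_eqF.
have bpos : 0 < b by exact: lt_le_trans db.
have b2k : 0 < b ^+ (2 * k) by exact: exprn_gt0.
exists (Num.min (Num.min (c / 2) (G s0 / b ^+ (2 * k))) (beta / 4)), b; split.
- by rewrite !lt_min !divr_gt0.
- move=> s sb; have [sd|ds] := leP `|s| dl.
    apply: le_trans (near0 s sd); rewrite ler_wpM2r//.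
    by rewrite !ge_min lexx.
  apply: (@le_trans _ _ (G s0 / b ^+ (2 * k) * s ^+ (2 * k))).
    by rewrite ler_wpM2r// !ge_min lexx !orbT.
  have Gs : G s0 <= G `|s| by apply: Hs0; rewrite in_itv/= (ltW ds).
  have -> : G s = G `|s| by case: (ger0P s) => _; [by []|rewrite /G mean_fieldN].
  apply: le_trans Gs; rewrite -mulrA ler_piMr ?(ltW Gs0)// mulrC ler_pdivrMr// mul1r.
  by rewrite -(ger0_norm (x2k s)) normrX lerXn2r ?nnegrE// ltW.
- move=> s bs.
  apply: (@le_trans _ _ (beta / 4 * s ^+ 2)).
    by rewrite ler_wpM2r ?sqr_ge0// ge_min lexx orbT.
  have lnM : ln (mom 0 (beta * s)) <= beta * `|s| * M.
    rewrite -[leRHS](@expRK R) ler_ln ?posrE ?expR_gt0 ?(spin_moment0_gt0 rho mX bX)//.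
    rewrite -[leRHS](Espin_cst rho X) /spin_moment.
    apply: (le_Espin _ mX bX); try by lb.
    move=> x xM; rewrite expr0 mul1r ler_expR (le_trans (ler_norm _))// !normrM.
    by rewrite (gtr0_norm b0) ler_wpM2l// mulr_ge0// ltW.
  have M4 : 4 * M <= `|s| by apply: le_trans bs; rewrite lerDl ltW.
  rewrite /G /mean_field.
  have : beta * `|s| * M <= beta * s ^+ 2 / 4.
    rewrite -(real_normK (num_real s)) expr2 -!mulrA ler_wpM2l ?(ltW b0)// ler_wpM2l//.
    by rewrite ler_pdivlMr// mulrC.
  lra.
Qed.

End cumulant_expansion.

(** * Moment bounds and the rate of approximation *)

Lemma ge0_Rintegral_subset d (T : measurableType d) (R : realType)
    (mu : {measure set T -> \bar R}) (D : set T) (f : T -> R) :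
  measurable D -> mu.-integrable setT (EFin \o f) -> (forall x, 0 <= f x) ->
  \int[mu]_(x in D) f x <= \int[mu]_x f x.
Proof.
move=> mD intf f0; rewrite Rintegral_mkcond; apply: le_Rintegral => //.
  have := (integrable_mkcond (EFin \o f) mD).1 (integrableS measurableT mD (@subsetT _ D) intf).
  by rewrite restrict_EFin.
by move=> x _; rewrite /patch; case: ifP.
Qed.

Section mean_field_moments.
Context d (T : measurableType d) (R : realType) (rho : probability T R).
Context (X : T -> R) (mX : measurable_fun setT X) (M : R).
Hypotheses (M0 : 0 <= M) (bX : forall t, `|X t| <= M).
Local Notation leb := (@lebesgue_measure R).

Lemma Esum_expR n t :
  Esum rho X n (fun y => expR (t * y)) = spin_moment rho X 0 t ^+ n.
Proof.
elim: n => [|n IH]; first by rewrite Esum0 mulr0 expR0 expr0.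
rewrite (EsumS _ mX bX); last exact: locally_bounded_exp.
rewrite exprS -IH -(EsumZ _ mX bX); last exact: locally_bounded_exp.
congr Esum; apply/funext => y; rewrite mulrC -(EspinZ _ mX bX); last by lb.
by congr Espin; apply/funext => x; rewrite mulrDr expRD expr0 mul1r mulrC.
Qed.

Context (beta : R) (b0 : 0 < beta).
Local Notation G := (mean_field rho X beta).

Let measurable_mean_field : measurable_fun setT G.
Proof.
apply: continuous_measurable_fun.
exact: (is_derive_continuous (is_derive_mean_field rho mX M0 bX beta)).
Qed.

Lemma bracket_mean_field n0 h : admissible (n0.+1%:R * M) (fun s _ => h s) ->
  bracket (power_probability rho n0.+1) (@iid_sum _ T R X n0.+1)
    (n0.+1%:R * beta / 2) beta (fun s _ => h s) =
  \int[leb]_s (h s * expR (- (n0.+1%:R * G s))).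
Proof.
move=> ah; have A0 : 0 < n0.+1%:R * beta / 2 :> R by rewrite divr_gt0// mulr_gt0.
have mS := measurable_iid_sum mX (n := n0.+1).
rewrite (bracket_fst _ mS (iid_sum_bounded bX (n := n0.+1)) _ A0)//.
apply: eq_Rintegral => s _.
transitivity (h s * gaussw (n0.+1%:R * beta / 2) s *
    Esum rho X n0.+1 (fun y => expR (beta * s * y))).
  rewrite -(EsumZ _ mX bX); last by lb.
  by apply: eq_Rintegral => x _; rewrite /coupling; ring.
rewrite Esum_expR -mulrA; congr (_ * _).
rewrite -[spin_moment _ _ _ _](@lnK R) ?posrE ?(spin_moment0_gt0 rho mX bX)//.
rewrite -expRM_natl /gaussw -expRD; congr expR.
by rewrite /mean_field -mulr_natl; field.
Qed.

Context (k' : nat).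
Local Notation k := k'.+1.

(** The moment is a quotient of integrals against exp(-n G). Numerator and normalisation are both of
    order 1 / lam, so the bound on the quotient is free of n. *)
Lemma cw_moment_bound (kap b dl C : R) : 0 < kap -> 0 < dl -> dl <= 1 -> 0 <= C ->
  (forall s, `|s| <= b -> kap * s ^+ (2 * k) <= G s) ->
  (forall s, b <= `|s| -> kap * s ^+ 2 <= G s) ->
  (forall s, `|s| <= dl -> G s <= C * s ^+ (2 * k)) ->
  exists Km : nat -> R, forall n0 lam, 1 <= lam -> lam ^+ (2 * k) = n0.+1%:R ->
    forall q, cw_expect rho X n0 beta lam (fun u _ => u ^+ (2 * q)) <= Km q.
Proof.
move=> kap0 dl0 dl1 C0 Gsmall Glarge Gup.
(* The bound for fixed [q] has to be uniform in n and [lam]; choice then collects these bounds into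
   one sequence. *)
suff H q : exists K, forall n0 lam, 1 <= lam -> lam ^+ (2 * k) = n0.+1%:R ->
    cw_expect rho X n0 beta lam (fun u _ => u ^+ (2 * q)) <= K.
  by have [Km HKm] := choice H; exists Km => n0 lam l1 lk q; exact: HKm.
have [Kg [Kg0 HKg]] := gaussw_moment R q.
pose c1 := Kg / kap ^+ q * Num.sqrt (pi / kap).
have c10 : 0 <= c1 by rewrite mulr_ge0 ?sqrtr_ge0// divr_ge0// exprn_ge0// ltW.
exists (expR kap * c1 * expR C / (2 * dl)) => n0 lam lam1 lamk.
have lam0 : 0 < lam by exact: lt_le_trans lam1.
have A0 : 0 < n0.+1%:R * beta / 2 :> R by rewrite divr_gt0// mulr_gt0.
have aX := admX M n0 lam1 (2 * q).
have kl0 : 0 < kap * lam ^+ 2 by rewrite mulr_gt0// exprn_gt0.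
pose W s := expR (- (n0.+1%:R * G s)).
have mW : measurable_fun setT W.
  apply: measurableT_comp => //; apply: measurableT_comp => //.
  exact: measurable_funM.
(* With v = lam s: for |s| <= b, n G >= kap v^(2k) >= kap (v^2 - 1); otherwise n s^2 >= v^2. One
   Gaussian of width of order 1 / lam serves both zones. *)
have WG s : W s <= expR kap * gaussw (kap * lam ^+ 2) s.
  rewrite /W /gaussw -expRD ler_expR lerNl opprD opprK addrC.
  rewrite -mulrA -exprMn.
  have [sb|bs] := leP `|s| b.
    apply: (@le_trans _ _ (n0.+1%:R * (kap * s ^+ (2 * k)))); last first.
      by rewrite ler_wpM2l// Gsmall.
    rewrite (mulrCA n0.+1%:R) -lamk -exprMn -{2}[kap]mulr1 -mulrBr ler_wpM2l ?(ltW kap0)//.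
    have : `|lam * s| ^+ 2 <= 1 + (lam * s) ^+ (2 * k).
      by apply: ler_exprn_even; rewrite mulnS.
    by rewrite real_normK ?num_real// lerBlDl.
  apply: (@le_trans _ _ (n0.+1%:R * (kap * s ^+ 2))); last first.
    by rewrite ler_wpM2l// Glarge// ltW.
  rewrite (mulrCA n0.+1%:R) -{2}[kap]mulr1 -mulrBr ler_wpM2l ?(ltW kap0)//.
  rewrite (@le_trans _ _ ((lam * s) ^+ 2)) ?gerBl// exprMn ler_wpM2r ?sqr_ge0//.
  by rewrite -lamk ler_weXn2l// mulnS.
have iW p : leb.-integrable setT (EFin \o (fun s => s ^+ p * W s)).
  apply: (@integrable_le_gaussw _ (kap * lam ^+ 2) 0 p (expR kap)) => //.
    by apply: measurable_funM => //; exact: exprn_measurable.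
  move=> s; rewrite mul0r expR0 mulr1 normrM (ger0_norm (expR_ge0 _)) mulrCA normrX.
  apply: ler_pM; rewrite ?exprn_ge0 ?expR_ge0//.
    by rewrite lerXn2r ?nnegrE ?addr_ge0// lerDr.
  exact: WG.
have up : \int[leb]_s ((lam * s) ^+ (2 * q) * W s) <= expR kap * c1 / lam.
  have gi : leb.-integrable setT (EFin \o (fun s => s ^+ (2 * q) * gaussw (kap * lam ^+ 2) s)).
    apply: (@integrable_le_gaussw _ (kap * lam ^+ 2) 0 (2 * q) 1) => //.
      by apply: measurable_funM; [exact: exprn_measurable|exact: measurable_gaussw].
    move=> s; rewrite mul0r expR0 mulr1 normrM (ger0_norm (expR_ge0 _)) mul1r normrX.
    by rewrite ler_wpM2r ?expR_ge0// lerXn2r ?nnegrE ?addr_ge0// lerDr.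
  apply: (@le_trans _ _ (\int[leb]_s (lam ^+ (2 * q) * expR kap *
      (s ^+ (2 * q) * gaussw (kap * lam ^+ 2) s)))).
    apply: le_Rintegral => //; last 2 first.
    - exact: integrableRZ.
    - move=> s _; rewrite exprMn -!mulrA ler_wpM2l ?exprn_ge0 ?(ltW lam0)//.
      by rewrite mulrCA ler_wpM2l// exprM exprn_ge0 ?sqr_ge0.
    have := integrableRZ (lam ^+ (2 * q)) (iW (2 * q)%N).
    by congr (_.-integrable _ _); apply/funext => s /=; rewrite exprMn mulrA.
  rewrite RintegralZl// HKg//.
  rewrite (_ : pi / (kap * lam ^+ 2) = pi / kap * (lam^-1) ^+ 2); last first.
    by rewrite exprVn invfM mulrA.
  rewrite sqrtrM ?divr_ge0 ?pi_ge0 ?(ltW kap0)// sqrtr_sqr ger0_norm ?invr_ge0 ?(ltW lam0)//.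
  rewrite /c1 exprMn -exprM le_eqVlt; apply/orP; left; apply/eqP; field.
  by rewrite !expf_neq0 ?gt_eqF.
(* For |s| <= dl / lam, n G <= C (lam s)^(2k) <= C; the interval has length 2 dl / lam. *)
have low : 2 * dl / expR C / lam <= \int[leb]_s W s.
  pose D := `[- (dl / lam), dl / lam]%classic : set R.
  have mD : measurable D by exact: measurable_itv.
  have dll : 0 < dl / lam by exact: divr_gt0.
  have muD : leb D = (2 * dl / lam)%:E.
    by rewrite lebesgue_measure_itv/= lte_fin gtrN// -EFinD; congr (_ %:E); ring.
  have iW0 : leb.-integrable setT (EFin \o W).
    by have := iW 0%N; congr (_.-integrable _ _); apply/funext => s /=; rewrite mul1r.
  have iWD : leb.-integrable D (EFin \o W) by apply: integrableS iW0.
  apply: (@le_trans _ _ (\int[leb]_(s in D) W s)); last first.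
    apply: ge0_Rintegral_subset => // s; exact: expR_ge0.
  rewrite (_ : _ / lam = \int[leb]_(s in D) (expR C)^-1); last first.
    by rewrite Rintegral_cst// [X in fine X]muD/=; ring.
  apply: le_Rintegral => //.
  - apply: measurable_bounded_integrable => //.
      by rewrite [X in (X < _)%E]muD ltry.
    exact: bounded_cst.
  move=> s; rewrite /D/= in_itv/= -ler_norml => sd.
  rewrite -expRN ler_expR lerN2.
  apply: (@le_trans _ _ (n0.+1%:R * (C * s ^+ (2 * k)))).
    by rewrite ler_wpM2l// Gup// (le_trans sd)// ler_pdivrMr// ler_peMr// (ltW dl0).
  rewrite (mulrCA n0.+1%:R) -lamk -exprMn ler_piMr//.
  have : `|lam * s| <= 1.
    rewrite normrM (gtr0_norm lam0) -ler_pdivlMl// mulr1 (le_trans sd)//.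
    by rewrite ler_piMl// invr_ge0 ltW.
  by move=> ls; rewrite (le_trans (ler_norm _))// normrX exprn_ile1.
rewrite /cw_expect !bracket_mean_field//; last exact: admissible_cst.
have -> : \int[leb]_s (1 * expR (- (n0.+1%:R * G s))) = \int[leb]_s W s.
  by apply: eq_Rintegral => s _; rewrite mul1r.
have d0 : 0 < 2 * dl / expR C / lam by rewrite !divr_gt0 ?mulr_gt0 ?expR_gt0.
rewrite ler_pdivrMr ?(lt_le_trans d0 low)// (le_trans up)//.
apply: (@le_trans _ _ (expR kap * c1 * expR C / (2 * dl) * (2 * dl / expR C / lam))).
  by rewrite le_eqVlt; apply/orP; left; apply/eqP; field; rewrite !gt_eqF ?expR_gt0.
rewrite ler_wpM2l//; apply: divr_ge0; last by rewrite mulr_ge0// ltW.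
by rewrite mulr_ge0 ?expR_ge0// mulr_ge0 ?expR_ge0.
Qed.

End mean_field_moments.

(** * The rate for the rescaled coupling, uniform in n *)

Section approximation_rate.
Context d (T : measurableType d) (R : realType) (rho : probability T R).
Context (X : T -> R) (mX : measurable_fun setT X) (M : R).
Hypotheses (M0 : 0 <= M) (bX : forall t, `|X t| <= M).
Hypothesis symX : forall h : R -> R, locally_bounded h ->
  Espin rho X (fun x => h (- x)) = Espin rho X h.
Hypothesis var1 : spin_moment rho X 2 0 = 1.
Context (beta : R) (b0 : 0 < beta) (k' : nat).
Local Notation k := k'.+1.
Local Notation r := (2 * k).-1.
Local Notation G := (mean_field rho X beta).

Context (c e K : R).
Hypotheses (c0 : 0 < c) (e0 : 0 < e).
Hypothesis Gexp : forall s, `|s| <= e ->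
  `|G s - c * s ^+ (2 * k)| <= K * `|s| ^+ (2 * k).+1.
Hypothesis Gpos : forall s, s != 0 -> 0 < G s.

Let uniform_moments : exists Km : nat -> R, forall n0 lam, 1 <= lam ->
  lam ^+ (2 * k) = n0.+1%:R ->
  forall q, cw_expect rho X n0 beta lam (fun u _ => u ^+ (2 * q)) <= Km q.
Proof.
have [kap [b [kap0 Gs Gl]]] := mean_field_lower mX M0 bX symX b0 c0 (ltn0Sn k') e0 Gexp Gpos.
apply: (cw_moment_bound mX M0 bX b0 kap0 (dl := Num.min e 1) (C := c + `|K|) _ _ _ Gs Gl).
- by rewrite lt_min e0 ltr01.
- by rewrite ge_min lexx orbT.
- by rewrite addr_ge0// ltW.
move=> s; rewrite le_min => /andP[se s1].
have s2k : 0 <= s ^+ (2 * k) by rewrite exprM exprn_ge0 ?sqr_ge0.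
have := Gexp se; rewrite ler_norml => /andP[_].
have : K * `|s| ^+ (2 * k).+1 <= `|K| * s ^+ (2 * k).
  apply: (@le_trans _ _ (`|K| * `|s| ^+ (2 * k).+1)).
    by rewrite ler_wpM2r ?exprn_ge0// ler_norm.
  by rewrite ler_wpM2l// exprS -normrX (ger0_norm s2k) ler_piMl.
rewrite mulrDl; lra.
Qed.

(** The first alternative collects the n for which the moment estimate is too weak to locate 1 / m;
    there the final bound exceeds 1 and holds trivially. Otherwise Stein's equation is solved with
    the coefficient 1 / m. *)
Lemma cw_approximation : exists C : R, forall n0 lam, 1 <= lam ->
  lam ^+ (2 * k) = n0.+1%:R ->
  let m := cw_expect rho X n0 beta lam (fun _ w => w ^+ (2 * k)) in
  1 <= C / lam ^+ 2 \/ 0 < m /\ forall z,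
    `|cw_expect rho X n0 beta lam (fun _ w => \1_(`]-oo, z]) w) -
      cumul k' m^-1 z / total k' m^-1| <= C * ((lam ^+ r)^-1 + (lam ^+ 2)^-1).
Proof.
have [Km hK] := uniform_moments.
have [C1 [C10 varC]] := tilted_var_expansion mX M0 bX symX beta var1.
have [C2 [C20 meanC]] := tilted_mean_expansion mX M0 bX symX b0 (ltW c0) (ltn0Sn k') e0 Gexp.
(* The coefficient of s^r in s - mean, which is the limit of 1 / m. *)
pose a0 := c * (2 * k)%:R / beta.
have a00 : 0 < a0 by rewrite divr_gt0// mulr_gt0.
pose Cm := Num.max C1 C2.
have Cm0 : 0 <= Cm by rewrite le_max C10.
pose mc := main_const beta k' Km a0 Cm.
(* Dominates [ratio_bound a] for every [a] in [a0/2, 2 a0] as well as the bound 2 on the Stein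
   derivative; [L] below plays the same part for [stein_lip]. *)
pose B := expR (2 * a0) * (2 / a0 + 1) + 2.
have B0 : 0 <= B by rewrite addr_ge0// mulr_ge0 ?expR_ge0// addr_ge0// divr_ge0// ltW.
pose L := 2 * a0 * (r%:R * B + 2) * (2 * (1 + M)) ^+ r.
have M10 : 0 <= (2 * (1 + M)) ^+ r by rewrite exprn_ge0// mulr_ge0// addr_ge0.
have L0 : 0 <= L.
  apply: mulr_ge0 => //; apply: mulr_ge0; first by rewrite mulr_ge0// ltW.
  by rewrite addr_ge0// mulr_ge0.
pose A1 := 3 * M ^+ 2 * (M * (L * (2 + Km k)) + concentration_const M k' Km a0 Cm).
(* The last summand comes from |a0 - a| <= 2 a0 mc / lam^2. *)
pose A2 := 3 * M ^+ 2 * (Cm * Km 1) + B * mc + 2 * a0 * mc * (B * (1 + Km k)).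
exists (`|A1| + `|A2| + 2 * `|mc|) => n0 lam lam1 lamk m.
have lam0 : 0 < lam by exact: lt_le_trans lam1.
have l20 : 0 < lam ^+ 2 by exact: exprn_gt0.
have lr0 : 0 < lam ^+ r by exact: exprn_gt0.
have mmean := (locally_bounded_cumulant mX M0 bX (cumulant_mean rho X beta)).1.
have mvar := (locally_bounded_cumulant mX M0 bX (cumulant_var rho X beta)).1.
have varC' s : `|tilted_var rho X (beta * s) - 1| <= Cm * s ^+ 2.
  by rewrite (le_trans (varC s))// ler_wpM2r ?sqr_ge0// le_max lexx.
have meanC' s : `|s - tilted_mean rho X (beta * s) - a0 * s ^+ r| <=
    Cm * `|s| ^+ (2 * k).+1.
  by rewrite (le_trans (meanC s))// ler_wpM2r ?exprn_ge0// le_max lexx orbT.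
have hKn := hK n0 lam lam1 lamk.
have Hm : `|a0 * m - 1| <= mc / lam ^+ 2.
  exact: (cw_moment mX M0 bX b0 lam1 lamk (fun=> erefl) (fun=> erefl) hKn mmean
    mvar (ltW a00) Cm0 varC' meanC').
(* A moment error below 1/2 puts a0 m between 1/2 and 3/2, which gives m > 0 and 1 / m in
   [a0/2, 2 a0]. *)
have [big|small] := ltP (1 / 2) (mc / lam ^+ 2).
  left; apply: (@le_trans _ _ (2 * (mc / lam ^+ 2))); first by lra.
  rewrite mulrA ler_wpM2r ?invr_ge0 ?(ltW l20)//.
  apply: (@le_trans _ _ (2 * `|mc|)); first by rewrite ler_wpM2l// ler_norm.
  by rewrite lerDr addr_ge0.
right.
have m0 : 0 < m.
  have : 0 < a0 * m by move: Hm; rewrite ler_norml => /andP[]; lra.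
  by rewrite pmulr_rgt0.
split=> // z; set a := m^-1.
have a_gt0 : 0 < a by rewrite invr_gt0.
have am : a0 * m = a0 / a by rewrite /a invrK.
have a2 : a <= 2 * a0.
  move: Hm; rewrite am ler_norml => /andP[h _].
  have : 1 / 2 <= a0 / a by lra.
  rewrite ler_pdivlMr// => ?; lra.
have a1 : a0 / 2 <= a.
  move: Hm; rewrite am ler_norml => /andP[_ h].
  have : a0 / a <= 2 by lra.
  rewrite ler_pdivrMr// => ?; lra.
have rB : ratio_bound a <= B.
  rewrite /ratio_bound /B (@le_trans _ _ (expR (2 * a0) * (2 / a0 + 1)))// ?lerDl//.
  apply: ler_pM; rewrite ?expR_ge0 ?ler_expR//.
    by rewrite addr_ge0// invr_ge0 ltW.
  rewrite lerD2r -[2 / a0]invrK invf_div lef_pV2// ?posrE// divr_gt0//.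
have lipL : stein_lip k' a M <= L.
  rewrite /stein_lip /L ler_wpM2r//; apply: ler_pM => //; first exact: ltW.
    by rewrite addr_ge0// mulr_ge0// ratio_bound_ge0.
  by rewrite lerD2r ler_wpM2l.
have N0 : 0 < n0.+1%:R :> R by [].
have lN : M * lam / n0.+1%:R <= M.
  by rewrite -mulrA ler_piMr// ler_pdivrMr// mul1r -lamk -{1}[lam]expr1 ler_weXn2l//.
have l0 : 0 <= M * lam / n0.+1%:R.
  by rewrite divr_ge0// mulr_ge0// ltW.
have oscL w : stein_osc k' a z M (M * lam / n0.+1%:R) w <=
    M * lam / n0.+1%:R * (L * (1 + `|w| ^+ r)) +
    \1_(`[z - M * lam / n0.+1%:R, z + M * lam / n0.+1%:R]) w.
  by rewrite lerD2r ler_wpM2l// ler_wpM2r// addr_ge0// exprn_ge0.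
have lf : locally_bounded (stein_fun k' a z).
  by apply: locally_bounded_continuous; exact: continuous_stein_fun.
have H := cw_stein_bound mX M0 bX b0 lam1 lamk (fun=> erefl) (fun=> erefl) hKn mmean
    mvar (ltW a00) Cm0 varC' meanC' (a := a) (z := z)
    (Fz := cumul k' a z / total k' a) (f := stein_fun k' a z) (K := B) (L := L) lf B0 L0.
apply: le_trans (H _ _ _ _) _.
- by move=> w; rewrite (le_trans _ rB)//; exact: normr_stein_fun.
- move=> w; have : `|stein_deriv k' a z w| <= B; last by [].
  apply: (@le_trans _ _ 2); first exact: normr_stein_deriv.
  by rewrite lerDr mulr_ge0 ?expR_ge0// addr_ge0// divr_ge0// ltW.
- move=> w v wv; apply: le_trans (oscL w).
  have : `|stein_deriv k' a z w - stein_deriv k' a z v| <=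
      stein_osc k' a z M (M * lam / n0.+1%:R) w; last by [].
  apply: stein_deriv_osc => //; first by rewrite subrr normr0.
  by rewrite distrC.
- move=> w v wv; apply: le_trans (ler_wpM2l l0 (oscL w)).
  exact: stein_fun_taylor.
have Km0 : 0 <= 1 + Km k.
  by rewrite addr_ge0// (moment_bound_ge0 mX bX b0 lam1 hKn).
have ca : `|a0 - a| <= 2 * a0 * mc / lam ^+ 2.
  have -> : a0 - a = a * (a0 * m - 1) by rewrite /a mulrBr mulr1 mulrCA mulVf ?mulr1// gt_eqF.
  by rewrite normrM (gtr0_norm a_gt0) -[2 * a0 * mc / _]mulrA; apply: ler_pM => //; exact: ltW.
apply: (@le_trans _ _ (A1 / lam ^+ r + A2 / lam ^+ 2)).
  apply: (@le_trans _ _ (A1 / lam ^+ r + (3 * M ^+ 2 * (Cm * Km 1) + B * mc) / lam ^+ 2 +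
    2 * a0 * mc / lam ^+ 2 * (B * (1 + Km k)))).
    by rewrite lerD2l ler_wpM2r// mulr_ge0.
  by rewrite /A2 le_eqVlt; apply/orP; left; apply/eqP; ring.
rewrite mulrDr; apply: lerD; apply: ler_wpM2r; rewrite ?invr_ge0 ?(ltW lr0) ?(ltW l20)//.
  by rewrite (le_trans (ler_norm _))// -addrA lerDl addr_ge0// mulr_ge0.
by rewrite (le_trans (ler_norm _))// -addrA addrCA lerDl addr_ge0// mulr_ge0.
Qed.

End approximation_rate.

(** * The Curie-Weiss measure *)

(** [Q] has both [g] and the Radon-Nikodym derivative as density with respect to [P]. The two agree
    almost everywhere, so the change of variables carries over to [g]. *)
Lemma integral_density d (T : measurableType d) (R : realType)
    (P Q : probability T R) (g : T -> R) (f : T -> \bar R) :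
  measurable_fun setT g -> (forall x, 0 <= g x) ->
  (forall A, measurable A -> Q A = (\int[P]_(x in A) (g x)%:E)%E) ->
  measurable_fun setT f -> (forall x, (0 <= f x)%E) ->
  (\int[Q]_x f x = \int[P]_x (f x * (g x)%:E))%E.
Proof.
move=> mg g0 QE mf f0.
have mEg : measurable_fun setT (EFin \o g) by exact/measurable_EFinP.
have QP : Q `<< P.
  apply/null_content_dominatesP => A mA PA0; rewrite QE//.
  by apply: null_set_integral => //; exact: measurable_funTS.
pose h := Radon_Nikodym_SigmaFinite.f Q P.
have ih : P.-integrable setT h by exact: Radon_Nikodym_SigmaFinite.f_integrable.
have mh : measurable_fun setT h by exact: measurable_int ih.
rewrite -(Radon_Nikodym_SigmaFinite.change_of_variables QP f0 measurableT mf).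
apply: ge0_ae_eq_integral => //.
- exact: emeasurable_funM.
- exact: emeasurable_funM.
- by move=> x _; rewrite mule_ge0// Radon_Nikodym_SigmaFinite.f_ge0.
- by move=> x _; rewrite mule_ge0// lee_fin.
apply: ae_eqe_mul2l; apply: integral_ae_eq => // E _ mE.
transitivity (Q E); last exact: QE.
by apply/esym; exact: Radon_Nikodym_SigmaFinite.f_integral.
Qed.

Section curie_weiss_law.
Context (R : realType) (rho : probability (measurableTypeR R) R) (M : R).
Hypotheses (M0 : 0 <= M) (suppM : {ae rho, forall x, `|x| <= M}).
Local Notation X := (@clamp R M : measurableTypeR R -> R).

Lemma measurable_clamp : measurable_fun setT X.
Proof.
have := (locally_bounded_clamp M 0).1.
by under eq_fun do rewrite subr0.
Qed.

Lemma clamp_ae : {ae rho, forall x, X x = x}.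
Proof.
apply: (@filterS _ _ (ae_filter_ringOfSetsType rho) _ _ _ suppM) => x.
by rewrite ler_norml; exact: clampE.
Qed.

Lemma Espin_clampE (h : R -> R) : measurable_fun setT h ->
  \int[rho]_x h x = Espin rho X h.
Proof.
move=> mh; rewrite /Espin /Rintegral; congr fine; apply: ae_eq_integral => //.
- exact/measurable_EFinP.
- by apply/measurable_EFinP; apply: measurableT_comp => //; exact: measurable_clamp.
apply: (@filterS _ _ (ae_filter_ringOfSetsType rho) _ _ _ clamp_ae) => x /= Xx _.
by rewrite Xx.
Qed.

(** All n coordinates lie in [-M, M] with probability 1, and there the truncation does nothing. *)
Lemma spin_sum_clamp_ae n :
  {ae power_probability rho n, forall x, spin_sum x = iid_sum X x}.
Proof.
pose B := [set x : R | `|x| <= M].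
have mB : measurable B.
  rewrite (_ : B = `[- M, M]%classic); first exact: measurable_itv.
    by apply/seteqP; split => x; rewrite /B/= in_itv/= ler_norml.
pose A := [set x : n.-tuple (measurableTypeR R) | forall i, B (tnth x i)].
have mA : measurable A.
  rewrite (_ : A = \bigcap_(i in setT) ((fun x => tnth x i) @^-1` B)); last first.
    by apply/seteqP; split => x h i => [_|]; exact: h.
  apply: fin_bigcap_measurable => // i _.
  by rewrite -[X in measurable X]setTI; exact: measurable_tnth.
have rB : rho B = 1%E.
  have [N [mN N0 BN]] := suppM.
  apply/eqP; rewrite eq_le probability_le1//=.
  have : (rho (~` B) <= 0)%E.
    by rewrite -N0; apply: le_measure; rewrite ?inE//; exact: measurableC.
  rewrite probability_setC// lee_subel_addr ?add0e//.
exists (~` A); split.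
- exact: measurableC.
- rewrite probability_setC//.
  have -> : power_probability rho n A = 1%E; last by rewrite subee.
  by rewrite (power_probabilityE rho (A := fun=> B))// big1.
move=> x /= xA Ax; apply: xA; apply: eq_bigr => i _.
by rewrite clampE// -ler_norml; exact: Ax.
Qed.

Lemma integral_spin_sum n (h : R -> R) : measurable_fun setT h ->
  (\int[power_probability rho n]_x (h (spin_sum x))%:E =
   \int[power_probability rho n]_x (h (iid_sum X x))%:E)%E.
Proof.
move=> mh; apply: ae_eq_integral => //.
- by apply/measurable_EFinP; apply: measurableT_comp mh _; exact: measurable_spin_sum.
- apply/measurable_EFinP; apply: measurableT_comp mh _.
  exact: (measurable_iid_sum measurable_clamp).
apply: (@filterS _ _ (ae_filter_ringOfSetsType _) _ _ _ (@spin_sum_clamp_ae n)).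
by move=> x /= -> _.
Qed.

Let bX x : `|X x| <= M. Proof. exact: normr_clamp. Qed.

Context (beta : R) (b0 : 0 < beta) (rhoB : classB rho) (n : nat) (n0 : (0 < n)%N).
Let w (y : R) : R := expR (beta / (2 * n%:R) * y ^+ 2).

Let lw : locally_bounded w.
Proof.
apply: (locally_bounded_comp (locally_bounded_exp (beta / (2 * n%:R)))).
exact: (locally_boundedX 2 (@locally_bounded_id R)).
Qed.

(** Nonnegative [h] are enough: it will be applied to even powers and to indicators. *)
Lemma curie_weiss_integral (h : R -> R) : locally_bounded h -> (forall y, 0 <= h y) ->
  (\int[curie_weiss rho beta n]_x (h (spin_sum x))%:E =
   (Esum rho X n (fun y => h y * w y) / Esum rho X n w)%:E)%E.
Proof.
move=> lh h0.
have EsumE g : locally_bounded g ->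
    (\int[power_probability rho n]_x (g (spin_sum x))%:E = (Esum rho X n g)%:E)%E.
  move=> lg; rewrite integral_spin_sum; last exact: lg.1.
  by rewrite fineK//; apply: integrable_fin_num => //; exact: (Esum_integrable rho measurable_clamp bX).
have ZE : cw_weight rho beta n setT = (Esum rho X n w)%:E by exact: EsumE lw.
pose Z := (Esum rho X n w)^-1.
have Z0 : 0 <= Z.
  by rewrite invr_ge0; apply: Rintegral_ge0 => x _; exact: expR_ge0.
rewrite (@integral_density _ _ _ (power_probability rho n) _ (fun x => Z * w (spin_sum x))).
- rewrite mulrC -(EsumZ _ measurable_clamp bX); last exact: locally_boundedM.
  rewrite -EsumE; last by apply: locally_boundedM; [exact: locally_bounded_cst|exact: locally_boundedM].
  by apply: eq_integral => x _; rewrite -EFinM mulrCA.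
- apply: measurable_funM => //; apply: measurableT_comp lw.1 _.
  exact: measurable_spin_sum.
- by move=> x; rewrite mulr_ge0// expR_ge0.
- move=> A mA; rewrite curie_weissE// ZE/=.
  rewrite -ge0_integralZl_EFin//.
  apply: measurable_funTS; apply/measurable_EFinP.
  by apply: measurableT_comp lw.1 _; exact: measurable_spin_sum.
- apply/measurable_EFinP; apply: measurableT_comp lh.1 _; exact: measurable_spin_sum.
- by move=> x; rewrite lee_fin.
Qed.

End curie_weiss_law.

(** For functions of W alone the coupling gives Curie-Weiss averages: the Gaussian constant cancels
    in the quotient, and the exponent b^2 / (4A) becomes beta / (2n). *)
Lemma cw_expect_marginal d (T : measurableType d) (R : realType)
    (rho : probability T R) (X : T -> R) (M beta lam : R) n0 h :
  measurable_fun setT X -> (forall t, `|X t| <= M) -> 0 < beta ->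
  locally_bounded h ->
  let w (y : R) := expR (beta / (2 * n0.+1%:R) * y ^+ 2) in
  cw_expect rho X n0 beta lam (fun _ y => h y) =
  Esum rho X n0.+1 (fun y => h (lam * y / n0.+1%:R) * w y) / Esum rho X n0.+1 w.
Proof.
move=> mX bX b0 lh w; have A0 : 0 < n0.+1%:R * beta / 2 :> R by rewrite divr_gt0// mulr_gt0.
have mS := measurable_iid_sum mX (n := n0.+1).
have bS := iid_sum_bounded bX (n := n0.+1).
have lh' : locally_bounded (fun y => h (lam * y / n0.+1%:R)).
  apply: (locally_bounded_comp lh); apply: locally_boundedM; last exact: locally_bounded_cst.
  by apply: locally_boundedM; [exact: locally_bounded_cst|exact: locally_bounded_id].
rewrite /cw_expect (bracket_marginal _ mS bS _ A0 lh').
rewrite (bracket_marginal _ mS bS _ A0 (locally_bounded_cst 1)).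
have -> : beta ^+ 2 / (4 * (n0.+1%:R * beta / 2)) = beta / (2 * n0.+1%:R).
  by field; rewrite nat1r !gt_eqF.
rewrite -mulf_div divff ?mul1r; last first.
  by rewrite gt_eqF// sqrtr_gt0 divr_gt0// pi_gt0.
by congr (_ / _); apply: eq_Rintegral => x _; rewrite mul1r.
Qed.

(** * The limiting distribution functions *)

Section limit_distributions.
Context (R : realType).
Local Notation leb := (@lebesgue_measure R).
Implicit Types m z : R.

Lemma Fhat_cumul k' m z : 0 < m ->
  Fhat k'.+1 m z = (cumul k' m^-1 z / total k' m^-1)%:E.
Proof.
move=> m0; have m'0 : 0 < m^-1 by rewrite invr_gt0.
have E (x : R) : expR (- (x ^+ (2 * k'.+1) / ((2 * k'.+1)%:R * m))) = weight k' m^-1 x.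
  by rewrite /weight /potential invfM; congr (expR (- _)); ring.
have fE x : fhat k'.+1 m x = (total k' m^-1)^-1 * weight k' m^-1 x.
  rewrite /fhat E mulrC; congr (_^-1 * _).
  by apply: eq_Rintegral => y _; rewrite E.
rewrite /Fhat; under eq_integral do rewrite fE EFinM.
have iw : leb.-integrable `]-oo, z]%classic (EFin \o weight k' m^-1).
  by apply: integrableS (integrable_weight k' m'0).
rewrite -[cumul _ _ _ / _]mulrC EFinM /cumul fineK; last exact: integrable_fin_num.
by rewrite -integralZl.
Qed.

(** For the n treated by the trivial bound, m is only known to be nonnegative, so m = 0 has to be
    covered. *)
Lemma Fhat_bounds k' m z : 0 <= m -> (0 <= Fhat k'.+1 m z <= 1)%E.
Proof.
rewrite le_eqVlt => /predU1P[<-|m0].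
  (* For m = 0 division by zero makes the exponent 0; the normalising integral is then [fine] of
     +oo, that is 0, and its inverse makes the density 0. *)
  rewrite /Fhat (_ : (fun x => _) = fun=> 0%E) ?integral0 ?lexx ?lee01//.
  apply/funext => x; rewrite /fhat.
  under eq_Rintegral do rewrite mulr0 invr0 mulr0 oppr0 expR0.
  rewrite Rintegral_cst// [X in fine X](_ : _ = +oo%E) ?mulr0 ?invr0 ?mulr0//.
  by have /= := @lebesgue_measure_itv R `]-oo, +oo[; rewrite set_itvE.
have m'0 : 0 < m^-1 by rewrite invr_gt0.
have T0 := total_gt0 k' m'0.
rewrite Fhat_cumul// !lee_fin divr_ge0 ?cumul_ge0 ?(ltW T0)//.
by rewrite ler_pdivrMr// mul1r cumul_le_total.
Qed.

(** The centred normal law of variance m is the case k = 1 of the family; the normalising constants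
    agree because the normal density integrates to 1. *)
Lemma normal_cdf_cumul m z : 0 < m ->
  normal_cdf m z = (cumul 0 m^-1 z / total 0 m^-1)%:E.
Proof.
move=> m0; rewrite -Fhat_cumul// /normal_cdf /normal_prob /Fhat.
have m'0 : 0 < m^-1 by rewrite invr_gt0.
have s0 : Num.sqrt m != 0 by rewrite gt_eqF// sqrtr_gt0.
pose c := normal_peak (Num.sqrt m).
have c0 : c != 0 by rewrite gt_eqF// normal_peak_gt0.
have E x : normal_pdf 0 (Num.sqrt m) x = c * expR (- (x ^+ (2 * 1) / ((2 * 1)%:R * m))).
  rewrite normal_pdfE// /normal_fun subr0 sqr_sqrtr ?(ltW m0)//.
  by rewrite mulNr -[m *+ 2]mulr_natl.
apply: eq_integral => x _; congr (_ %:E); rewrite E /fhat mulrC; congr (_ * _).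
set I := \int[leb]_y _.
have cI : c * I = 1.
  rewrite /I -RintegralZl//.
    under eq_Rintegral do rewrite -E.
    by rewrite /Rintegral integral_normal_pdf.
  have := integrableRZ c^-1 (integrable_normal_pdf 0 (Num.sqrt m)).
  by congr (_.-integrable _ _); apply/funext => y /=; rewrite E mulKf.
by rewrite -[c]mulr1 -[1](mulfV (x := I)) ?mulrA ?cI ?mul1r//; apply: contra_eq_neq cI => ->; rewrite mulr0 eq_sym oner_eq0.
Qed.

Lemma normal_cdf_bounds m z : (0 <= normal_cdf m z <= 1)%E.
Proof. by rewrite measure_ge0 (@probability_le1 _ _ _ (normal_prob 0 _))//; exact: measurable_itv. Qed.

End limit_distributions.

(** Symmetry is given on sets; the image measure under negation carries it over to integrals. *)
Lemma symmetric_Rintegral (R : realType) (rho : probability (measurableTypeR R) R)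
    (h : R -> R) : classB rho -> measurable_fun setT h ->
  (exists K, forall x, `|h x| <= K) -> \int[rho]_x h (- x) = \int[rho]_x h x.
Proof.
move=> [_ sym _] mh [K hK]; rewrite /Rintegral; congr fine.
have mN : measurable_fun setT (-%R : measurableTypeR R -> measurableTypeR R) by [].
transitivity (\int[pushforward rho (-%R : measurableTypeR R -> measurableTypeR R)]_y (h y)%:E)%E.
  rewrite integral_pushforward//; first exact/measurable_EFinP.
  apply: (@bounded_integrable _ _ _ rho (fun x => h (- x))).
    exact: measurableT_comp.
  by exists K.
by apply: eq_measure_integral => A mA _; exact: sym.
Qed.

(** * The rate for the Curie-Weiss measure *)

Section curie_weiss_rate.
Context (R : realType) (rho : probability (measurableTypeR R) R) (beta : R).
Context (k' : nat).
Local Notation k := k'.+1.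
Hypotheses (rhoB : classB rho) (b0 : 0 < beta).
Hypothesis var1 : (\int[rho]_x (x ^+ 2)%:E = 1)%E.
Context (M : R).
Hypotheses (M0 : 0 <= M) (suppM : {ae rho, forall x, `|x| <= M}).
Local Notation X := (@clamp R M : measurableTypeR R -> R).
Let mX : measurable_fun setT X := measurable_clamp M.
Let bX x : `|X x| <= M. Proof. exact: normr_clamp. Qed.

Let symX (h : R -> R) : locally_bounded h ->
  Espin rho X (fun x => h (- x)) = Espin rho X h.
Proof.
move=> [mh bh].
pose g x := h (X x).
have mg : measurable_fun setT g by exact: measurableT_comp.
have XN x : X (- x) = - X x.
  have MM : - M <= M by rewrite (le_trans _ M0)// oppr_le0.
  by rewrite /clamp max_minr (max_idPr MM) oppr_max oppr_min opprK minC (maxC (- x)).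
transitivity (\int[rho]_x g (- x)).
  by apply: eq_Rintegral => x _; rewrite /g XN.
apply: (symmetric_Rintegral rhoB mg).
by have [K hK] := bh M; exists K => x; exact: hK.
Qed.

Lemma cwG_mean_field s : cwG rho beta s = mean_field rho X beta s.
Proof.
rewrite /cwG /mean_field /cumulant /spin_moment (Espin_clampE suppM).
  by congr (_ - ln _); congr Espin; apply/funext => x; rewrite expr0 mul1r.
exact: (locally_bounded_exp (beta * s)).1.
Qed.

Lemma cwGN s : cwG rho beta (- s) = cwG rho beta s.
Proof. by rewrite !cwG_mean_field (mean_fieldN mX bX symX). Qed.

Lemma curie_weiss_expect (n0 : nat) (lam : R) (h : R -> R) :
  locally_bounded h -> (forall w, 0 <= h w) ->
  (\int[curie_weiss rho beta n0.+1]_x (h (lam * spin_sum x / n0.+1%:R))%:E =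
   (cw_expect rho X n0 beta lam (fun _ w => h w))%:E)%E.
Proof.
move=> lh h0; rewrite (cw_expect_marginal rho lam n0 mX bX b0 lh).
have lh' : locally_bounded (fun y => h (lam * y / n0.+1%:R)).
  apply: (locally_bounded_comp lh); apply: locally_boundedM; last exact: locally_bounded_cst.
  by apply: locally_boundedM; [exact: locally_bounded_cst|exact: locally_bounded_id].
exact: (curie_weiss_integral M0 suppM b0 rhoB (ltn0Sn n0) lh' (fun y => h0 _)).
Qed.

(** The limit family [F] is left abstract so that one statement serves both the normal law and
    [Fhat]. Its formula is required for positive v only; the bounds 0 and 1 handle v = 0. *)
Lemma curie_weiss_rate (c e K : R) : 0 < c -> 0 < e ->
  (forall s, `|s| <= e -> `|cwG rho beta s - c * s ^+ (2 * k)| <= K * `|s| ^+ (2 * k).+1) ->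
  (forall s, s != 0 -> 0 < cwG rho beta s) ->
  exists C : R, 0 <= C /\ forall (n0 : nat) (lam : R), 1 <= lam -> lam ^+ (2 * k) = n0.+1%:R ->
  let P := curie_weiss rho beta n0.+1 in
  let W := fun x => lam * spin_sum x / n0.+1%:R in
  let m := fine ('E_P[fun x => (W x ^+ (2 * k))%R])%E in
  forall F : R -> R -> \bar R,
    (forall v z, 0 <= v -> (0 <= F v z <= 1)%E) ->
    (forall v z, 0 < v -> F v z = (cumul k' v^-1 z / total k' v^-1)%:E) ->
    (cdf_dist P W (F m) <= (C * ((lam ^+ (2 * k).-1)^-1 + (lam ^+ 2)^-1))%:E)%E.
Proof.
move=> c0 e0 Gexp Gpos.
have spin1 : spin_moment rho X 2 0 = 1.
  rewrite /spin_moment -(Espin_clampE suppM); last first.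
    by apply: measurable_funM; [exact: exprn_measurable|exact: (locally_bounded_exp 0).1].
  rewrite /Rintegral; under eq_integral do rewrite mul0r expR0 mulr1.
  by rewrite var1.
have Gexp' s : `|s| <= e ->
    `|mean_field rho X beta s - c * s ^+ (2 * k)| <= K * `|s| ^+ (2 * k).+1.
  by rewrite -cwG_mean_field; exact: Gexp.
have Gpos' s : s != 0 -> 0 < mean_field rho X beta s.
  by rewrite -cwG_mean_field; exact: Gpos.
have [C HC] := cw_approximation mX M0 bX symX spin1 b0 c0 e0 Gexp' Gpos'.
exists `|C|; split=> // n0 lam lam1 lamk P W m F F01 FE.
have lam0 : 0 < lam by exact: lt_le_trans lam1.
have lpow p : locally_bounded (fun w : R => w ^+ p).
  by apply: locally_boundedX; exact: locally_bounded_id.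
have mE : m = cw_expect rho X n0 beta lam (fun _ w => w ^+ (2 * k)).
  rewrite /m unlock (curie_weiss_expect n0 lam (lpow (2 * k)%N))//.
  by move=> w; rewrite exprM exprn_ge0 ?sqr_ge0.
have m0 : 0 <= m.
  rewrite fine_ge0// unlock; apply: integral_ge0 => x _.
  by rewrite lee_fin exprM exprn_ge0 ?sqr_ge0.
have mW : measurable_fun setT W.
  by apply: measurable_funM => //; apply: measurable_funM => //; exact: measurable_spin_sum.
have mA z : measurable [set x | W x <= z].
  rewrite (_ : [set x | W x <= z] = W @^-1` `]-oo, z]%classic); last first.
    by apply/seteqP; split => x /=; rewrite in_itv.
  by rewrite -[X in measurable X]setTI; apply: mW => //; exact: measurable_itv.
have WE z : P [set x | W x <= z] = (cw_expect rho X n0 beta lam (fun _ w => \1_(`]-oo, z]) w))%:E.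
  have lI : locally_bounded (\1_(`]-oo, z] : set R) : R -> R).
    by apply: locally_bounded_indic; exact: measurable_itv.
  rewrite -(curie_weiss_expect n0 lam lI); last by move=> w; rewrite indicE.
  by rewrite -(setIT [set x | W x <= z]) -integral_indic//.
have rate0 : 0 <= (lam ^+ (2 * k).-1)^-1 + (lam ^+ 2)^-1.
  by rewrite addr_ge0// invr_ge0 exprn_ge0// ltW.
apply: ge_ereal_sup => _ [z _ <-].
have [big|[mpos small]] := HC n0 lam lam1 lamk.
  (* Here the claimed bound is at least 1, while two numbers in [0, 1] differ by at most 1. *)
  apply: (@le_trans _ _ 1%E).
    have /andP[f0 f1] := F01 m z m0.
    have p0 : (0 <= P [set x | (W x <= z)%R])%E by exact: measure_ge0.
    have p1 : (P [set x | (W x <= z)%R] <= 1)%E by exact: probability_le1.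
    move: p0 p1; rewrite WE; case: (F m z) f0 f1 => [f||]//.
    rewrite -EFinB abse_EFin !lee_fin => f0 f1 p0 p1.
    by rewrite ler_norml; apply/andP; split; lra.
  rewrite lee_fin (le_trans big)// mulrDr.
  apply: (@le_trans _ _ (`|C| / lam ^+ 2)).
    by rewrite ler_wpM2r ?ler_norm// invr_ge0 exprn_ge0// ltW.
  by rewrite lerDr mulr_ge0// invr_ge0 exprn_ge0// ltW.
rewrite -mE in mpos small.
rewrite FE// WE -EFinB abse_EFin lee_fin (le_trans (small z))//.
by rewrite ler_wpM2r// ler_norm.
Qed.

End curie_weiss_rate.

Theorem theorem1p7 (R : realType) (rho : probability (measurableTypeR R) R)
    (beta alpha mu : R) (k : nat) :
  classGHS rho ->
  (\int[rho]_x (x ^+ 2)%:E = 1)%E ->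
  0 < beta ->
  unique_global_min (cwG rho beta) alpha ->
  min_type (cwG rho beta) alpha k mu ->
  bounded_support rho ->
  (k = 1%N ->
    exists C : R, forall n : nat, (0 < n)%N ->
      let P := curie_weiss rho beta n in
      let W := fun x => spin_sum x / Num.sqrt n%:R in
      let m := fine ('E_P[fun x => (W x ^+ 2)%R])%E in
      (cdf_dist P W (normal_cdf m) <= (C * n%:R `^ (- 2^-1))%:E)%E) /\
  ((2 <= k)%N ->
    exists C : R, forall n : nat, (0 < n)%N ->
      let P := curie_weiss rho beta n in
      let W := fun x =>
        (spin_sum x - n%:R * alpha) / n%:R `^ (1 - (2 * k)%:R^-1) in
      let m := fine ('E_P[fun x => (W x ^+ (2 * k))%R])%E in
      (cdf_dist P W (Fhat k m) <= (C * n%:R `^ (- k%:R^-1))%:E)%E).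
Proof.
move=> [rhoB _] var1 b0 Gmin [k0 mu0 GO] [M1 suppM1].
pose M := Num.max M1 0; have M0 : 0 <= M by rewrite le_max lexx orbT.
have suppM : {ae rho, forall x, `|x| <= M}.
  apply: (@filterS _ _ (ae_filter_ringOfSetsType rho) _ _ _ suppM1) => x xM.
  by rewrite le_max xM.
case: k k0 GO => // k' _ GO.
(* [cwG] is even, so otherwise - alpha would be a second global minimum. *)
have alpha0 : alpha = 0.
  apply/eqP; apply/negP => /negP a0; have aN : - alpha != alpha.
    by apply: contraNneq a0 => /eqP; rewrite -subr_eq0 -opprD oppr_eq0 -mulr2n mulrn_eq0.
  by have := Gmin _ aN; rewrite (cwGN beta rhoB M0 suppM) ltxx.
move: Gmin GO; rewrite {}alpha0 => Gmin GO.
have G0 : cwG rho beta 0 = 0.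
  by rewrite (cwG_mean_field beta suppM) mean_field0.
have Gpos s : s != 0 -> 0 < cwG rho beta s by move=> /Gmin; rewrite G0.
pose c := mu / (2 * k'.+1)`!%:R.
have c0 : 0 < c by rewrite divr_gt0// ltr0n fact_gt0.
have [e [K [e0 Gexp]]] : exists e K : R, 0 < e /\ forall s, `|s| <= e ->
    `|cwG rho beta s - c * s ^+ (2 * k'.+1)| <= K * `|s| ^+ (2 * k'.+1).+1.
  have /eqO_exP[K K0 /nbhs_ballP[e/= e0 H]] := GO.
  (* Half the radius, since the neighbourhood is an open ball and the bound is wanted on a closed
     interval. *)
  exists (e / 2), K; split; first by rewrite divr_gt0.
  move=> s se; have := H s; rewrite /ball/= sub0r normrN G0 add0r subr0 normrX mulrAC.
  by apply; rewrite (le_lt_trans se)// ltr_pdivrMr// ltr_pMr// ltr1n.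
have [C [C0 HC]] := curie_weiss_rate rhoB b0 var1 M0 suppM c0 e0 Gexp Gpos.
split=> k2.
  have {k2} k'0 : k' = 0%N by case: k2.
  subst k'.
  (* With lam = sqrt n and r = 1, lam^-2 <= lam^-1 = n^(-1/2); two equal terms give the factor 2. *)
  exists (C * 2) => -[//|n0] _; cbv zeta.
  set W := (fun x => spin_sum x / _).
  have N1 : 1 <= n0.+1%:R :> R by rewrite ler1n.
  have N0 : 0 < n0.+1%:R :> R by [].
  have s2 : Num.sqrt n0.+1%:R ^+ (2 * 1) = n0.+1%:R :> R by rewrite sqr_sqrtr.
  have s1 : 1 <= Num.sqrt n0.+1%:R :> R by rewrite -[leLHS]sqrtr1 ler_sqrt.
  have WE : W = fun x => Num.sqrt n0.+1%:R * spin_sum x / n0.+1%:R.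
    have sn0 : Num.sqrt n0.+1%:R != 0 :> R by rewrite gt_eqF// (lt_le_trans _ s1).
    apply/funext => x; rewrite /W -[X in _ = _ / X]s2 muln1.
    by move: (Num.sqrt _) sn0 => s sn0; field.
  have := HC n0 _ s1 s2 (@normal_cdf R) (fun v z _ => normal_cdf_bounds v z) (@normal_cdf_cumul R).
  move=> H; rewrite WE; apply: (le_trans H); rewrite lee_fin -mulrA ler_wpM2l//.
  rewrite powRN powR12_sqrt// expr1 mulr_natl mulr2n lerD2l.
  rewrite lef_pV2 ?posrE ?exprn_gt0 ?(lt_le_trans ltr01 s1)//.
  by rewrite expr2 ler_peMl// (le_trans _ s1).
(* Now r = 2k - 1 >= 3, so lam^-r <= lam^-2 = n^(-1/k). *)
exists (C * 2) => -[//|n0] _; cbv zeta.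
set W := (fun x => (spin_sum x - _) / _).
have N0 : 0 < n0.+1%:R :> R by [].
pose lam : R := n0.+1%:R `^ (2 * k'.+1)%:R^-1.
have kn : (2 * k'.+1)%:R != 0 :> R by rewrite pnatr_eq0.
have lam0 : 0 < lam by exact: powR_gt0.
have lam1 : 1 <= lam.
  by rewrite -[leLHS](powRr0 n0.+1%:R) ler_powR ?ler1n// invr_ge0.
have lamk : lam ^+ (2 * k'.+1) = n0.+1%:R.
  by rewrite -powR_mulrn ?ltW// -powRrM mulVf// powRr1.
(* The normalisation n^(1 - 1/(2k)) is n / lam. *)
have WE : W = fun x => lam * spin_sum x / n0.+1%:R.
  apply/funext => x; rewrite /W mulr0 subr0 powRD; last by rewrite (gt_eqF N0) implybT.
  by rewrite powRr1// powRN -/lam invfM invrK; ring.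
have := HC n0 lam lam1 lamk (@Fhat R k'.+1) (fun v z v0 => Fhat_bounds k' z v0) (fun v z v0 => Fhat_cumul k' z v0).
move=> H; rewrite WE; apply: (le_trans H); rewrite lee_fin -mulrA ler_wpM2l//.
have -> : n0.+1%:R `^ (- k'.+1%:R^-1) = (lam ^+ 2)^-1.
  rewrite powRN -powR_mulrn ?ltW// -powRrM; congr (_ `^ _)^-1.
  by rewrite natrM; field.
rewrite mulr_natl mulr2n lerD2r lef_pV2 ?posrE ?exprn_gt0// ler_weXn2l//.
by rewrite mulnS ltnS muln_gt0.
Qed.
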